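(* Let $\Gamma=(\Gamma(1),\ldots,\Gamma(d))$ be a $d$-dimensional analytic fractional Brownian motion with Hurst parameter $\alpha\in(0,1/2)$, let $\Gamma^{\varepsilon}$ ($\varepsilon>0$) be its regular approximation $\Gamma^\varepsilon_z=\Gamma_{z+\imath\varepsilon}$, and let $\Omega$ be a bounded neighborhood of $0$ in $\bar\Pi^+$. Let $n=\lfloor 1/\alpha\rfloor$, let $\mathbf{\Gamma}^{\mathbf{k},\varepsilon}$, $k=2,\ldots,n$, be the regularized iterated integrals $$\mathbf{\Gamma}^{\mathbf{k},\varepsilon}_{ts}(i_1,\ldots,i_k)=\int_{[s,t]} d\Gamma^{\varepsilon}_{u_1}(i_1)\int_{[s,u_1]} d\Gamma^{\varepsilon}_{u_2}(i_2)\cdots\int_{[s,u_{k-1}]} d\Gamma^{\varepsilon}_{u_k}(i_k),\qquad s,t\in\Omega,\ (i_1,\dots,i_k)\in\{1,\dots,d\}^k,$$ and let $0<\gamma<\alpha$. Then: (1) For any $p\ge 1$, as $\varepsilon\to 0$, the truncated multiplicative functional $(\Gamma^{\varepsilon},\mathbf{\Gamma}^{\mathbf{2},\varepsilon},\ldots,\mathbf{\Gamma}^{\mathbf{n},\varepsilon})$ converges in $L^p\big(\mathcal U;\,\mathcal C_1^{\gamma}(\Omega;\mathbb C^d)\times\mathcal C_2^{2\gamma}(\Omega;(\mathbb C^{d})^{\otimes 2})\times\cdots\times\mathcal C_2^{n\gamma}(\Omega;(\mathbb C^{d})^{\otimes n})\big)$ to an $n$-tuple $(\Gamma,\mathbf{\Gamma}^{\mathbf{2}},\ldots,\mathbf{\Gamma}^{\mathbf{n}})$,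 where $\Gamma$ is the analytic fractional Brownian motion. (2) For $k=2,\ldots,n$, the iterated integral $\mathbf{\Gamma}^{\mathbf{k}}$ is an element of $\mathcal C_2^{k\gamma}(\Omega;(\mathbb C^{d})^{\otimes k})$, and it also belongs to $\mathcal C_2^{\mathrm m,\gamma}(\Omega;(\mathbb C^{d})^{\otimes k})$. (3) The truncated multiplicative functional $(\Gamma,\mathbf{\Gamma}^{\mathbf{2}},\ldots,\mathbf{\Gamma}^{\mathbf{n}})$ satisfies the following multiplicative and geometric relations, where $\mathbf{\Gamma}^{\mathbf 1}_{ts}:=\Gamma_t-\Gamma_s$. For every $k\le n$, $(i_1,\ldots,i_k)\in\{1,\ldots,d\}^k$ and $t,u,s\in\Omega$, $$(\delta\mathbf{\Gamma}^{\mathbf k})_{tus}(i_1,\ldots,i_k)=\sum_{j=1}^{k-1}\mathbf{\Gamma}^{\mathbf j}_{tu}(i_1,\ldots,i_j)\,\mathbf{\Gamma}^{\mathbf{k-j}}_{us}(i_{j+1},\ldots,i_k);$$ and for all $k,m\ge1$ with $k+m\le n$, all tuples $\bar\imath=(i_1,\dots,i_k)$, $\bar\jmath=(j_1,\dots,j_m)$ with entries in $\{1,\dots,d\}$ and all $s,t\in\Omega$, $$\mathbf{\Gamma}^{\mathbf k}_{ts}(i_1,\ldots,i_k)\,\mathbf{\Gamma}^{\mathbf m}_{ts}(j_1,\ldots,j_m)=\sum_{\bar l\in \mathrm{Sh}(\bar\imath,\bar\jmath)}\mathbf{\Gamma}^{\mathbf{k+m}}_{ts}(l_1,\ldots,l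_{k+m}).$$
   Context: $\Pi^+=\{z\in\mathbb C:\Im z>0\}$ and $\bar\Pi^+=\{z\in\mathbb C:\Im z\ge0\}$; $[s,t]$ denotes the straight segment from $s$ to $t$. Analytic fractional Brownian motion (afBm) with Hurst parameter $\alpha\in(0,1/2)$: on a complete probability space $(\mathcal U,\mathcal F,\mathbf P)$, let $\Gamma'=\{\Gamma'_z;z\in\Pi^+\}$ be the centered complex Gaussian process, with analytic paths, such that $\mathbf E[\Gamma'_z\Gamma'_w]=0$ and $\mathbf E[\Gamma'_z\overline{\Gamma'_w}]=\frac{\alpha(1-2\alpha)}{2\cos(\pi\alpha)}(-\imath(z-\bar w))^{2\alpha-2}$ for $z,w\in\Pi^+$ (principal determination of the power, defined on $\mathbb C\setminus\mathbb R_-$). The scalar afBm is $\Gamma_z=\int_0^z\Gamma'_u\,du$ (integral along any path from $0$ to $z$ inside $\Pi^+$), extended by continuity to $\bar\Pi^+$. A $d$-dimensional afBm is $\Gamma=(\Gamma(1),\ldots,\Gamma(d))$ with $d$ independent scalar afBm components. For $\varepsilon>0$, $\Gamma^\varepsilon_z=\Gamma_{z+\imath\varepsilon}$, which is analytic in a neighborhood of $\bar\Pi^+$, so iterated integrals are Riemann integrals along segments. Increments: for a finite-dimensional complex normed space $V$, $\mathcal C_k(\Omega;V)$ is the set of $g:\Omega^k\to V$ with $g_{t_1\cdots t_k}=0$ whenever $t_i=t_{i+1}$ for some $i\le k-1$. For $g\in\mathcal C_1$, $(\delta g)_{ts}=g_t-g_s$; for $h\in\mathcal C_2$, $(\delta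 h)_{tus}=h_{ts}-h_{tu}-h_{us}$. For $\mu>0$, $\mathcal C_2^\mu(\Omega;V)$ is the set of $f\in\mathcal C_2(\Omega;V)$ with $\sup_{s,t\in\Omega}|f_{ts}|/|t-s|^\mu<\infty$, with this norm; $\mathcal C_1^\mu(\Omega;V)$ is the set of $f:\Omega\to V$ with $\delta f\in\mathcal C_2^\mu(\Omega;V)$, with the Hölder semi-norm of $\delta f$. $\mathcal C_j^{\mathrm m,\beta}(\Omega;V)$ is the set of $h\in\mathcal C_j(\Omega;V)$ such that $$\sup\Big\{\frac{|h_{s_1+\imath\varepsilon,\ldots,s_j+\imath\varepsilon}-h_{s_1,\ldots,s_j}|}{\varepsilon^\beta}:\ \varepsilon\in(0,1],\ s_1,\ldots,s_j\in\Omega\Big\}<\infty$$ (over those $\varepsilon$ for which the shifted points lie in the domain of $h$). $L^p(\mathcal U;E)$ is the space of $E$-valued random variables whose norm has finite $p$-th moment. $\mathrm{Sh}(\bar\imath,\bar\jmath)$ is the set of permutations of the indices contained in the concatenated tuple $(\bar\imath,\bar\jmath)$ which do not change the orderings of $\bar\imath$ and $\bar\jmath$ (shuffles). *)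

(* Defs.v *)
From HB Require Import structures.
From mathcomp Require Import all_boot all_order all_algebra all_fingroup.
From mathcomp Require Import all_classical all_reals all_analysis.
From mathcomp Require Import complex.

Set Implicit Arguments.
Unset Strict Implicit.
Unset Printing Implicit Defensive.

Import Order.TTheory GRing.Theory Num.Theory.
Import numFieldNormedType.Exports.

Local Open Scope classical_set_scope.
Local Open Scope ring_scope.
Local Open Scope complex_scope.

(* Topological notions on the complex plane R[i] are taken through the regular
   module (R[i])^o, whose topology is the one of the modulus. *)

Section ComplexPlane.
Variable R : realType.

Definition cmod (z : R[i]) : R := Normc.normc z.

Definition ishift (eps : R) (z : R[i]) : R[i] := z + (0 +i* eps).

Definition upper_half : set R[i] := [set z | 0 < complex.Im z].
Definition closed_upper_half : set R[i] := [set z | 0 <= complex.Im z].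

(* Principal argument, in ]-pi, pi] (for z != 0). *)
Definition Carg (z : R[i]) : R :=
  let theta := acos (complex.Re z / cmod z) in
  if 0 <= complex.Im z then theta else - theta.

(* Principal determination of z ^ a for a real exponent a. *)
Definition Cpow (z : R[i]) (a : R) : R[i] :=
  (cmod z `^ a)%:C * (cos (a * Carg z) +i* sin (a * Carg z)).

Definition analytic_on (D : set R[i]) (f : R[i] -> R[i]) : Prop :=
  forall z0, D z0 -> exists2 r : R, 0 < r &
    exists a : nat -> R[i], forall z, cmod (z - z0) < r ->
      (series (fun n => a n * (z - z0) ^+ n : (R[i])^o) @ \oo
         --> (f z : (R[i])^o)).

Definition Cderive (f : R[i] -> R[i]) (z : R[i]) : R[i] :=
  derive1 (f : (R[i])^o -> (R[i])^o) z.

Definition seg_param (s t : R[i]) (x : R) : R[i] := s + x%:C * (t - s).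

Definition seg_integrable (f : R[i] -> R[i]) (s t : R[i]) : Prop :=
  lebesgue_measure.-integrable `[0, 1]
    (fun x : R => (complex.Re (f (seg_param s t x)))%:E) /\
  lebesgue_measure.-integrable `[0, 1]
    (fun x : R => (complex.Im (f (seg_param s t x)))%:E).

Definition seg_int (f : R[i] -> R[i]) (s t : R[i]) : R[i] :=
  (t - s) *
  ((\int[lebesgue_measure]_(x in `[0, 1]) complex.Re (f (seg_param s t x)))
   +i* (\int[lebesgue_measure]_(x in `[0, 1]) complex.Im (f (seg_param s t x)))).

(* iter_int f [:: i_1; ..; i_k] t s is the iterated integral, with the
   argument order (t, s) of increments indexed as "ts":
   int_[s,t] df_{i_1}(u_1) int_[s,u_1] df_{i_2}(u_2) ... int_[s,u_{k-1}] df_{i_k}(u_k). *)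
Fixpoint iter_int (I : Type) (f : I -> R[i] -> R[i]) (w : seq I)
    (t s : R[i]) : R[i] :=
  if w is i :: w' then
    seg_int (fun u => Cderive (f i) u * iter_int f w' u s) s t
  else 1.

End ComplexPlane.

Section Afbm.
Context {R : realType} {disp : measure_display} {T : measurableType disp}.
Variable P : probability T R.

(* Degenerate (zero) Gaussian variables are allowed. *)
Definition centered_gaussian (X : T -> R) : Prop :=
  measurable_fun setT X /\
  ({ae P, forall w, X w = 0} \/
   exists2 sigma : R, 0 < sigma &
     forall B, measurable B -> P (X @^-1` B) = normal_prob 0 sigma B).

Definition cmeasurable (X : T -> R[i]) : Prop :=
  measurable_fun setT (fun w => complex.Re (X w)) /\
  measurable_fun setT (fun w => complex.Im (X w)).

(* The real and imaginary parts of the process are jointly Gaussian: the real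
   part of every complex linear combination is Gaussian. A process is a map
   X w z, where X w is the path of the outcome w. *)
Definition centered_complex_gaussian_process (D : set R[i])
    (X : T -> R[i] -> R[i]) : Prop :=
  (forall z, D z -> cmeasurable (X ^~ z)) /\
  forall (m : nat) (z c : 'I_m -> R[i]), (forall j, D (z j)) ->
    centered_gaussian (fun w => complex.Re (\sum_(j < m) c j * X w (z j))).

Definition Cexpectation (X : T -> R[i]) : R[i] :=
  (\int[P]_w complex.Re (X w)) +i* (\int[P]_w complex.Im (X w)).

Definition afBm_derivative (alpha : R) (X' : T -> R[i] -> R[i]) : Prop :=
  [/\ centered_complex_gaussian_process (upper_half (R:=R)) X',
      forall w, analytic_on (upper_half (R:=R)) (X' w),
      forall z1 z2, upper_half z1 -> upper_half z2 ->
        Cexpectation (fun w => X' w z1 * X' w z2) = 0 &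
      forall z1 z2, upper_half z1 -> upper_half z2 ->
        Cexpectation (fun w => X' w z1 * conjc (X' w z2)) =
        (alpha * (1 - 2 * alpha) / (2 * cos (pi * alpha)))%:C
          * Cpow (- (0 +i* 1) * (z1 - conjc z2)) (2 * alpha - 2)].

(* The path from 0 to z is the segment [0, z], which lies in the open half
   plane except for its origin; the integral converges, and the extension to
   the closed half plane is continuous, almost surely only. *)
Definition scalar_afBm (alpha : R) (X : T -> R[i] -> R[i]) : Prop :=
  (forall z, closed_upper_half z -> cmeasurable (X ^~ z)) /\
  exists2 X' : T -> R[i] -> R[i], afBm_derivative alpha X' &
    {ae P, forall w,
      (forall z, upper_half z ->
         seg_integrable (X' w) 0 z /\ X w z = seg_int (X' w) 0 z) /\
      {within (closed_upper_half (R:=R) : set (R[i])^o),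
         continuous (X w : (R[i])^o -> (R[i])^o)}}.

Definition process_sigma (D : set R[i]) (X : T -> R[i] -> R[i]) :
    set (set T) :=
  <<s [set A | exists2 z, D z & exists2 B : set R, measurable B &
       A = (fun w => complex.Re (X w z)) @^-1` B \/
       A = (fun w => complex.Im (X w z)) @^-1` B] >>.

(* Mutual independence; subfamilies are covered by taking some E i = setT. *)
Definition independent_processes (D : set R[i]) (d : nat)
    (X : 'I_d -> T -> R[i] -> R[i]) : Prop :=
  forall E : 'I_d -> set T, (forall i, process_sigma D (X i) (E i)) ->
    fine (P (\bigcap_i E i)) = \prod_(i < d) fine (P (E i)).

Definition afBm (alpha : R) (d : nat) (X : 'I_d -> T -> R[i] -> R[i]) : Prop :=
  (forall i, scalar_afBm alpha (X i)) /\
  independent_processes (closed_upper_half (R:=R)) X.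

End Afbm.

Section Increments.
Variable R : realType.

(* C^I with the max norm: I = 'I_d gives C^d and I = k.-tuple 'I_d gives the
   coordinates of the k-th tensor power of C^d in its canonical basis. *)
Definition vnorm (I : finType) (v : {ffun I -> R[i]}) : R :=
  \big[Num.max/0]_(i : I) cmod (v i).

Definition delta1 (V : zmodType) (g : R[i] -> V) (t s : R[i]) : V := g t - g s.

Definition delta2 (V : zmodType) (h : R[i] -> R[i] -> V) (t u s : R[i]) : V :=
  h t s - h t u - h u s.

Definition hoelder_norm (mu : R) (Omega : set R[i]) (I : finType)
    (h : R[i] -> R[i] -> {ffun I -> R[i]}) : \bar R :=
  ereal_sup [set x | exists s t, [/\ Omega s, Omega t, s != t &
    x = (vnorm (h t s) / cmod (t - s) `^ mu)%:E]].

Definition in_C2 (Omega : set R[i]) (I : finType)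
    (h : R[i] -> R[i] -> {ffun I -> R[i]}) : Prop :=
  forall t, Omega t -> h t t = 0.

Definition in_C1mu (mu : R) (Omega : set R[i]) (I : finType)
    (g : R[i] -> {ffun I -> R[i]}) : Prop :=
  (hoelder_norm mu Omega (delta1 g) < +oo)%E.

Definition in_C2mu (mu : R) (Omega : set R[i]) (I : finType)
    (h : R[i] -> R[i] -> {ffun I -> R[i]}) : Prop :=
  in_C2 Omega h /\ (hoelder_norm mu Omega h < +oo)%E.

Definition in_C2m (beta : R) (Omega : set R[i]) (I : finType)
    (h : R[i] -> R[i] -> {ffun I -> R[i]}) : Prop :=
  in_C2 Omega h /\
  (ereal_sup [set x | exists (eps : R) (s1 s2 : R[i]),
     [/\ (0 < eps <= 1)%R, Omega s1 /\ Omega s2,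
         Omega (ishift eps s1) /\ Omega (ishift eps s2) &
         x = (vnorm (h (ishift eps s1) (ishift eps s2) - h s1 s2)
              / eps `^ beta)%:E]] < +oo)%E.

Definition tensors (d : nat) : Type :=
  forall k : nat, R[i] -> R[i] -> {ffun k.-tuple 'I_d -> R[i]}.

(* Elements (g, h) of the product of C_1^gamma and of the C_2^(k gamma),
   2 <= k <= n; the components of h of other levels are irrelevant. *)
Definition mult_functional (d : nat) : Type :=
  ((R[i] -> {ffun 'I_d -> R[i]}) * tensors d)%type.

Definition mf_sub (d : nat) (x y : mult_functional d) : mult_functional d :=
  (fun z => x.1 z - y.1 z, fun k t s => x.2 k t s - y.2 k t s).

Definition mf_space (d n : nat) (gamma : R) (Omega : set R[i]) :
    set (mult_functional d) :=
  [set x | in_C1mu gamma Omega x.1 /\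
           forall k, (2 <= k <= n)%N -> in_C2mu (k%:R * gamma) Omega (x.2 k)].

Definition mf_norm (d n : nat) (gamma : R) (Omega : set R[i])
    (x : mult_functional d) : \bar R :=
  (hoelder_norm gamma Omega (delta1 x.1) +
   \sum_(2 <= k < n.+1) hoelder_norm (k%:R * gamma) Omega (x.2 k))%E.

Definition mf_open (d n : nat) (gamma : R) (Omega : set R[i])
    (U : set (mult_functional d)) : Prop :=
  U `<=` mf_space n gamma Omega /\
  forall x, U x -> exists2 r : R, 0 < r &
    forall y, mf_space n gamma Omega y ->
      (mf_norm n gamma Omega (mf_sub y x) < r%:E)%E -> U y.

(* Picks the tensor level from the length of the word v. *)
Definition word_coord (d : nat) (h : tensors d) (t s : R[i]) (v : seq 'I_d) : R[i] :=
  h (size v) t s (in_tuple v).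

(* The permutation sg sends the entry at position p of a concatenated tuple to
   the position sg p, and keeps the orders of the first k and last m entries. *)
Definition is_shuffle (k m : nat) (sg : 'S_(k + m)) : bool :=
  [forall a : 'I_k, forall b : 'I_k,
     (a < b)%N ==> (sg (lshift m a) < sg (lshift m b))%N] &&
  [forall a : 'I_m, forall b : 'I_m,
     (a < b)%N ==> (sg (rshift k a) < sg (rshift k b))%N].

Definition permute_tuple (A : Type) (N : nat) (sg : 'S_N) (x : N.-tuple A) :
    N.-tuple A :=
  [tuple tnth x ((sg^-1)%g q) | q < N].

End Increments.

Section Lp.
Context {R : realType} {disp : measure_display} {T : measurableType disp}.
Variable P : probability T R.
Variables (d n : nat) (gamma : R) (Omega : set R[i]).

(* Random variables are Borel measurable, and defined almost surely. *)
Definition in_Lp (p : R) (X : T -> mult_functional R d) : Prop :=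
  [/\ {ae P, forall w, mf_space n gamma Omega (X w)},
      forall U, mf_open n gamma Omega U -> measurable (X @^-1` U) &
      (Lnorm P p%:E (fun w => mf_norm n gamma Omega (X w)) < +oo)%E].

(* The space is not separable, so that the measurability of the difference is
   not automatic. *)
Definition cvg_Lp (p : R) (Xeps : R -> T -> mult_functional R d)
    (X : T -> mult_functional R d) : Prop :=
  [/\ forall eps, 0 < eps -> in_Lp p (Xeps eps),
      in_Lp p X,
      forall eps, 0 < eps -> in_Lp p (fun w => mf_sub (Xeps eps w) (X w)) &
      (fun eps : R => Lnorm P p%:E
         (fun w => mf_norm n gamma Omega (mf_sub (Xeps eps w) (X w))))
        @ 0^'+ --> 0%E].

End Lp.

Section Regularization.
Variables (R : realType) (d : nat).

Definition shift_path (eps : R) (f : R[i] -> R[i]) (z : R[i]) : R[i] :=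
  f (ishift eps z).

Definition reg_functional (eps : R) (f : 'I_d -> R[i] -> R[i]) :
    mult_functional R d :=
  (fun z => [ffun i => shift_path eps (f i) z],
   fun k t s => [ffun v : k.-tuple 'I_d =>
                   iter_int (fun i => shift_path eps (f i)) v t s]).

Definition nbhs0_closed_upper_half (Omega : set R[i]) : Prop :=
  Omega `<=` closed_upper_half (R:=R) /\
  within (closed_upper_half (R:=R) : set (R[i])^o) (nbhs (0 : (R[i])^o)) Omega.

End Regularization.

(* Main.v *)
Require Import Defs.
From HB Require Import structures.
From mathcomp Require Import all_boot all_order all_algebra all_fingroup.
From mathcomp Require Import all_classical all_reals all_analysis.
From mathcomp Require Import complex.
From mathcomp Require Import measurable_realfun zify ring lra.

Set Implicit Arguments.
Unset Strict Implicit.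
Unset Printing Implicit Defensive.

Import Order.TTheory GRing.Theory Num.Theory.
Import numFieldNormedType.Exports.

Local Open Scope classical_set_scope.
Local Open Scope ring_scope.
Local Open Scope complex_scope.

(* The covariance bounds the moments of [Gamma'_z] by powers of [Im z]. Cauchy's formula on a
   Whitney decomposition of the half plane turns this into a random constant [M], with as many
   moments as wanted, such that [|Gamma'_z| <= M (Im z)^(g - 1)] near [0], for any [g < alpha].
   The rest is pathwise. Iterated integrals of [Gamma'] do not depend on the path, and along a path
   which goes up by about [|t - s|], then across, then down, they are at most
   [(6 M / g |t - s|^g)^k]. With Chen's relation this gives a modulus of continuity up to the
   boundary, so that they extend to the closed half plane, the shift by [i eps] being of order
   [eps^g]; interpolating between the two bounds gives the rate of convergence in the
   [gamma]-Hoelder norms, [gamma < g]. Independence of the components plays no role.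
   As the space of functionals is not separable, Borel measurability has to be proved: where the
   random constant is at most [N], the values at a finite net determine a functional up to a
   small error. *)

(** * Calculus of one complex variable *)

(** The variance of [Gamma'_z] blows up like [(Im z)^(2 alpha - 2)], and at height [2^-j] there are
    about [2^j] Whitney squares to control at once. Giving up [alpha - g] in the exponent gains a
    factor [2^(-j (alpha - g) 2m)] on moments of order [2m]; this is summable against the number of
    squares once [(alpha - g) 2m >= 2]. The pathwise obstacle is that [y^(g - 1)] is integrable in
    the height [y], but along a horizontal segment at height [y] it only gives [|t - s| y^(g - 1)],
    which explodes at the boundary. The detour cures this: vertical moves cost [|t - s|^g] whatever
    the starting height, and the horizontal move takes place at height at least [|t - s|]. Constants
    at level [k] are of order [M^k], so that convergence in [L^p] uses moments of [M] of order
    beyond [n p]. The Hoelder norms are suprema over uncountable families; their integrals are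
    therefore estimated through measurable majorants. *)

Section ComplexModulus.
Variable R : realType.
Implicit Types (z w : R[i]) (x y : R).

Lemma cReD z w : complex.Re (z + w) = complex.Re z + complex.Re w.
Proof. by case: z; case: w. Qed.
Lemma cImD z w : complex.Im (z + w) = complex.Im z + complex.Im w.
Proof. by case: z; case: w. Qed.
Lemma cReN z : complex.Re (- z) = - complex.Re z.
Proof. by case: z. Qed.
Lemma cImN z : complex.Im (- z) = - complex.Im z.
Proof. by case: z. Qed.
Lemma cReB z w : complex.Re (z - w) = complex.Re z - complex.Re w.
Proof. by rewrite cReD cReN. Qed.
Lemma cImB z w : complex.Im (z - w) = complex.Im z - complex.Im w.
Proof. by rewrite cImD cImN. Qed.
Lemma cReM z w : complex.Re (z * w) =
  complex.Re z * complex.Re w - complex.Im z * complex.Im w.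
Proof. by case: z; case: w. Qed.
Lemma cImM z w : complex.Im (z * w) =
  complex.Re z * complex.Im w + complex.Im z * complex.Re w.
Proof. by case: z; case: w. Qed.
Definition ReIm := (cReD, cImD, cReN, cImN, cReM, cImM).

Lemma cIm_sum (I : Type) (r : seq I) (Q : pred I) (F : I -> R[i]) :
  complex.Im (\sum_(i <- r | Q i) F i) = \sum_(i <- r | Q i) complex.Im (F i).
Proof. by apply: (big_morph _ cImD). Qed.

Lemma eq_ReIm z w : complex.Re z = complex.Re w ->
  complex.Im z = complex.Im w -> z = w.
Proof. by case: z; case: w => a b c d /= -> ->. Qed.

Lemma cmod_norm z : (cmod z)%:C = `|z|.
Proof. by case: z => a b; rewrite normc_def /cmod. Qed.
Lemma cmod_ge0 z : 0 <= cmod z.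
Proof. by case: z => a b; rewrite /cmod /= sqrtr_ge0. Qed.
Lemma cmod0 : cmod (0 : R[i]) = 0. Proof. exact: Normc.normc0. Qed.
Lemma cmod1 : cmod (1 : R[i]) = 1. Proof. exact: Normc.normc1. Qed.
Lemma cmod_eq0 z : (cmod z == 0) = (z == 0).
Proof. by apply/eqP/eqP => [/Normc.eq0_normc//|->]; exact: cmod0. Qed.
Lemma cmod_gt0 z : (0 < cmod z) = (z != 0).
Proof. by rewrite lt0r cmod_eq0 cmod_ge0 andbT. Qed.
Lemma cmodD z w : cmod (z + w) <= cmod z + cmod w.
Proof. by rewrite -lecR rmorphD /= !cmod_norm ler_normD. Qed.
Lemma cmodN z : cmod (- z) = cmod z.
Proof. by apply/complexI; rewrite !cmod_norm normrN. Qed.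
Lemma cmodM z w : cmod (z * w) = cmod z * cmod w.
Proof. exact: Normc.normcM. Qed.
Lemma cmodV z : cmod z^-1 = (cmod z)^-1.
Proof. exact: Normc.normcV. Qed.
Lemma cmodX z n : cmod (z ^+ n) = cmod z ^+ n.
Proof. by elim: n => [|n IH]; rewrite ?expr0 ?cmod1// !exprS cmodM IH. Qed.
Lemma cmodB z w : cmod (z - w) <= cmod z + cmod w.
Proof. by rewrite (le_trans (cmodD _ _))// cmodN. Qed.
Lemma cmod_distC z w : cmod (z - w) = cmod (w - z).
Proof. by rewrite -cmodN opprB. Qed.
Lemma cmod_distD w z z' : cmod (z - z') <= cmod (z - w) + cmod (w - z').
Proof. by have := cmodD (z - w) (w - z'); rewrite addrA subrK. Qed.
Lemma cmod_real x : cmod x%:C = `|x|.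
Proof. by rewrite /cmod /= expr0n addr0 sqrtr_sqr. Qed.
Lemma cmod_imag x : cmod (0 +i* x) = `|x|.
Proof. by rewrite /cmod /= expr0n add0r sqrtr_sqr. Qed.
Lemma cmod_sum (I : Type) (r : seq I) (Q : pred I) (F : I -> R[i]) :
  cmod (\sum_(i <- r | Q i) F i) <= \sum_(i <- r | Q i) cmod (F i).
Proof.
elim/big_ind2 : _ => [|x1 x2 y1 y2 h1 h2|//]; first by rewrite cmod0.
by rewrite (le_trans (cmodD _ _))// lerD.
Qed.

Lemma cmod_sqr z : cmod z ^+ 2 = complex.Re z ^+ 2 + complex.Im z ^+ 2.
Proof. by case: z => a b; rewrite /cmod /= sqr_sqrtr// addr_ge0// sqr_ge0. Qed.
Lemma cmod_Re z : `|complex.Re z| <= cmod z.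
Proof.
case: z => a b; rewrite /cmod /= -sqrtr_sqr ler_wsqrtr//.
by rewrite lerDl sqr_ge0.
Qed.
Lemma cmod_Im z : `|complex.Im z| <= cmod z.
Proof.
case: z => a b; rewrite /cmod /= -sqrtr_sqr ler_wsqrtr//.
by rewrite lerDr sqr_ge0.
Qed.
Lemma Re_le_cmod z : complex.Re z <= cmod z.
Proof. exact: le_trans (ler_norm _) (cmod_Re z). Qed.
Lemma cmod_le_ReIm z : cmod z <= `|complex.Re z| + `|complex.Im z|.
Proof.
rewrite -(@ler_pXn2r _ 2) ?nnegrE ?cmod_ge0 ?addr_ge0// cmod_sqr.
rewrite -(real_normK (num_real (complex.Re z))) -(real_normK (num_real (complex.Im z))).
by rewrite sqrrD -addrA [_ *+ 2 + _]addrC addrA lerDl mulrn_wge0// mulr_ge0.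
Qed.

Lemma Re_real_mul x z : complex.Re (x%:C * z) = x * complex.Re z.
Proof. by rewrite cReM /= mul0r subr0. Qed.
Lemma Im_real_mul x z : complex.Im (x%:C * z) = x * complex.Im z.
Proof. by rewrite cImM /= mul0r addr0. Qed.

Lemma cmod_rot z : exists2 c : R[i], cmod c = 1 & complex.Re (c * z) = cmod z.
Proof.
have [->|z0] := eqVneq z 0; first by exists 1; rewrite ?cmod1// mulr0 cmod0.
have zp : 0 < cmod z by rewrite cmod_gt0.
exists ((cmod z)^-1%:C * conjc z).
  rewrite cmodM cmod_real ger0_norm ?invr_ge0 ?cmod_ge0//.
  have -> : cmod (conjc z) = cmod z.
    by case: (z) => a b; rewrite /cmod /= sqrrN.
  by rewrite mulVf// gt_eqF.
rewrite -mulrA Re_real_mul.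
have -> : complex.Re (conjc z * z) = cmod z ^+ 2.
  by rewrite cmod_sqr; case: (z) => a b /=; rewrite mulNr opprK !expr2.
by rewrite expr2 mulKf// gt_eqF.
Qed.

End ComplexModulus.

(** * Complex derivatives and the mean value inequality *)

Section ComplexDerivative.
Variable R : realType.
Implicit Types (f g : R[i] -> R[i]) (z l w s t : R[i]).

(** Real tolerances and large inequalities, valid at [h = 0] too: errors can be added and multiplied
    without dividing by [h]. The link with the topological derivative is [cderive_eq]. *)
Definition ccont f z := forall e : R, 0 < e -> exists2 dl : R, 0 < dl &
  forall h, cmod h < dl -> cmod (f (z + h) - f z) <= e.

Definition cderiv f z l := forall e : R, 0 < e -> exists2 dl : R, 0 < dl &
  forall h, cmod h < dl -> cmod (f (z + h) - f z - h * l) <= e * cmod h.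

Lemma cderiv_ccont f z l : cderiv f z l -> ccont f z.
Proof.
move=> fl e e0; have [dl dl0 H] := fl 1 ltr01.
have K0 : 0 < 1 + cmod l by rewrite ltr_pwDl// cmod_ge0.
exists (Num.min dl (e / (1 + cmod l))).
  by rewrite lt_min dl0 divr_gt0.
move=> h; rewrite lt_min ltr_pdivlMr// => /andP[h1 h2].
rewrite -[X in cmod X](subrK (h * l)) (le_trans (cmodD _ _))//.
rewrite (le_trans (lerD (H _ h1) (lexx _)))// cmodM mul1r.
by apply: le_trans (ltW h2); rewrite mulrDr mulr1.
Qed.

Lemma cderiv_near f g z l (r : R) : 0 < r ->
  (forall h, cmod h < r -> f (z + h) = g (z + h)) -> cderiv f z l -> cderiv g z l.
Proof.
move=> r0 fg fl e e0; have [dl dl0 H] := fl e e0.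
exists (Num.min dl r); first by rewrite lt_min dl0.
move=> h; rewrite lt_min => /andP[h1 h2].
rewrite -fg//; have -> : g z = f z by rewrite -[z]addr0 fg// cmod0.
exact: H.
Qed.

Lemma ccont_near f g z (r : R) : 0 < r ->
  (forall h, cmod h < r -> f (z + h) = g (z + h)) -> ccont f z -> ccont g z.
Proof.
move=> r0 fg fl e e0; have [dl dl0 H] := fl e e0.
exists (Num.min dl r); first by rewrite lt_min dl0.
move=> h; rewrite lt_min => /andP[h1 h2].
rewrite -fg//; have -> : g z = f z by rewrite -[z]addr0 fg// cmod0.
exact: H.
Qed.

Lemma cderiv_cst (c : R[i]) z : cderiv (fun=> c) z 0.
Proof. by move=> e e0; exists 1 => // h _; rewrite mulr0 !subr0 subrr cmod0 mulr_ge0 ?cmod_ge0// ltW. Qed.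

Lemma cderiv_id z : cderiv id z 1.
Proof.
move=> e e0; exists 1 => // h _.
have -> : z + h - z - h * 1 = 0 by ring.
by rewrite cmod0 mulr_ge0 ?cmod_ge0// ltW.
Qed.

Lemma cderivD f g z l l' : cderiv f z l -> cderiv g z l' ->
  cderiv (fun u => f u + g u) z (l + l').
Proof.
move=> fl gl e e0; have e2 : 0 < e / 2 by rewrite divr_gt0.
have [d1 d10 H1] := fl _ e2; have [d2 d20 H2] := gl _ e2.
exists (Num.min d1 d2); first by rewrite lt_min d10.
move=> h; rewrite lt_min => /andP[h1 h2].
have -> : f (z + h) + g (z + h) - (f z + g z) - h * (l + l') =
  (f (z + h) - f z - h * l) + (g (z + h) - g z - h * l') by ring.
rewrite (le_trans (cmodD _ _))// (le_trans (lerD (H1 _ h1) (H2 _ h2)))//.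
by rewrite -mulrDl -splitr.
Qed.

Lemma cderivM f g z l l' : cderiv f z l -> cderiv g z l' ->
  cderiv (fun u => f u * g u) z (l * g z + f z * l').
Proof.
move=> fl gl e e0.
pose K := cmod (f z) + cmod l + cmod (g z) + cmod l' + 1.
have [F0 L0 G0 L'0] := And4 (cmod_ge0 (f z)) (cmod_ge0 l) (cmod_ge0 (g z)) (cmod_ge0 l').
have K1 : 1 <= K by rewrite /K; lra.
have K0 : 0 < K by lra.
pose e1 := Num.min (e / (3 * K)) 1.
have e10 : 0 < e1 by rewrite lt_min ltr01 divr_gt0// mulr_gt0.
have e11 : e1 <= 1 by rewrite ge_min lexx orbT.
have e1K : K * e1 <= e / 3.
  rewrite -ler_pdivlMl//; apply: (le_trans (_ : e1 <= e / (3 * K))).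
    by rewrite ge_min lexx.
  by rewrite invfM mulrA [X in _ <= X]mulrC.
have [d1 d10 H1] := fl _ e10; have [d2 d20 H2] := gl _ e10.
exists (Num.min (Num.min d1 d2) (Num.min 1 (e / (3 * K ^+ 2)))).
  by rewrite !lt_min d10 d20 ltr01 divr_gt0// mulr_gt0// exprn_gt0.
move=> h; rewrite !lt_min => /andP[/andP[h1 h2] /andP[h3 h4]].
set A := f (z + h) - f z - h * l; set B := g (z + h) - g z - h * l'.
(* The error of the product is split into three pieces, each at most [e / 3 * |h|]. *)
have -> : f (z + h) * g (z + h) - f z * g z - h * (l * g z + f z * l') =
  h * (h * (l * l')) + (f z + h * l) * B + A * (g z + h * l' + B).
  by rewrite /A /B; ring.
have HA : cmod A <= e1 * cmod h by exact: H1.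
have HB : cmod B <= e1 * cmod h by exact: H2.
have h0 := cmod_ge0 h.
have e1h : e1 * cmod h <= 1 by rewrite mulr_ile1// ltW.
have T1 : cmod (h * (h * (l * l'))) <= e / 3 * cmod h.
  rewrite !cmodM mulrC ler_wpM2r//.
  rewrite ltr_pdivlMr ?mulr_gt0 ?exprn_gt0// in h4.
  have LL : cmod l * cmod l' <= K ^+ 2 by rewrite expr2 ler_pM//; rewrite /K; lra.
  have : cmod h * (cmod l * cmod l') <= cmod h * K ^+ 2 by rewrite ler_wpM2l.
  lra.
have T2 : cmod ((f z + h * l) * B) <= e / 3 * cmod h.
  rewrite cmodM (le_trans (ler_pM (cmod_ge0 _) (cmod_ge0 _) (_ : _ <= K) HB))//.
    rewrite (le_trans (cmodD _ _))// cmodM.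
    have : cmod h * cmod l <= cmod l by rewrite ler_piMl// ltW.
    rewrite /K; lra.
  by rewrite mulrA ler_wpM2r.
have T3 : cmod (A * (g z + h * l' + B)) <= e / 3 * cmod h.
  rewrite cmodM (le_trans (ler_pM (cmod_ge0 _) (cmod_ge0 _) HA (_ : _ <= K)))//.
    rewrite (le_trans (cmodD _ _))// (le_trans (lerD (cmodD _ _) HB))// cmodM.
    have : cmod h * cmod l' <= cmod l' by rewrite ler_piMl// ltW.
    rewrite /K; lra.
  by rewrite mulrAC [e1 * K]mulrC ler_wpM2r.
rewrite (le_trans (cmodD _ _))// (le_trans (lerD (cmodD _ _) (lexx _)))//.
lra.
Qed.

Lemma cderivZ (c : R[i]) f z l : cderiv f z l -> cderiv (fun u => c * f u) z (c * l).
Proof. by move=> fl; have := cderivM (cderiv_cst c z) fl; rewrite mul0r add0r. Qed.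

Lemma cderivB f g z l l' : cderiv f z l -> cderiv g z l' ->
  cderiv (fun u => f u - g u) z (l - l').
Proof.
move=> fl gl; have := cderivD fl (cderivZ (-1) gl).
by rewrite mulN1r; apply: (cderiv_near (r := 1)) => // h _; rewrite mulN1r.
Qed.

Lemma cderiv_sum (I : Type) (r : seq I) (Q : pred I) (F : I -> R[i] -> R[i])
    (L : I -> R[i]) z : (forall i, cderiv (F i) z (L i)) ->
  cderiv (fun u => \sum_(i <- r | Q i) F i u) z (\sum_(i <- r | Q i) L i).
Proof.
move=> FL; elim: r => [|i r IH].
  rewrite big_nil; apply: (cderiv_near (r := 1) _ _ (cderiv_cst 0 z)) => // h _.
  by rewrite big_nil.
rewrite big_cons; case: ifPn => Qi.
  apply: (cderiv_near (r := 1) _ _ (cderivD (FL i) IH)) => // h _.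
  by rewrite big_cons Qi.
by apply: (cderiv_near (r := 1) _ _ IH) => // h _; rewrite big_cons (negbTE Qi).
Qed.

Lemma cderiv_inv (z0 z : R[i]) : z != z0 ->
  cderiv (fun u => (u - z0)^-1) z (- (z - z0) ^- 2).
Proof.
move=> zz0 e e0; set a := z - z0.
have a0 : 0 < cmod a by rewrite cmod_gt0 subr_eq0.
exists (Num.min (cmod a / 2) (e * cmod a ^+ 3 / 2)).
  by rewrite lt_min !divr_gt0// mulr_gt0// exprn_gt0.
move=> h; rewrite lt_min => /andP[h1 h2].
have az : a != 0 by rewrite -cmod_gt0.
have ah : cmod a / 2 <= cmod (a + h).
  have := cmodB (a + h) h; rewrite addrK; lra.
have ahz : a + h != 0 by rewrite -cmod_gt0; lra.
have -> : (z + h - z0)^-1 - a^-1 - h * - a ^- 2 = h * (h * (a ^+ 2 * (a + h))^-1).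
  have -> : z + h - z0 = a + h by rewrite /a; ring.
  by field; rewrite ahz az.
rewrite !cmodM [X in _ <= X]mulrC ler_wpM2l ?cmod_ge0// cmodV cmodM cmodX.
rewrite ler_pdivrMr ?mulr_gt0 ?exprn_gt0 ?cmod_gt0//.
apply: (le_trans (ltW h2)).
have : e * cmod a ^+ 2 * (cmod a / 2) <= e * cmod a ^+ 2 * cmod (a + h).
  by rewrite ler_wpM2l// mulr_ge0 ?sqr_ge0// ltW.
by rewrite exprS -!mulrA ![cmod a * _]mulrC !mulrA.
Qed.

(** This brings complex statements back to real calculus of one variable: [c = 1] and [c = -i] give
    the real and imaginary parts, and a rotation [c] gives the modulus. *)
Lemma cderiv_line f (a b c l : R[i]) (x : R) : cderiv f (a + x%:C * b) l ->
  is_derive x 1 (fun y : R => complex.Re (c * f (a + y%:C * b)))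
    (complex.Re (c * (l * b))).
Proof.
move=> fl.
suff H : (fun h : R => h^-1 *: ((fun y : R => complex.Re (c * f (a + y%:C * b)))
    (h *: 1 + x) - complex.Re (c * f (a + x%:C * b)))) @ 0^' -->
    complex.Re (c * (l * b)).
  split; first by apply/cvg_ex; eexists; exact: H.
  by apply: cvg_lim => //; exact: H.
apply/cvgrPdist_le => e e0.
pose K := (1 + cmod c) * (1 + cmod b).
have cK : 0 < 1 + cmod c by rewrite ltr_pwDl// cmod_ge0.
have bK : 0 < 1 + cmod b by rewrite ltr_pwDl// cmod_ge0.
have K0 : 0 < K by rewrite mulr_gt0.
have [dl dl0 H] := fl (e / K) (divr_gt0 e0 K0).
near=> h.
have h0 : h != 0 by near: h; exact: nbhs_dnbhs_neq.
have hd : `|h| * (1 + cmod b) < dl.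
  rewrite -ltr_pdivlMr//; near: h.
  exists (dl / (1 + cmod b)); first by rewrite /= divr_gt0.
  by move=> y /=; rewrite sub0r normrN.
have hd' : cmod (h%:C * b) < dl.
  rewrite cmodM cmod_real (le_lt_trans _ hd)// ler_wpM2l//.
  by rewrite lerDr.
have := H _ hd'.
have -> : a + x%:C * b + h%:C * b = a + (h *: 1 + x)%:C * b.
  by rewrite rmorphD /= [h *: 1]mulr1 mulrDl [h%:C * b + _]addrC addrA.
set A := f _ - f _ - _ => HA.
have -> : complex.Re (c * (l * b)) - h^-1 *:
  (complex.Re (c * f (a + (h *: 1 + x)%:C * b)) - complex.Re (c * f (a + x%:C * b)))
  = complex.Re (- (h^-1%:C * (c * A))).
  rewrite -cReB -[_ *: _]Re_real_mul -cReB /A; congr complex.Re.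
  have E : h^-1%:C * h%:C = 1 :> R[i] by rewrite -rmorphM /= mulVf.
  move: (f _) (f _) => v u.
  have -> : - (h^-1%:C * (c * (u - v - h%:C * b * l))) =
    h^-1%:C * h%:C * (c * (l * b)) - h^-1%:C * (c * u - c * v) by ring.
  by rewrite E mul1r.
rewrite (le_trans (cmod_Re _))// cmodN !cmodM cmod_real normfV.
rewrite mulrC ler_pdivrMr ?normr_gt0//.
apply: (le_trans (ler_wpM2l (cmod_ge0 _) HA)).
rewrite cmodM cmod_real.
have -> : cmod c * (e / K * (`|h| * cmod b)) = e * `|h| * (cmod c * cmod b / K) by ring.
rewrite ler_piMr ?mulr_ge0 ?(ltW e0)// ler_pdivrMr// mul1r /K.
by rewrite ler_pM ?cmod_ge0// lerDr.
Unshelve. all: end_near.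
Qed.

Lemma cderive_eq f z l : cderiv f z l -> Cderive f z = l.
Proof.
move=> fl; rewrite /Cderive.
suff H : (fun h : (R[i])^o => h^-1 *: ((f : (R[i])^o -> (R[i])^o) (h + z) - f z)) @ 0^'
    --> (l : (R[i])^o).
  rewrite /derive1; exact: (cvg_lim (@norm_hausdorff _ _) H).
apply/cvgrPdist_le => e e0.
(* The norm of [(R[i])^o] takes its values in [R[i]], where a positive tolerance has zero imaginary
   part. *)
have [er er0 ee] : exists2 er : R, 0 < er & er%:C <= e.
  exists (complex.Re e); first by move: e0; rewrite ltcE => /andP[].
  by move: e0; rewrite ltcE lecE /= => /andP[/eqP -> _]; rewrite eqxx lexx.
have [dl dl0 H] := fl er er0.
near=> h.
have h0 : h != 0 by near: h; exact: nbhs_dnbhs_neq.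
have hd : cmod h < dl.
  near: h; exists dl%:C; first by rewrite /= ltcR.
  by move=> y /=; rewrite sub0r normrN -cmod_norm ltcR.
have HA := H _ hd; apply: le_trans ee.
have -> : (l : (R[i])^o) - h^-1 *: (f (h + z) - f z) =
    - (h^-1 * (f (z + h) - f z - h * l)).
  rewrite [h + z]addrC [_ *: _](_ : _ = h^-1 * (f (z + h) - f z))//.
  by rewrite [X in _ = - X]mulrBr mulrA mulVf// mul1r opprB.
rewrite normrN -cmod_norm lecR cmodM cmodV mulrC ler_pdivrMr// ?cmod_gt0//.
Unshelve. all: end_near.
Qed.

(** After a rotation making [f t - f s] a nonnegative real, [Phi] minus the real part of the rotated
    [f] is nondecreasing along the segment. A variable bound [phi] is allowed so that blow-up near
    the boundary can be integrated. *)
Lemma mean_value_ineq f (f' : R -> R[i]) s t (Phi phi : R -> R) :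
  (forall x, 0 <= x <= 1 -> cderiv f (seg_param s t x) (f' x)) ->
  {within `[0, 1], continuous Phi} ->
  (forall x : R, 0 < x < 1 -> is_derive x 1 Phi (phi x)) ->
  (forall x : R, 0 < x < 1 -> cmod (f' x) * cmod (t - s) <= phi x) ->
  cmod (f t - f s) <= Phi 1 - Phi 0.
Proof.
move=> ff' cPhi dPhi le_phi.
have [c c1 <-] := cmod_rot (f t - f s).
pose psi x := complex.Re (c * f (s + x%:C * (t - s))).
have dpsi (x : R) : 0 <= x <= 1 -> is_derive x 1 psi (complex.Re (c * (f' x * (t - s)))).
  by move=> x01; apply: cderiv_line; exact: ff'.
have d (x : R) : 0 < x < 1 -> is_derive x 1 (Phi - psi)
    (phi x - complex.Re (c * (f' x * (t - s)))).
  move=> x01; apply: is_deriveB; first exact: dPhi.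
  by apply: dpsi; case/andP: x01 => /ltW -> /ltW ->.
have : (Phi - psi) 0 <= (Phi - psi) 1.
  apply: (@ger0_derive1_le_cc _ _ 0 1) => //.
  - by move=> x; rewrite in_itv /= => /d [].
  - move=> x; rewrite in_itv /= => x01; rewrite derive1E.
    have [_ ->] := d _ x01; rewrite subr_ge0 (le_trans _ (le_phi _ x01))//.
    by rewrite (le_trans (Re_le_cmod _))// !cmodM c1 mul1r.
  - move=> x; apply: cvgB; first exact: cPhi.
    apply: derivable_within_continuous => y; rewrite in_itv /= => /dpsi [].
    by [].
- by rewrite in_itv /= lexx ler01.
- by rewrite in_itv /= lexx ler01.
have E (a : R) : (Phi - psi) a = Phi a - psi a by [].
by rewrite !E /psi mul0r addr0 mul1r [s + _]addrC subrK mulrBr cReB; lra.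
Qed.

Lemma mean_value_ineq_cst f f' s t (K : R) :
  (forall x, 0 <= x <= 1 -> cderiv f (seg_param s t x) (f' (seg_param s t x))) ->
  (forall x, 0 <= x <= 1 -> cmod (f' (seg_param s t x)) <= K) ->
  cmod (f t - f s) <= K * cmod (t - s).
Proof.
move=> ff' f'K.
rewrite (le_trans (@mean_value_ineq f (fun x => f' (seg_param s t x)) s t
  (fun x => K * cmod (t - s) * x) (fun=> K * cmod (t - s)) ff' _ _ _)) ?mulr0 ?subr0 ?mulr1//.
- by apply: continuous_subspaceT => x; apply: mulrl_continuous.
- move=> x _; have : is_derive x 1 ((K * cmod (t - s)) *: (id : R -> R)) (K * cmod (t - s) *: 1).
    exact: is_deriveZ.
  by rewrite [_ *: 1]mulr1.
- by move=> x /andP[/ltW x0 /ltW x1]; rewrite ler_wpM2r ?cmod_ge0// f'K// x0.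
Qed.

End ComplexDerivative.

(** * Limits of complex sequences *)

Section ComplexSequences.
Variable R : realType.
Implicit Types (u v : nat -> R[i]) (l z w : R[i]).

Definition ctends u l := forall e : R, 0 < e ->
  exists N, forall n, (N <= n)%N -> cmod (u n - l) <= e.

Lemma cmod_small0 z : (forall e : R, 0 < e -> cmod z <= e) -> z = 0.
Proof.
move=> H; apply/eqP; rewrite -cmod_eq0 eq_le cmod_ge0 andbT.
by apply/ler_addgt0Pl => e e0; rewrite addr0; exact: H.
Qed.

Lemma ctends_unique u l l' : ctends u l -> ctends u l' -> l = l'.
Proof.
move=> ul ul'; apply/eqP; rewrite -subr_eq0; apply/eqP/cmod_small0 => e e0.
have e2 : 0 < e / 2 by rewrite divr_gt0.
have [N HN] := ul _ e2; have [M HM] := ul' _ e2.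
rewrite (le_trans (cmod_distD (u (maxn N M)) _ _))// [leRHS]splitr lerD//.
  by rewrite cmod_distC HN// leq_maxl.
by rewrite HM// leq_maxr.
Qed.

Lemma ctends_cst l : ctends (fun=> l) l.
Proof. by move=> e e0; exists 0%N => n _; rewrite subrr cmod0 ltW. Qed.

Lemma ctendsD u v l l' : ctends u l -> ctends v l' ->
  ctends (fun n => u n + v n) (l + l').
Proof.
move=> ul ul' e e0; have e2 : 0 < e / 2 by rewrite divr_gt0.
have [N HN] := ul _ e2; have [M HM] := ul' _ e2.
exists (maxn N M) => n; rewrite geq_max => /andP[Nn Mn].
rewrite opprD addrACA (le_trans (cmodD _ _))// [leRHS]splitr lerD//.
  exact: HN.
exact: HM.
Qed.

Lemma ctendsM u v l l' : ctends u l -> ctends v l' ->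
  ctends (fun n => u n * v n) (l * l').
Proof.
move=> ul vl' e e0; pose K := 1 + cmod l + cmod l'.
have l0 := cmod_ge0 l; have l'0 := cmod_ge0 l'.
have K0 : 0 < K by rewrite /K; lra.
pose e1 := Num.min 1 (e / (2 * K)).
have e10 : 0 < e1 by rewrite lt_min ltr01 divr_gt0// mulr_gt0.
have [N HN] := ul _ e10; have [M HM] := vl' _ e10.
exists (maxn N M) => n; rewrite geq_max => /andP[Nn Mn].
have -> : u n * v n - l * l' = (u n - l) * (v n - l' + l') + l * (v n - l') by ring.
have {}HN := HN _ Nn; have {}HM := HM _ Mn.
have e11 : e1 <= 1 by rewrite ge_min lexx.
have e1K : e1 * K <= e / 2.
  rewrite -ler_pdivlMr// (le_trans (_ : e1 <= e / (2 * K)))//.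
    by rewrite ge_min lexx orbT.
  by rewrite invfM mulrA.
have T1 : cmod ((u n - l) * (v n - l' + l')) <= e1 * K.
  rewrite cmodM ler_pM ?cmod_ge0// (le_trans (cmodD _ _))//.
  by rewrite /K; move: HM e11; move: (cmod _) => x; lra.
have T2 : cmod (l * (v n - l')) <= e1 * K.
  by rewrite cmodM mulrC ler_pM ?cmod_ge0// /K; lra.
by rewrite (le_trans (cmodD _ _))//; lra.
Qed.

Lemma ctendsZ (c : R[i]) u l : ctends u l -> ctends (fun n => c * u n) (c * l).
Proof. exact: ctendsM (ctends_cst c). Qed.

Lemma ctendsB u v l l' : ctends u l -> ctends v l' ->
  ctends (fun n => u n - v n) (l - l').
Proof.
move=> ul vl' e e0; have [N HN] := ctendsD ul (ctendsZ (-1) vl') e0.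
by exists N => n /HN; rewrite !mulN1r.
Qed.

Lemma ctends_sum (I : Type) (r : seq I) (Q : pred I) (F : I -> nat -> R[i])
    (L : I -> R[i]) : (forall i, ctends (F i) (L i)) ->
  ctends (fun n => \sum_(i <- r | Q i) F i n) (\sum_(i <- r | Q i) L i).
Proof.
move=> FL; elim: r => [|i r IH].
  by rewrite big_nil => e e0; exists 0%N => n _; rewrite big_nil subrr cmod0 ltW.
rewrite big_cons; case: ifPn => Qi e e0.
  by have [N HN] := ctendsD (FL i) IH e0; exists N => n /HN; rewrite big_cons Qi.
by have [N HN] := IH e e0; exists N => n /HN; rewrite big_cons (negbTE Qi).
Qed.

Lemma ctends_ext u v l : u =1 v -> ctends u l -> ctends v l.
Proof. by move=> uv ul e e0; have [N HN] := ul e e0; exists N => n /HN; rewrite uv. Qed.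

Lemma ctends_shift u l k : ctends u l -> ctends (fun n => u (n + k)%N) l.
Proof.
move=> ul e e0; have [N HN] := ul e e0; exists N => n Nn.
by apply: HN; rewrite (leq_trans Nn)// leq_addr.
Qed.

Lemma ctends_cmod_le u l (K : R) : ctends u l -> (forall n, cmod (u n) <= K) ->
  cmod l <= K.
Proof.
move=> ul uK; apply/ler_addgt0Pl => e e0; have [N HN] := ul e e0.
have := HN N (leqnn _); rewrite cmod_distC => {}HN.
by rewrite -[l](subrK (u N)) (le_trans (cmodD _ _))// lerD.
Qed.

Lemma ctends_Re u l : ctends u l -> (fun n => complex.Re (u n)) @ \oo --> complex.Re l.
Proof.
move=> ul; apply/cvgrPdist_le => e e0; have [N HN] := ul e e0.
exists N => // n /= Nn; rewrite -cReB (le_trans (cmod_Re _))// cmod_distC.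
exact: HN.
Qed.

Lemma ctends_Im u l : ctends u l -> (fun n => complex.Im (u n)) @ \oo --> complex.Im l.
Proof.
move=> ul; apply/cvgrPdist_le => e e0; have [N HN] := ul e e0.
exists N => // n /= Nn; rewrite -cImB (le_trans (cmod_Im _))// cmod_distC.
exact: HN.
Qed.

Lemma cvg_ctends (u : nat -> (R[i])^o) (l : (R[i])^o) : u @ \oo --> l -> ctends u l.
Proof.
move=> /cvgrPdist_le H e e0.
have /H [N _ HN] : 0 < e%:C :> R[i] by rewrite ltcR.
by exists N => n /HN /=; rewrite -cmod_norm lecR cmod_distC.
Qed.

Lemma ctends_cauchy u : (forall e : R, 0 < e -> exists N, forall n m,
    (N <= n)%N -> (N <= m)%N -> cmod (u n - u m) <= e) -> exists l, ctends u l.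
Proof.
move=> uc.
have cre (p : R[i] -> R) : (forall z w, `|p z - p w| <= cmod (z - w)) ->
    exists l : R, (fun n => p (u n)) @ \oo --> l.
  move=> pz; apply/cvg_ex; apply/cauchy_cvgP/cauchy_exP => e e0.
  have e2 : 0 < e / 2 by rewrite divr_gt0.
  have [N HN] := uc _ e2; exists (p (u N)); exists N => // n /= Nn.
  rewrite /ball /= (le_lt_trans (pz _ _))// (le_lt_trans (HN _ _ (leqnn _) Nn))//.
  by rewrite ltr_pdivrMr// ltr_pMr// ltr1n.
have [a ua] : exists l : R, (fun n => complex.Re (u n)) @ \oo --> l.
  by apply: cre => z w; rewrite -cReB; exact: cmod_Re.
have [b ub] : exists l : R, (fun n => complex.Im (u n)) @ \oo --> l.
  by apply: cre => z w; rewrite -cImB; exact: cmod_Im.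
exists (a +i* b) => e e0; have e2 : 0 < e / 2 by rewrite divr_gt0.
move/cvgrPdist_le : ua => /(_ _ e2)[N _ HN].
move/cvgrPdist_le : ub => /(_ _ e2)[M _ HM].
exists (maxn N M) => n; rewrite geq_max => /andP[Nn Mn].
rewrite (le_trans (cmod_le_ReIm _))// cReB cImB [leRHS]splitr /= lerD//.
  by rewrite distrC; exact: HN.
by rewrite distrC; exact: HM.
Qed.

End ComplexSequences.

(** * Power series are continuously differentiable *)

Section PowerSeries.
Variable R : realType.
Implicit Types (a : nat -> R[i]) (z w h l : R[i]) (f : R[i] -> R[i]) (r : R).

Definition psum a w N := \sum_(n < N) a n * w ^+ n.

Definition has_pseries a z0 r f :=
  forall z, cmod (z - z0) < r -> ctends (psum a (z - z0)) (f z).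

(** At the point [z0 + rho] the partial sums are eventually within [1] of the limit, so the terms
    are eventually at most [2]; the finitely many earlier ones are added to the constant. *)
Lemma pseries_bound a z0 r f (rho : R) : 0 < rho < r -> has_pseries a z0 r f ->
  exists2 K : R, 0 < K & forall n, cmod (a n) * rho ^+ n <= K.
Proof.
move=> /andP[rho0 rhor] af.
have [|N HN] := af (z0 + rho%:C) _ 1 ltr01.
  by rewrite addrC addKr cmod_real ger0_norm// ltW.
exists (2 + \sum_(n < N) cmod (a n) * rho ^+ n).
  by rewrite ltr_pwDl// sumr_ge0// => i _; rewrite mulr_ge0 ?cmod_ge0// exprn_ge0// ltW.
move=> n; have [nN|Nn] := ltnP n N.
  rewrite (bigD1 (Ordinal nN))//= addrCA lerDl addr_ge0// sumr_ge0// => i _.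
  by rewrite mulr_ge0 ?cmod_ge0// exprn_ge0// ltW.
rewrite ler_wpDr//.
  by rewrite sumr_ge0// => i _; rewrite mulr_ge0 ?cmod_ge0// exprn_ge0// ltW.
have -> : cmod (a n) * rho ^+ n = cmod (a n * (rho%:C) ^+ n).
  by rewrite cmodM cmodX cmod_real ger0_norm// ltW.
have H1 := HN n Nn; have H2 := HN n.+1 (leqW Nn).
have E : z0 + rho%:C - z0 = rho%:C by ring.
rewrite E {E} in H1 H2.
have -> : a n * rho%:C ^+ n = psum a rho%:C n.+1 - psum a rho%:C n.
  by rewrite /psum big_ord_recr /= [_ + a n * _]addrC addrK.
rewrite (le_trans (cmod_distD (f (z0 + rho%:C)) _ _))//.
by rewrite -[2]/(1 + 1) lerD// cmod_distC.
Qed.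

(** The factor [q ^+ 2] on the left stands for the power [q^(n - 2)] on the right, which would be
    truncated for [n < 2]. *)
Lemma expr_taylor2 w h (q : R) n : cmod w <= q -> cmod (w + h) <= q ->
  cmod ((w + h) ^+ n - w ^+ n - h * (n%:R * w ^+ n.-1)) * q ^+ 2 <=
  n%:R ^+ 2 * cmod h ^+ 2 * q ^+ n.
Proof.
move=> wq whq; have q0 : 0 <= q := le_trans (cmod_ge0 _) wq.
elim: n => [|n IH].
  have -> : (w + h) ^+ 0 - w ^+ 0 - h * (0%:R * w ^+ 0.-1) = 0 by rewrite !expr0; ring.
  by rewrite cmod0 mul0r expr0n /= !mul0r.
have [n0|n0] := posnP n.
  rewrite n0; have -> : (w + h) ^+ 1 - w ^+ 1 - h * (1%:R * w ^+ 1.-1) = 0.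
    by rewrite /= !expr1 expr0; ring.
  by rewrite cmod0 mul0r !mulr_ge0 ?exprn_ge0 ?cmod_ge0.
set E := (w + h) ^+ n - _ - _ in IH.
have -> : (w + h) ^+ n.+1 - w ^+ n.+1 - h * (n.+1%:R * w ^+ n.+1.-1) =
    (w + h) * E + n%:R * (h ^+ 2 * w ^+ n.-1).
  rewrite /E /=; have -> : w ^+ n.+1 = w * w ^+ n by rewrite exprS.
  have -> : w ^+ n = w * w ^+ n.-1 by rewrite -exprS prednK.
  by rewrite -natr1 exprS; ring.
apply: (@le_trans _ _ (q * (cmod E * q ^+ 2) + n%:R * (cmod h ^+ 2 * (q ^+ n.-1 * q ^+ 2)))).
  apply: (@le_trans _ _ ((q * cmod E + n%:R * (cmod h ^+ 2 * q ^+ n.-1)) * q ^+ 2)); last first.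
    by rewrite mulrDl !mulrA.
  rewrite ler_wpM2r ?sqr_ge0// (le_trans (cmodD _ _))// !cmodM !cmodX lerD//.
    by rewrite ler_wpM2r ?cmod_ge0.
  have -> : cmod (n%:R : R[i]) = n%:R.
    by have := cmod_real (n%:R : R); rewrite rmorph_nat normr_nat.
  by rewrite -expr2 ler_wpM2l// ler_wpM2l ?sqr_ge0// lerXn2r ?nnegrE ?cmod_ge0.
have -> : q ^+ n.-1 * q ^+ 2 = q ^+ n.+1 by rewrite -exprD addn2 /= prednK.
apply: (@le_trans _ _ (q * (n%:R ^+ 2 * cmod h ^+ 2 * q ^+ n) + n%:R * (cmod h ^+ 2 * q ^+ n.+1))).
  by rewrite lerD2r ler_wpM2l.
have -> : q * (n%:R ^+ 2 * cmod h ^+ 2 * q ^+ n) + n%:R * (cmod h ^+ 2 * q ^+ n.+1) =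
  (n%:R ^+ 2 + n%:R) * (cmod h ^+ 2 * q ^+ n.+1) by rewrite [q ^+ n.+1]exprS; ring.
rewrite -[leRHS]mulrA ler_wpM2r ?mulr_ge0 ?sqr_ge0 ?exprn_ge0 ?cmod_ge0//.
rewrite -natr1; have : 0 <= n%:R :> R by rewrite ler0n.
by rewrite !expr2; nra.
Qed.

Lemma sum_sqr_half N : \sum_(n < N) n%:R ^+ 2 * 2^-1 ^+ n <= 6 :> R.
Proof.
(* The exact partial sum makes the induction go through; [6] is the sum of the series. *)
suff : \sum_(n < N) n%:R ^+ 2 * 2^-1 ^+ n = 6 - (N%:R ^+ 2 + 2 * N%:R + 3) * (2 * 2^-1 ^+ N) :> R.
  by move=> ->; rewrite lerBlDr lerDl mulr_ge0.
elim: N => [|N IH]; first by rewrite big_ord0 expr0; lra.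
rewrite big_ord_recr /= IH -natr1 [2^-1 ^+ N.+1]exprS.
by field.
Qed.

(** Everything rests on [key], a second order Taylor bound for the partial sums that is uniform in
    [N]. With [|w|] and [|h|] at most [r / 8], the points stay in the disk of radius [q = r / 4],
    half of the radius [r / 2] at which the coefficients are bounded; hence the series of
    [n^2 / 2^n]. *)
Lemma pseries_derivative a z0 r f : 0 < r -> has_pseries a z0 r f ->
  exists2 f', has_pseries (fun n => n.+1%:R * a n.+1) z0 (r / 8) f' &
    forall z, cmod (z - z0) < r / 8 -> cderiv f z (f' z).
Proof.
move=> r0 af.
have rho : 0 < r / 2 < r by lra.
have [K K0 HK] := pseries_bound rho af.
pose q := r / 4; have q0 : 0 < q by rewrite /q; lra.
pose T w N := \sum_(n < N) a n * (n%:R * w ^+ n.-1).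
pose C := 6 * K / q ^+ 2.
have C0 : 0 < C by rewrite divr_gt0 ?exprn_gt0// mulr_gt0.
have key w h N : cmod w < r / 8 -> cmod h <= r / 8 ->
    cmod (psum a (w + h) N - psum a w N - h * T w N) <= C * cmod h ^+ 2.
  move=> wr hr.
  have -> : psum a (w + h) N - psum a w N - h * T w N =
      \sum_(n < N) a n * ((w + h) ^+ n - w ^+ n - h * (n%:R * w ^+ n.-1)).
    rewrite /psum /T mulr_sumr -!sumrB; apply: eq_bigr => n _; ring.
  rewrite (le_trans (cmod_sum _ _ _))//.
  have wq : cmod w <= q by rewrite /q; lra.
  have whq : cmod (w + h) <= q by rewrite (le_trans (cmodD _ _))// /q; lra.
  apply: (@le_trans _ _ (\sum_(n < N) K / q ^+ 2 * cmod h ^+ 2 * (n%:R ^+ 2 * 2^-1 ^+ n))).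
    apply: ler_sum => n _; rewrite cmodM.
    have := expr_taylor2 n wq whq; set E := cmod (_ - _ - _) => HE.
    have qn : 0 < q ^+ n by rewrite exprn_gt0.
    have q2 : 0 < q ^+ 2 by rewrite exprn_gt0.
    rewrite -(@ler_pM2r _ (q ^+ 2))//.
    have -> : K / q ^+ 2 * cmod h ^+ 2 * (n%:R ^+ 2 * 2^-1 ^+ n) * q ^+ 2 =
        K * cmod h ^+ 2 * (n%:R ^+ 2 * 2^-1 ^+ n) by field; rewrite gt_eqF.
    rewrite -(mulrA _ E) (le_trans (ler_wpM2l (cmod_ge0 _) HE))//.
    have -> : q ^+ n = (r / 2) ^+ n * 2^-1 ^+ n by rewrite -exprMn; congr (_ ^+ _); rewrite /q; field.
    have := HK n => HKn.
    have -> : cmod (a n) * (n%:R ^+ 2 * cmod h ^+ 2 * ((r / 2) ^+ n * 2^-1 ^+ n)) =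
       cmod (a n) * (r / 2) ^+ n * (cmod h ^+ 2 * (n%:R ^+ 2 * 2^-1 ^+ n)) by ring.
    by rewrite -[leRHS]mulrA ler_wpM2r// !mulr_ge0 ?sqr_ge0 ?exprn_ge0 ?cmod_ge0 ?invr_ge0.
  rewrite -mulr_sumr.
  have -> : C * cmod h ^+ 2 = K / q ^+ 2 * cmod h ^+ 2 * 6 by rewrite /C; ring.
  rewrite ler_wpM2l ?sum_sqr_half// mulr_ge0 ?sqr_ge0// divr_ge0 ?sqr_ge0//.
  exact: ltW.
(* The differentiated series is Cauchy: for a fixed small step [x] it differs by at most [C x] from
   the difference quotient of the partial sums at [w + x] and [w], which converge. *)
have Tl w : cmod w < r / 8 -> exists l, ctends (T w) l.
  move=> wr; apply: ctends_cauchy => e e0.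
  pose x := Num.min (r / 8) (e / (4 * C)).
  have x0 : 0 < x by rewrite lt_min !divr_gt0// mulr_gt0.
  have xr : x <= r / 8 by rewrite ge_min lexx.
  have xC : C * x <= e / 4.
    rewrite -ler_pdivlMl// (le_trans (_ : x <= e / (4 * C)))//.
      by rewrite ge_min lexx orbT.
    by rewrite invfM [leRHS]mulrC mulrA.
  have cx : cmod x%:C = x by rewrite cmod_real ger0_norm// ltW.
  have n0 : 0 < x * e / 8 by rewrite divr_gt0// mulr_gt0.
  have [|N HN] := af (z0 + (w + x%:C)) _ _ n0.
    rewrite addrC addKr (le_lt_trans (cmodD _ _))// cx; lra.
  have [|M HM] := af (z0 + w) _ _ n0.
    rewrite addrC addKr; lra.
  exists (maxn N M) => n m; rewrite !geq_max => /andP[Nn Mn] /andP[Nm Mm].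
  have HNn := HN _ Nn; have HNm := HN _ Nm; have HMn := HM _ Mn; have HMm := HM _ Mm.
  have E1 : z0 + (w + x%:C) - z0 = w + x%:C by ring.
  have E2 : z0 + w - z0 = w by ring.
  rewrite !E1 in HNn HNm; rewrite !E2 in HMn HMm.
  have Kn := key w x%:C n wr; have Km := key w x%:C m wr.
  rewrite cx in Kn Km; have {}Kn := Kn xr; have {}Km := Km xr.
  rewrite -(ler_pM2l x0) -{1}cx -cmodM.
  set An := psum a (w + x%:C) n in HNn Kn *; set Bn := psum a w n in HMn Kn *.
  set Am := psum a (w + x%:C) m in HNm Km *; set Bm := psum a w m in HMm Km *.
  set l1 := f _ in HNn HNm; set l2 := f _ in HMn HMm.
  have -> : x%:C * (T w n - T w m) = (An - l1) - (Am - l1) - ((Bn - l2) - (Bm - l2))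
      - ((An - Bn - x%:C * T w n) - (Am - Bm - x%:C * T w m)) by ring.
  apply: (le_trans (cmodB _ _)); apply: (le_trans (lerD (cmodB _ _) (cmodB _ _))).
  apply: (le_trans (lerD (lerD (cmodB _ _) (cmodB _ _)) (lexx _))).
  have : C * x ^+ 2 <= x * e / 4.
    have -> : C * x ^+ 2 = x * (C * x) by ring.
    by rewrite -mulrA ler_wpM2l// ltW.
  lra.
have /boolp.choice[F HF] : forall w, exists l, cmod w < r / 8 -> ctends (T w) l.
  move=> w; have [wr|wr] := ltP (cmod w) (r / 8); last by exists 0.
  by have [l Hl] := Tl w wr; exists l.
exists (fun z => F (z - z0)).
  move=> z zr; apply: ctends_ext (ctends_shift 1 (HF _ zr)) => N.
  rewrite addn1 /T big_ord_recl /= mul0r mulr0 add0r /psum; apply: eq_bigr => n _.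
  by rewrite /= mulrCA mulrA.
move=> z zr e e0.
exists (Num.min (r / 8) (e / C)).
  by rewrite lt_min; apply/andP; split; apply: divr_gt0.
move=> h; rewrite lt_min => /andP[/ltW h1]; rewrite ltr_pdivlMr// => h2.
apply: (@le_trans _ _ (C * cmod h ^+ 2)); last first.
  by rewrite expr2 mulrA ler_wpM2r ?cmod_ge0// mulrC ltW.
have h3 : cmod (z + h - z0) < r.
  have -> : z + h - z0 = (z - z0) + h by ring.
  rewrite (le_lt_trans (cmodD _ _))//; lra.
have h4 : cmod (z - z0) < r by lra.
apply: ctends_cmod_le (ctendsB (ctendsB (af _ h3) (af _ h4)) (ctendsZ h (HF _ zr))) _ => N /=.
have -> : z + h - z0 = (z - z0) + h by ring.
exact: key.
Qed.

Lemma pseries_C1 a z0 r f : 0 < r -> has_pseries a z0 r f ->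
  exists2 f', (forall z, cmod (z - z0) < r / 8 -> cderiv f z (f' z)) & ccont f' z0.
Proof.
move=> r0 /(pseries_derivative r0)[f' pf' ff']; exists f' => //.
have r80 : 0 < r / 8 by rewrite divr_gt0.
have [f2 _ H] := pseries_derivative r80 pf'.
by apply: (@cderiv_ccont _ _ _ (f2 z0)); apply: H; rewrite subrr cmod0 divr_gt0.
Qed.

Lemma pseries_coef0 a z0 r f : 0 < r -> has_pseries a z0 r f -> f z0 = a 0%N.
Proof.
move=> r0 af; have := af z0; rewrite subrr cmod0 => /(_ r0) H.
apply: (ctends_unique (ctends_shift 1 H)); apply: ctends_ext (ctends_cst _) => n.
rewrite addn1 /psum big_ord_recl expr0 mulr1 big1 ?addr0// => i _.
by rewrite expr0n mulr0.
Qed.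

Lemma pseries_quotient a z0 r f g : 0 < r -> has_pseries a z0 r f ->
  (forall z, z != z0 -> g z = (f z - f z0) / (z - z0)) -> g z0 = a 1%N ->
  has_pseries (fun n => a n.+1) z0 r g.
Proof.
move=> r0 af gz gz0 z zr; have [->|zz0] := eqVneq z z0.
  rewrite gz0 subrr => e e0; exists 1%N => -[//|n] _.
  rewrite /psum big_ord_recl expr0 mulr1 big1 ?addr0 ?subrr ?cmod0 ?ltW// => i _.
  by rewrite expr0n mulr0.
rewrite gz// (pseries_coef0 r0 af) mulrC.
apply: ctends_ext (ctendsZ (z - z0)^-1 (ctendsB (ctends_shift 1 (af z zr)) (ctends_cst (a 0%N)))) => n /=.
rewrite addn1 /psum big_ord_recl expr0 mulr1 [a 0%N + _]addrC addrK mulr_sumr.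
apply: eq_bigr => i _; rewrite lift0 exprS mulrCA [_^-1 * _]mulrA mulVf ?mul1r//.
by rewrite subr_eq0.
Qed.

End PowerSeries.

(** * Functions holomorphic on the upper half plane *)

Section HolomorphicFunctions.
Variable R : realType.
Implicit Types (f g : R[i] -> R[i]) (z u s t h : R[i]).

Lemma ccontD f g z : ccont f z -> ccont g z -> ccont (fun u => f u + g u) z.
Proof.
move=> cf cg e e0; have e2 : 0 < e / 2 by rewrite divr_gt0.
have [d1 d10 H1] := cf _ e2; have [d2 d20 H2] := cg _ e2.
exists (Num.min d1 d2); first by rewrite lt_min d10.
move=> h; rewrite lt_min => /andP[h1 h2].
rewrite opprD addrACA (le_trans (cmodD _ _))// [leRHS]splitr lerD//.
  exact: H1.
exact: H2.
Qed.

Lemma ccont_cst (c : R[i]) z : ccont (fun=> c) z.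
Proof. by move=> e e0; exists 1 => // h _; rewrite subrr cmod0 ltW. Qed.

Lemma ccontM f g z : ccont f z -> ccont g z -> ccont (fun u => f u * g u) z.
Proof.
move=> cf cg e e0; pose K := 1 + cmod (f z) + cmod (g z).
have f0 := cmod_ge0 (f z); have g0 := cmod_ge0 (g z).
have K0 : 0 < K by rewrite /K; lra.
pose e1 := Num.min 1 (e / (2 * K)).
have e10 : 0 < e1 by rewrite lt_min ltr01 divr_gt0// mulr_gt0.
have [d1 d10 H1] := cf _ e10; have [d2 d20 H2] := cg _ e10.
exists (Num.min d1 d2); first by rewrite lt_min d10.
move=> h; rewrite lt_min => /andP[/H1 h1 /H2 h2].
have -> : f (z + h) * g (z + h) - f z * g z =
  (f (z + h) - f z) * (g (z + h) - g z + g z) + f z * (g (z + h) - g z) by ring.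
have e11 : e1 <= 1 by rewrite ge_min lexx.
have e1K : e1 * K <= e / 2.
  rewrite -ler_pdivlMr// (le_trans (_ : e1 <= e / (2 * K)))//.
    by rewrite ge_min lexx orbT.
  by rewrite invfM mulrA.
have T1 : cmod ((f (z + h) - f z) * (g (z + h) - g z + g z)) <= e1 * K.
  rewrite cmodM ler_pM ?cmod_ge0// (le_trans (cmodD _ _))//.
  by rewrite /K; move: h2 e11; move: (cmod (_ - _)) => x; lra.
have T2 : cmod (f z * (g (z + h) - g z)) <= e1 * K.
  by rewrite cmodM mulrC ler_pM ?cmod_ge0// /K; lra.
by rewrite (le_trans (cmodD _ _))//; lra.
Qed.

Lemma ccontZ (c : R[i]) f z : ccont f z -> ccont (fun u => c * f u) z.
Proof. exact: ccontM (ccont_cst c z). Qed.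

Lemma ccont_line f (a b c : R[i]) (x : R) : ccont f (a + x%:C * b) ->
  {for x, continuous (fun y : R => complex.Re (c * f (a + y%:C * b)))}.
Proof.
move=> cf; apply/cvgrPdist_le => e e0.
have bK : 0 < 1 + cmod b by rewrite ltr_pwDl// cmod_ge0.
have cK : 0 < 1 + cmod c by rewrite ltr_pwDl// cmod_ge0.
have [dl dl0 H] := cf (e / (1 + cmod c)) (divr_gt0 e0 cK).
near=> y.
have hd : `|x - y| * (1 + cmod b) < dl.
  rewrite -ltr_pdivlMr//; near: y.
  by exists (dl / (1 + cmod b)); rewrite /= ?divr_gt0.
have hd' : cmod ((y - x)%:C * b) < dl.
  rewrite cmodM cmod_real distrC (le_lt_trans _ hd)// ler_wpM2l//.
  by rewrite lerDr.
have := H _ hd'.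
have -> : a + x%:C * b + (y - x)%:C * b = a + y%:C * b.
  by rewrite rmorphB /=; ring.
move=> H1; rewrite distrC -cReB -mulrBr (le_trans (cmod_Re _))// cmodM.
rewrite (le_trans (ler_wpM2l (cmod_ge0 _) H1))// mulrA ler_pdivrMr// mulrC.
by rewrite ler_wpM2l ?(ltW e0)// lerDr.
Unshelve. all: end_near.
Qed.

(** Continuity of the derivative is part of the notion: it makes first order expansions locally
    uniform, from which primitives along segments are obtained in place of Goursat's theorem. *)
Definition hol f := forall z, upper_half z ->
  cderiv f z (Cderive f z) /\ ccont (Cderive f) z.

Lemma upper_half_ball z h : cmod h < complex.Im z -> upper_half (z + h).
Proof.
move=> hz; rewrite /upper_half /= cImD.
have := cmod_Im h; rewrite ler_norml => /andP[]; lra.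
Qed.

Lemma hol_intro f f' : (forall z, upper_half z -> cderiv f z (f' z)) ->
  (forall z, upper_half z -> ccont f' z) -> hol f.
Proof.
move=> ff' cf' z zP; split; first by rewrite (cderive_eq (ff' z zP)); exact: ff'.
apply: ccont_near (cf' z zP) => [|h hz]; first exact: zP.
by rewrite (cderive_eq (ff' _ (upper_half_ball hz))).
Qed.

Lemma hol_ccont f z : hol f -> upper_half z -> ccont f z.
Proof. by move=> hf /hf[+ _]; exact: cderiv_ccont. Qed.

Lemma hol_cst (c : R[i]) : hol (fun=> c).
Proof.
by apply: (@hol_intro _ (fun=> 0)) => z _; [exact: cderiv_cst|exact: ccont_cst].
Qed.

Lemma holD f g : hol f -> hol g -> hol (fun u => f u + g u).
Proof.
move=> hf hg; apply: (@hol_intro _ (fun u => Cderive f u + Cderive g u)) => z zP.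
  exact: cderivD (hf z zP).1 (hg z zP).1.
exact: ccontD (hf z zP).2 (hg z zP).2.
Qed.

Lemma holM f g : hol f -> hol g -> hol (fun u => f u * g u).
Proof.
move=> hf hg.
apply: (@hol_intro _ (fun u => Cderive f u * g u + f u * Cderive g u)) => z zP.
  exact: cderivM (hf z zP).1 (hg z zP).1.
apply: ccontD; apply: ccontM; [exact: (hf z zP).2|exact: hol_ccont|
  exact: hol_ccont|exact: (hg z zP).2].
Qed.

Lemma holX f n : hol f -> hol (fun u => f u ^+ n).
Proof.
move=> hf; elim: n => [|n IH]; first exact: hol_cst.
have := holM hf IH; congr hol; apply/funext => u; by rewrite exprS.
Qed.

Lemma analytic_hol f : analytic_on (upper_half (R := R)) f -> hol f.
Proof.
move=> af z zP; have [r r0 [a Ha]] := af z zP.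
have ps : has_pseries a z r f.
  move=> u ur; have := cvg_ctends (Ha u ur); apply: ctends_ext => N.
  by rewrite /series /= big_mkord.
have r80 : 0 < r / 8 by rewrite divr_gt0.
have [f' ff' cf'] := pseries_C1 r0 ps.
have zz : cmod (z - z) < r / 8 by rewrite subrr cmod0.
split; first by rewrite (cderive_eq (ff' _ zz)); exact: ff'.
apply: ccont_near cf' => [|h hr]; first exact: r80.
by rewrite (cderive_eq (ff' _ _))// [z + h]addrC addrK.
Qed.

(** The quotient with its removable singularity filled in. Cauchy's formula for [f] at [z] will
    follow from the existence of a primitive of this function. *)
Definition dquot f z u := if u == z then Cderive f z else (f u - f z) / (u - z).

(** Away from [z] this is the quotient rule; at [z] the quotient is the power series of [f] with its
    coefficients shifted by one. *)
Lemma hol_dquot f z : analytic_on (upper_half (R := R)) f -> upper_half z ->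
  hol (dquot f z).
Proof.
move=> af zP; have hf := analytic_hol af.
pose D u := Cderive f u * (u - z)^-1 + (f u - f z) * - (u - z) ^- 2.
have dD u : upper_half u -> u != z -> cderiv (dquot f z) u (D u).
  move=> uP uz; have uz0 : 0 < cmod (u - z) by rewrite cmod_gt0 subr_eq0.
  have := cderivM (cderivB (hf u uP).1 (cderiv_cst (f z) u)) (cderiv_inv uz).
  rewrite subr0; apply: cderiv_near => [|h hr]; first exact: uz0.
  rewrite /dquot ifF//; apply/eqP => uhz; move: hr.
  by rewrite -uhz opprD addNKr cmodN ltxx.
have [r r0 [a Ha]] := af z zP.
have ps : has_pseries a z r f.
  move=> u ur; have := cvg_ctends (Ha u ur); apply: ctends_ext => N.
  by rewrite /series /= big_mkord.
have r80 : 0 < r / 8 by rewrite divr_gt0.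
have fz : Cderive f z = a 1%N.
  have [f' pf' ff'] := pseries_derivative r0 ps.
  rewrite (cderive_eq (ff' z _)) ?subrr ?cmod0// (pseries_coef0 _ pf')//.
  by rewrite mul1r.
have pq : has_pseries (fun n => a n.+1) z r (dquot f z).
  apply: (pseries_quotient r0 ps); last by rewrite /dquot eqxx.
  by move=> u uz; rewrite /dquot (negbTE uz).
have [q' dq' cq'] := pseries_C1 r0 pq.
move=> u uP; have [->|uz] := eqVneq u z.
  have zz : cmod (z - z) < r / 8 by rewrite subrr cmod0.
  split; first by rewrite (cderive_eq (dq' _ zz)); exact: dq'.
  apply: ccont_near cq' => [|h hr]; first exact: r80.
  by rewrite (cderive_eq (dq' _ _))// [z + h]addrC addrK.
split; first by rewrite (cderive_eq (dD _ uP uz)); exact: dD.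
have cinv : ccont (fun v => (v - z)^-1) u by exact: cderiv_ccont (cderiv_inv uz).
have cD : ccont D u.
  apply: ccontD; first exact: ccontM (hf u uP).2 cinv.
  apply: ccontM; first exact: ccontD (hol_ccont hf uP) (ccont_cst _ _).
  apply: (ccont_near (r := 1)) (ccontZ (-1) (ccontM cinv cinv)) => // h _.
  by rewrite mulN1r -expr2 exprVn.
have uz0 : 0 < cmod (u - z) by rewrite cmod_gt0 subr_eq0.
have m0 : 0 < Num.min (complex.Im u) (cmod (u - z)) by rewrite lt_min uz0 andbT.
apply: (ccont_near m0) cD => h hr.
move: hr; rewrite lt_min => /andP[h1 h2].
rewrite (cderive_eq (dD _ (upper_half_ball h1) _))//; apply/eqP => uhz; move: h2.
by rewrite -uhz opprD addNKr cmodN ltxx.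
Qed.

Lemma seg_upper_half s t (x : R) : upper_half s -> upper_half t -> 0 <= x <= 1 ->
  upper_half (seg_param s t x).
Proof.
rewrite /upper_half /= => sP tP /andP[x0 x1].
rewrite /seg_param cImD Im_real_mul cImB.
have -> : complex.Im s + x * (complex.Im t - complex.Im s) =
  (1 - x) * complex.Im s + x * complex.Im t by ring.
have [->|xn0] := eqVneq x 0; first by rewrite subr0 mul1r mul0r addr0.
have xp : 0 < x by rewrite lt_neqAle eq_sym xn0.
by rewrite ltr_wpDl ?mulr_gt0// mulr_ge0 ?subr_ge0// ltW.
Qed.

(** The half plane is convex, so a primitive is unique up to a constant. The algebraic identities
    between iterated integrals are all proved in this way, by differentiating in the upper end
    point. *)
Lemma hol_deriv_eq f g f' s t : upper_half s -> upper_half t ->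
  (forall z, upper_half z -> cderiv f z (f' z)) ->
  (forall z, upper_half z -> cderiv g z (f' z)) -> f t - f s = g t - g s.
Proof.
move=> sP tP ff' gf'; apply/eqP; rewrite -subr_eq0; apply/eqP/cmod_small0 => e e0.
have E : f t - f s - (g t - g s) = (f t - g t) - (f s - g s) by ring.
rewrite E; have := @mean_value_ineq_cst R (fun u => f u - g u) (fun=> 0) s t 0.
move=> H; apply: (le_trans (H _ _)); [|by move=> x _; rewrite cmod0|by rewrite mul0r ltW].
move=> x x01.
have xP := seg_upper_half sP tP x01.
by have := cderivB (ff' _ xP) (gf' _ xP); rewrite subrr.
Qed.

End HolomorphicFunctions.

(** * Integrals along segments and primitives *)

Section UnitIntervalIntegral.
Variable R : realType.
Local Notation mu := (@lebesgue_measure R).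
Implicit Types (phi psi : R -> R[i]) (f g h : R[i] -> R[i]) (s t z u : R[i]).

Definition cint phi : R[i] := (\int[mu]_(x in `[0, 1]) complex.Re (phi x))
  +i* (\int[mu]_(x in `[0, 1]) complex.Im (phi x)).

Lemma seg_intE f s t : seg_int f s t = (t - s) * cint (fun x => f (seg_param s t x)).
Proof. by []. Qed.

Lemma FTC_unit (F f : R -> R) : (forall x : R, 0 <= x <= 1 -> is_derive x 1 F (f x)) ->
  (forall x : R, 0 <= x <= 1 -> {for x, continuous f}) ->
  \int[mu]_(x in `[0, 1]) f x = F 1 - F 0.
Proof.
move=> Ff cf; rewrite /Rintegral (@continuous_FTC2 _ f F 0 1)//.
- by apply: continuous_in_subspaceT => x; rewrite inE /= in_itv /= => /cf.
- have cF (x : R) : 0 <= x <= 1 -> {for x, continuous F}.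
    by move=> /Ff[dF _]; apply: differentiable_continuous; exact/derivable1_diffP.
  split; last 2 first.
  + by apply: cvg_at_right_filter; apply: cF; rewrite lexx ler01.
  + by apply: cvg_at_left_filter; apply: cF; rewrite lexx ler01.
  by move=> x; rewrite in_itv /= => /andP[/ltW x0 /ltW x1]; have [] : is_derive x 1 F (f x) by apply: Ff; rewrite x0.
- move=> x; rewrite in_itv /= => /andP[/ltW x0 /ltW x1].
  have [_ <-] : is_derive x 1 F (f x) by apply: Ff; rewrite x0.
  by rewrite derive1E.
Qed.

Lemma continuous_for_ext (f g : R -> R) (x : R) : f =1 g ->
  {for x, continuous f} -> {for x, continuous g}.
Proof. by move=> /funext ->. Qed.

(** Continuity is tested on the real parts of all multiples, which is what [ccont_line] provides and
    what is stable under multiplication by constants. *)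
Definition rcont phi := forall (c : R[i]) (x : R), 0 <= x <= 1 ->
  {for x, continuous (fun y => complex.Re (c * phi y))}.

Lemma rcont_re phi (x : R) : rcont phi -> 0 <= x <= 1 ->
  {for x, continuous (fun y => complex.Re (phi y))}.
Proof.
move=> /(_ 1 x) /[apply]; apply: continuous_for_ext => y; by rewrite mul1r.
Qed.

Lemma rcont_im phi (x : R) : rcont phi -> 0 <= x <= 1 ->
  {for x, continuous (fun y => complex.Im (phi y))}.
Proof.
move=> /(_ (0 +i* -1) x) /[apply]; apply: continuous_for_ext => y.
by rewrite cReM /= mul0r sub0r mulN1r opprK.
Qed.

Lemma integrable_unit (f : R -> R) : (forall x : R, 0 <= x <= 1 -> {for x, continuous f}) ->
  mu.-integrable `[0, 1] (EFin \o f).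
Proof.
move=> cf; apply: continuous_compact_integrable; first exact: segment_compact.
by apply: continuous_in_subspaceT => x; rewrite inE /= in_itv /= => /cf.
Qed.

Lemma cintD phi psi : rcont phi -> rcont psi ->
  cint (fun x => phi x + psi x) = cint phi + cint psi.
Proof.
move=> cphi cpsi; apply: eq_ReIm; rewrite !ReIm /=.
  rewrite -RintegralD//; first by apply: eq_Rintegral => x _; rewrite cReD.
  - by apply: integrable_unit => x; exact: rcont_re.
  - by apply: integrable_unit => x; exact: rcont_re.
rewrite -RintegralD//; first by apply: eq_Rintegral => x _; rewrite cImD.
- by apply: integrable_unit => x; exact: rcont_im.
- by apply: integrable_unit => x; exact: rcont_im.
Qed.

Lemma cintZ c phi : rcont phi -> cint (fun x => c * phi x) = c * cint phi.
Proof.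
move=> cphi.
have ire := integrable_unit (fun x => @rcont_re _ x cphi).
have iim := integrable_unit (fun x => @rcont_im _ x cphi).
have iZ (a : R) (f : R -> R) : mu.-integrable `[0, 1] (EFin \o f) ->
    mu.-integrable `[0, 1] (EFin \o (fun x => a * f x)).
  by move=> /(integrableZl _ a); exact.
apply: eq_ReIm; rewrite !ReIm /=.
  rewrite -!RintegralZl// -RintegralB ?iZ//.
  by apply: eq_Rintegral => x _; rewrite cReM.
rewrite -!RintegralZl// -RintegralD ?iZ//.
by apply: eq_Rintegral => x _; rewrite cImM.
Qed.

Lemma eq_cint phi psi : (forall x, 0 <= x <= 1 -> phi x = psi x) -> cint phi = cint psi.
Proof.
move=> pp; apply: eq_ReIm; apply: eq_Rintegral => x; rewrite inE /= in_itv /= => x01;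
  by rewrite pp.
Qed.

Lemma Rintegral_unit_le (f : R -> R) (e : R) :
  (forall x : R, 0 <= x <= 1 -> {for x, continuous f}) ->
  (forall x, 0 <= x <= 1 -> `|f x| <= e) -> `|\int[mu]_(x in `[0, 1]) f x| <= e.
Proof.
move=> cf fe; have intf := integrable_unit cf.
apply: (le_trans (le_normr_Rintegral _ intf)) => //.
have E : e = \int[mu]_(x in `[0, 1]) e.
  by rewrite Rintegral_cst//= lebesgue_measure_itv/= lte_fin ltr01 oppr0 adde0 mulr1.
rewrite [leRHS]E; apply: le_Rintegral => //.
- by apply: integrable_unit => x x01; apply: (continuous_comp (cf x x01)); exact: norm_continuous.
- by apply: integrable_unit => x _; exact: cst_continuous.
Qed.

Lemma cmod_cint_le phi (e : R) : rcont phi ->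
  (forall x, 0 <= x <= 1 -> cmod (phi x) <= e) -> cmod (cint phi) <= 2 * e.
Proof.
move=> cphi phie; rewrite (le_trans (cmod_le_ReIm _))// mulr2n mulrDl mul1r /= lerD//.
  apply: Rintegral_unit_le => [x|x /phie]; first exact: rcont_re.
  exact: le_trans (cmod_Re _).
apply: Rintegral_unit_le => [x|x /phie]; first exact: rcont_im.
exact: le_trans (cmod_Im _).
Qed.

Lemma rcontD phi psi : rcont phi -> rcont psi -> rcont (fun x => phi x + psi x).
Proof.
move=> c1 c2 c x x01.
have := continuousD (c1 c x x01) (c2 c x x01); apply: continuous_for_ext => y.
by rewrite mulrDr cReD.
Qed.

Lemma rcontZ c phi : rcont phi -> rcont (fun x => c * phi x).
Proof.
move=> c1 a x x01; have := c1 (a * c) x x01.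
by apply: continuous_for_ext => y; rewrite mulrA.
Qed.

Lemma rcont_realM phi : rcont phi -> rcont (fun x => x%:C * phi x).
Proof.
move=> c1 c x x01; have idc : {for x, continuous (@id R)} by exact: cvg_id.
have := continuousM idc (c1 c x x01); apply: continuous_for_ext => y.
by rewrite mulrCA Re_real_mul.
Qed.

Lemma rcont_line f a b : (forall x : R, 0 <= x <= 1 -> ccont f (a + x%:C * b)) ->
  rcont (fun x => f (a + x%:C * b)).
Proof. by move=> cf c x x01; apply: ccont_line; exact: cf. Qed.

(* Compactness of [0, 1]. *)
Lemma unit_interval_unif (Q : R -> R -> Prop) :
  (forall x dl dl', 0 < dl' <= dl -> Q x dl -> Q x dl') ->
  (forall x, 0 <= x <= 1 -> exists2 dl, 0 < dl & forall y, `|x - y| < dl -> Q y dl) ->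
  exists2 dl, 0 < dl & forall x, 0 <= x <= 1 -> Q x dl.
Proof.
move=> Qmono Qloc.
have /compact_near_coveringP := @segment_compact R 0 1.
move=> /(_ R (0^'+)%R (fun dl x => Q x dl) _).
case.
  move=> x; rewrite /= in_itv /= => /Qloc[dl dl0 Hdl].
  exists (ball x dl, [set e | 0 < e <= dl]).
    split; first exact: nbhsx_ballx.
    by near=> e; rewrite /=; apply/andP; split; near: e; [exact: nbhs_right_gt|exact: nbhs_right_le].
  by move=> [y e] [/= xy e0]; apply: Qmono e0 _; apply: Hdl.
move=> e /= e0 He.
exists (e / 2); first by rewrite divr_gt0.
move=> x x01; apply: (He (e / 2)) => /=.
- by rewrite sub0r normrN gtr0_norm ?divr_gt0// ltr_pdivrMr// ltr_pMr// ltr1n.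
- by rewrite divr_gt0.
- by rewrite in_itv.
Unshelve. all: end_near.
Qed.

(** The expansion is uniform in the base point [v] near [u]: the mean value inequality is applied to
    [f w - w f'(u)], whose derivative is small near [u]. *)
Lemma hol_taylor1 f u (e : R) : hol f -> upper_half u -> 0 < e ->
  exists2 dl : R, 0 < dl & forall v (h : R[i]), cmod (v - u) < dl -> cmod h < dl ->
    cmod (f (v + h) - f v - h * Cderive f v) <= e * cmod h /\
    cmod (f (v + h) - f v) <= e.
Proof.
move=> hf uP e0; have e2 : 0 < e / 2 by rewrite divr_gt0.
have [d1 d10 H1] := (hf u uP).2 _ e2; have [d2 d20 H2] := hol_ccont hf uP e2.
pose dl := Num.min (Num.min (d1 / 2) (d2 / 2)) (complex.Im u / 2).
have dl0 : 0 < dl by rewrite !lt_min !divr_gt0.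
exists dl => // v h; rewrite !lt_min => /andP[/andP[v1 v2] v3] /andP[/andP[h1 h2] h3].
have nr (x : R) : 0 <= x <= 1 -> cmod (v - u + x%:C * h) <= cmod (v - u) + cmod h.
  move=> /andP[x0 x1]; rewrite (le_trans (cmodD _ _))// lerD2l cmodM cmod_real ger0_norm//.
  by rewrite ler_piMl ?cmod_ge0.
split.
  have key : cmod ((f (v + h) - (v + h) * Cderive f u) - (f v - v * Cderive f u)) <=
      e / 2 * cmod (v + h - v).
    apply: (@mean_value_ineq_cst _ (fun w => f w - w * Cderive f u)
      (fun w => Cderive f w - Cderive f u)) => x x01.
      have xP : upper_half (seg_param v (v + h) x).
        rewrite /seg_param [v + h]addrC addrK -[v](subrK u) addrAC addrC.
        by apply: upper_half_ball; rewrite (le_lt_trans (nr _ x01))//; lra.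
      apply: cderivB; first exact: (hf _ xP).1.
      have := cderivM (cderiv_id (seg_param v (v + h) x)) (cderiv_cst (Cderive f u) _).
      by rewrite mul1r mulr0 addr0.
    rewrite /seg_param [v + h]addrC addrK -[v](subrK u) addrAC addrC.
    by apply: H1; rewrite (le_lt_trans (nr _ x01))//; lra.
  have E (a b p q : R[i]) : a - b - h * q =
    ((a - (v + h) * p) - (b - v * p)) - h * (q - p) by ring.
  rewrite (E _ _ (Cderive f u)).
  have -> : e * cmod h = e / 2 * cmod h + e / 2 * cmod h by rewrite -mulrDl -splitr.
  rewrite (le_trans (cmodB _ _))// lerD//.
    by rewrite [v + h in X in _ <= X]addrC addrK in key.
  rewrite cmodM mulrC ler_wpM2r ?cmod_ge0//.
  by have := H1 (v - u); rewrite [u + _]addrC subrK; apply; lra.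
have -> : f (v + h) - f v = (f (u + (v - u + h)) - f u) - (f (u + (v - u)) - f u).
  by rewrite addrA ![u + (v - u)]addrC subrK; ring.
rewrite (le_trans (cmodB _ _))// [leRHS]splitr lerD// H2//; last lra.
by rewrite (le_lt_trans (cmodD _ _))//; lra.
Qed.

Lemma hol_taylor1_seg f s z (e : R) : hol f -> upper_half s -> upper_half z -> 0 < e ->
  exists2 dl : R, 0 < dl & forall x, 0 <= x <= 1 -> forall h : R[i], cmod h < dl ->
    cmod (f (seg_param s z x + h) - f (seg_param s z x)
          - h * Cderive f (seg_param s z x)) <= e * cmod h /\
    cmod (f (seg_param s z x + h) - f (seg_param s z x)) <= e.
Proof.
move=> hf sP zP e0.
apply: (unit_interval_unif (Q := fun x dl => forall h : R[i], cmod h < dl -> _ /\ _)).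
  move=> x dl dl' /andP[_ le] H h hdl'; apply: H; exact: lt_le_trans hdl' le.
move=> x x01; have [dl dl0 H] := hol_taylor1 hf (seg_upper_half sP zP x01) e0.
have bK : 0 < 1 + cmod (z - s) by rewrite ltr_pwDl// cmod_ge0.
have m0 : 0 < Num.min dl (dl / (1 + cmod (z - s))) by rewrite lt_min dl0 divr_gt0.
exists (Num.min dl (dl / (1 + cmod (z - s)))) => // y; rewrite lt_min => /andP[_ y2] h.
rewrite lt_min => /andP[h1 _]; apply: H => //.
have -> : seg_param s z y - seg_param s z x = (y - x)%:C * (z - s).
  by rewrite /seg_param rmorphB /=; ring.
rewrite ltr_pdivlMr// in y2.
rewrite cmodM cmod_real distrC (le_lt_trans _ y2)// ler_wpM2l//.
by rewrite lerDr.
Qed.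

(* [z * \int_0^1 h (s + x z) dx] is differentiated under the integral sign; the
   derivative of the integrand is the total derivative of [x * h (s + x z)]. *)
Lemma cderiv_seg_int h s z : hol h -> upper_half s -> upper_half z ->
  cderiv (fun u => seg_int h s u) z (h z).
Proof.
move=> hh sP zP e e0.
have bK : 0 < 1 + cmod (z - s) by rewrite ltr_pwDl// cmod_ge0.
(* The [2] compensates the factor in [cmod_cint_le]; the sum [1 + |z - s|] collects the two error
   terms of the integrand [E]. *)
pose e1 := e / (2 * (1 + cmod (z - s))).
have e10 : 0 < e1 by rewrite divr_gt0// mulr_gt0.
have [dl dl0 H] := hol_taylor1_seg hh sP zP e10.
have m0 : 0 < Num.min dl (complex.Im z) by rewrite lt_min dl0.
exists (Num.min dl (complex.Im z)) => // d; rewrite lt_min => /andP[d1 d2].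
have zdP : upper_half (z + d) by exact: upper_half_ball.
pose U (x : R) := seg_param s z x.
have Ud (x : R) : seg_param s (z + d) x = U x + x%:C * d.
  by rewrite /U /seg_param; ring.
pose D (x : R) := h (U x) + x%:C * ((z - s) * Cderive h (U x)).
have cU : rcont (fun x => h (U x)).
  by apply: rcont_line => x x01; apply: hol_ccont hh _; exact: seg_upper_half.
have cU' : rcont (fun x => Cderive h (U x)).
  by apply: rcont_line => x x01; apply: (hh _ _).2; exact: seg_upper_half.
have cUd : rcont (fun x => h (U x + x%:C * d)).
  have : rcont (fun x => h (s + x%:C * (z + d - s))).
    by apply: rcont_line => x x01; apply: hol_ccont hh _; exact: (seg_upper_half sP zdP).
  by congr rcont; apply/funext => x; rewrite -Ud.
have cD : rcont D by apply: rcontD => //; apply: rcont_realM; exact: rcontZ.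
have hz : cint D = h z.
  have key (c : R[i]) : \int[mu]_(x in `[0, 1]) complex.Re (c * D x) = complex.Re (c * h z).
    apply: etrans (FTC_unit (F := fun x : R => x * complex.Re (c * h (U x))) _ _) _; last first.
    - by rewrite mul1r mul0r subr0 /U /seg_param rmorph1 mul1r [s + _]addrC subrK.
    - by move=> x x01; exact: cD.
    - move=> x x01.
      have dU := cderiv_line c (hh _ (seg_upper_half sP zP x01)).1.
      have := is_deriveM (is_derive_id x 1) dU.
      suff -> : complex.Re (c * D x) =
          x *: complex.Re (c * (Cderive h (U x) * (z - s))) + complex.Re (c * h (U x)) *: 1.
        by [].
      rewrite /D mulrDr cReD mulrCA Re_real_mul addrC [Cderive _ _ * _]mulrC.
      by rewrite [_ *: 1]mulr1.
  apply: eq_ReIm => /=.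
    by have := key 1; rewrite mul1r => <-; apply: eq_Rintegral => x _; rewrite mul1r.
  have := key (0 +i* -1); rewrite [in RHS]cReM /= mul0r sub0r mulN1r opprK => <-.
  by apply: eq_Rintegral => x _; rewrite cReM /= mul0r sub0r mulN1r opprK.
pose E (x : R) := (z + d - s) * h (U x + x%:C * d) + (- (z - s)) * h (U x) + (- d) * D x.
have c1 := rcontZ (c := z + d - s) cUd; have c2 := rcontZ (c := - (z - s)) cU.
have c3 := rcontZ (c := - d) cD.
have -> : seg_int h s (z + d) - seg_int h s z - d * h z = cint E.
  rewrite /E (cintD (rcontD c1 c2) c3) (cintD c1 c2) (cintZ _ cUd) (cintZ _ cU).
  rewrite (cintZ _ cD) hz.
  rewrite !seg_intE -!mulNr; congr (_ * _ + _ + _).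
  by apply: eq_cint => x _; rewrite Ud.
rewrite (le_trans (cmod_cint_le (e := e / 2 * cmod d) _ _))//.
- exact: rcontD (rcontD c1 c2) c3.
- move=> x x01; have /andP[x0 x1] := x01.
  have xd : cmod (x%:C * d) <= cmod d.
    by rewrite cmodM cmod_real ger0_norm// ler_piMl ?cmod_ge0.
  have [|H1 H2] := H x x01 (x%:C * d); first exact: le_lt_trans xd d1.
  have EE (a b p : R[i]) : (z + d - s) * a + - (z - s) * b + - d * (b + x%:C * ((z - s) * p)) =
    (z - s) * (a - b - x%:C * d * p) + d * (a - b) by ring.
  rewrite /E /D EE.
  rewrite (le_trans (cmodD _ _))// !cmodM.
  have -> : e / 2 * cmod d = cmod (z - s) * (e1 * cmod d) + cmod d * e1.
    by rewrite /e1; field; rewrite gt_eqF.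
  rewrite lerD// ler_wpM2l ?cmod_ge0//.
  by rewrite (le_trans H1)// ler_wpM2l// ltW.
- by rewrite mulrA mulrCA mulfV ?mulr1.
Qed.

Lemma hol_seg_int h s : hol h -> upper_half s -> hol (fun u => seg_int h s u).
Proof.
move=> hh sP; apply: (@hol_intro _ _ h) => z zP; first exact: cderiv_seg_int.
exact: hol_ccont.
Qed.

End UnitIntervalIntegral.

(** * Iterated integrals *)

Section IteratedIntegrals.
Variables (R : realType) (I : Type).
Implicit Types (i j : I) (w v : seq I) (s t u z : R[i]).

(* The iterated integrals of [iter_int], as functions of the integrands. *)
Fixpoint chen_int (h : I -> R[i] -> R[i]) w t s : R[i] :=
  if w is i :: w' then seg_int (fun u => h i u * chen_int h w' u s) s t else 1.

Lemma iter_int_chen (f h : I -> R[i] -> R[i]) w t s :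
  upper_half t -> upper_half s ->
  (forall i z, upper_half z -> Cderive (f i) z = h i z) ->
  iter_int f w t s = chen_int h w t s.
Proof.
move=> + sP fh; elim: w t => //= i w IH t tP.
rewrite !seg_intE; congr (_ * _); apply: eq_cint => x x01.
have xP := seg_upper_half sP tP x01.
by rewrite fh// IH.
Qed.

Lemma Cderive_shift (eps : R) (f : R[i] -> R[i]) z :
  Cderive (shift_path eps f) z = Cderive f (ishift eps z).
Proof.
rewrite /Cderive /derive1.
suff -> : (fun h : (R[i])^o => h^-1 *: ((shift_path eps f : (R[i])^o -> (R[i])^o) (h + z)
    - shift_path eps f z)) =
  (fun h => h^-1 *: ((f : (R[i])^o -> (R[i])^o) (h + ishift eps z) - f (ishift eps z))).
  by [].
by apply/funext => h; rewrite /shift_path /ishift addrA.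
Qed.

Lemma iter_int_shift (eps : R) (f : I -> R[i] -> R[i]) w t s :
  iter_int (fun i => shift_path eps (f i)) w t s =
  iter_int f w (ishift eps t) (ishift eps s).
Proof.
elim: w t => //= i w IH t; rewrite !seg_intE.
have -> : ishift eps t - ishift eps s = t - s by rewrite /ishift; ring.
congr (_ * _); apply: eq_cint => x _; rewrite Cderive_shift IH.
by have -> : ishift eps (seg_param s t x) = seg_param (ishift eps s) (ishift eps t) x
  by rewrite /ishift /seg_param; ring.
Qed.

(** The shuffles as a list, with repetitions. First letters are the outermost integrands, so that
    the recursion on them mirrors the product rule. *)
Fixpoint shuffles w : seq I -> seq (seq I) :=
  fix sh v := match w, v with
  | i :: w', j :: v' => [seq i :: l | l <- shuffles w' v] ++ [seq j :: l | l <- sh v']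
  | [::], _ => [:: v]
  | _, [::] => [:: w]
  end.

Section Holomorphic.
Variable h : I -> R[i] -> R[i].
Hypothesis holh : forall i, hol (h i).
Local Notation G := (chen_int h).

Lemma hol_chen w s : upper_half s -> hol (fun u => G w u s).
Proof.
move=> sP; elim: w => [|i w IH] /=; first exact: hol_cst.
exact: (@hol_seg_int _ (fun u => h i u * G w u s) s (holM (holh i) IH) sP).
Qed.

Lemma cderiv_chen i w s z : upper_half s -> upper_half z ->
  cderiv (fun u => G (i :: w) u s) z (h i z * G w z s).
Proof.
move=> sP zP; apply: (@cderiv_seg_int _ (fun u => h i u * G w u s)) => //.
by apply: holM => //; exact: hol_chen.
Qed.

Lemma chen_diag i w s : G (i :: w) s s = 0.
Proof. by rewrite /= seg_intE subrr mul0r. Qed.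

(** As functions of [t], both sides agree at [t = u] and, by induction on the word, have the same
    derivative. *)
Lemma chen_relation w t u s : upper_half t -> upper_half u -> upper_half s ->
  G w t s = \sum_(j < (size w).+1) G (take j w) t u * G (drop j w) u s.
Proof.
move=> + uP sP; elim: w t => [|i w IH] t tP.
  by rewrite big_ord_recl big_ord0 /= mul1r addr0.
pose F z := G (i :: w) u s + \sum_(j < (size w).+1) G (i :: take j w) z u * G (drop j w) u s.
have -> : \sum_(j < (size (i :: w)).+1) G (take j (i :: w)) t u * G (drop j (i :: w)) u s = F t.
  by rewrite big_ord_recl /= mul1r.
have Fu : F u = G (i :: w) u s.
  rewrite /F big1 ?addr0// => j _; by rewrite chen_diag mul0r.
have := @hol_deriv_eq _ (fun z => G (i :: w) z s) F (fun z => h i z * G w z s) u t uP tP.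
rewrite Fu => H; apply: (addIr (- G (i :: w) u s)); apply: H => z zP.
  exact: cderiv_chen.
rewrite -[h i z * _]add0r; apply: cderivD; first exact: cderiv_cst.
rewrite IH// mulr_sumr; apply: cderiv_sum => j.
have := cderivM (cderiv_chen i (take j w) uP zP) (cderiv_cst (G (drop j w) u s) z).
by rewrite mulr0 addr0 mulrA.
Qed.

(** Both sides vanish at [t = s]; the two terms of the product rule match the two families of
    shuffles, according to the first letter. *)
Lemma chen_shuffle w v t s : upper_half t -> upper_half s ->
  G w t s * G v t s = \sum_(l <- shuffles w v) G l t s.
Proof.
move=> + sP; elim: w v t => [|i w IHw] v t tP.
  by case: v => [|j v]; rewrite /= big_seq1 mul1r.
elim: v t tP => [|j v IHv] t tP.
  by rewrite [in LHS]/= mulr1 /= big_seq1.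
pose F z := \sum_(l <- shuffles (i :: w) (j :: v)) G l z s.
have := @hol_deriv_eq _ (fun z => G (i :: w) z s * G (j :: v) z s) F
  (fun z => h i z * G w z s * G (j :: v) z s + G (i :: w) z s * (h j z * G v z s)) s t sP tP.
have FE z : F z = \sum_(l <- shuffles w (j :: v)) G (i :: l) z s +
    \sum_(l <- shuffles (i :: w) v) G (j :: l) z s.
  by rewrite /F /= big_cat !big_map.
have Fs : F s = 0.
  by rewrite FE !big1 ?addr0// => l _; rewrite chen_diag.
rewrite Fs chen_diag mul0r !subr0; apply => z zP.
  by apply: cderivM; exact: cderiv_chen.
apply: (@cderiv_near _ (fun z => \sum_(l <- shuffles w (j :: v)) G (i :: l) z s +
    \sum_(l <- shuffles (i :: w) v) G (j :: l) z s) F z _ 1) => [//|y _|].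
  by rewrite FE.
apply: cderivD.
  rewrite -mulrA IHw// mulr_sumr; apply: cderiv_sum => l; exact: cderiv_chen.
rewrite mulrCA IHv// mulr_sumr; apply: cderiv_sum => l; exact: cderiv_chen.
Qed.

Lemma sum_expr_le (a b : R) n : 0 <= a -> 0 <= b ->
  \sum_(j < n.+1) a ^+ j * b ^+ (n - j) <= (a + b) ^+ n.
Proof.
move=> a0 b0; rewrite addrC exprDn; apply: ler_sum => j _.
rewrite mulrC -mulr_natr ler_peMr ?mulr_ge0 ?exprn_ge0//.
by rewrite ler1n bin_gt0 -ltnS.
Qed.

(** By Chen's relation, bounds of the form [A ^+ size w] for all words are stable under
    concatenation of paths, with [A] additive like a length. *)
Lemma chen_bound_concat (A B : R) t u s : 0 <= A -> 0 <= B ->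
  upper_half t -> upper_half u -> upper_half s ->
  (forall w, cmod (G w t u) <= A ^+ size w) ->
  (forall w, cmod (G w u s) <= B ^+ size w) ->
  forall w, cmod (G w t s) <= (A + B) ^+ size w.
Proof.
move=> A0 B0 tP uP sP HA HB w.
rewrite (@chen_relation w t u s)// (le_trans (cmod_sum _ _ _))//.
apply: le_trans (sum_expr_le (size w) A0 B0); apply: ler_sum => j _.
rewrite cmodM ler_pM ?cmod_ge0//.
  by rewrite (le_trans (HA _))// size_takel// -ltnS.
by rewrite (le_trans (HB _))// size_drop.
Qed.

Lemma chen_bound_seg (Phi phi : R -> R) (A : R) s t :
  upper_half s -> upper_half t -> 0 <= A ->
  (forall x : R, 0 <= x <= 1 -> is_derive x 1 Phi (phi x)) ->
  (forall i (x : R), 0 <= x <= 1 -> cmod (h i (seg_param s t x)) * cmod (t - s) <= phi x) ->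
  (forall x : R, 0 <= x <= 1 -> Phi x - Phi 0 <= A) ->
  forall w, cmod (G w t s) <= A ^+ size w.
Proof.
move=> sP tP A0 dPhi hphi PhiA w.
have t1 : seg_param s t 1 = t by rewrite /seg_param rmorph1 mul1r addrC subrK.
(* The induction needs every point of the segment, since the inner integrals end there. *)
suff H (x : R) : 0 <= x <= 1 -> cmod (G w (seg_param s t x) s) <= A ^+ size w.
  by rewrite -{1}t1; apply: H; rewrite ler01 lexx.
elim: w x => [|i w IH] x x01; first by change (cmod (1 : R[i]) <= 1); rewrite cmod1.
have [x0 x1] := andP x01.
set z := seg_param s t x.
have zE (y : R) : seg_param s z y = seg_param s t (x * y).
  by rewrite /z /seg_param rmorphM /=; ring.
have zs : z - s = x%:C * (t - s) by rewrite /z /seg_param; ring.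
have zP : upper_half z by exact: seg_upper_half.
have xy01 (y : R) : 0 <= y <= 1 -> 0 <= x * y <= 1.
  by move=> /andP[y0 y1]; rewrite mulr_ge0//= mulr_ile1.
rewrite -[G (i :: w) z s]subr0 -(chen_diag i w s) [A ^+ _]exprS mulrC.
have Ak : 0 <= A ^+ size w by rewrite exprn_ge0.
have dPhi' (y : R) : 0 <= y <= 1 ->
    is_derive y 1 (fun y => A ^+ size w * Phi (x * y)) (A ^+ size w * (x * phi (x * y))).
  move=> y01.
  have d1 : is_derive y 1 (fun y : R => x * y) x.
    have := is_deriveZ x (is_derive_id y 1).
    by rewrite [_ *: 1]mulr1.
  have d2 := dPhi _ (xy01 _ y01).
  have d3 := is_derive1_comp d2 d1.
  have := is_deriveZ (A ^+ size w) d3.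
  by rewrite [phi _ * x]mulrC.
apply: (le_trans (@mean_value_ineq _ (fun u => G (i :: w) u s)
  (fun y => h i (seg_param s z y) * G w (seg_param s z y) s) s z
  (fun y => A ^+ size w * Phi (x * y)) (fun y => A ^+ size w * (x * phi (x * y))) _ _ _ _)).
- by move=> y y01; apply: cderiv_chen => //; exact: seg_upper_half.
- apply: derivable_within_continuous => y; rewrite in_itv /= => y01.
  by have [] := dPhi' _ y01.
- by move=> y /andP[/ltW y0 /ltW y1]; apply: dPhi'; rewrite y0.
- move=> y /andP[/ltW y0 /ltW y1].
  have y01 : 0 <= y <= 1 by rewrite y0.
  rewrite zE zs !cmodM cmod_real ger0_norm//.
  have -> : cmod (h i (seg_param s t (x * y))) * cmod (G w (seg_param s t (x * y)) s) *
    (x * cmod (t - s)) = cmod (G w (seg_param s t (x * y)) s) *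
    (x * (cmod (h i (seg_param s t (x * y))) * cmod (t - s))) by ring.
  rewrite ler_pM ?cmod_ge0 ?mulr_ge0 ?cmod_ge0//; first exact: IH (xy01 _ y01).
  by rewrite ler_wpM2l// hphi// xy01.
- by rewrite mulr1 mulr0 -mulrBr ler_wpM2l// PhiA.
Qed.

End Holomorphic.
End IteratedIntegrals.

Arguments cmod : simpl never.

(** * Bounds by detours away from the boundary *)

Section PathBounds.
Variables (R : realType) (I : Type).
Implicit Types (w : seq I) (s t z : R[i]) (a b l x y : R).

(** On [[0, 1]] a number is at most its power [g]; this is applied to [a / (a + b)] and
    [b / (a + b)], whose sum is [1]. *)
Lemma powR_subadd (g a b : R) : 0 < g <= 1 -> 0 <= a -> 0 <= b ->
  (a + b) `^ g <= a `^ g + b `^ g.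
Proof.
move=> /andP[g0 g1] a0 b0; have [->|an0] := eqVneq a 0.
  by rewrite add0r lerDr powR_ge0.
have [->|bn0] := eqVneq b 0; first by rewrite addr0 lerDl powR_ge0.
have ap : 0 < a by rewrite lt_neqAle eq_sym an0.
have bp : 0 < b by rewrite lt_neqAle eq_sym bn0.
have ab : 0 < a + b by rewrite addr_gt0.
have H (c : R) : 0 < c <= a + b -> (a + b) `^ g * (c / (a + b)) <= c `^ g.
  move=> /andP[c0 cab].
  rewrite -[X in _ <= X `^ g](@mulfVK _ (a + b)) ?gt_eqF//.
  rewrite powRM ?divr_ge0 ?(ltW c0) ?(ltW ab)// mulrC.
  by rewrite ler_wpM2r ?powR_ge0// ger1_powR// divr_gt0//= ler_pdivrMr// mul1r.
have Ha := H a; have Hb := H b.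
rewrite ap lerDl ltW//= in Ha; rewrite bp lerDr ltW//= in Hb.
apply: le_trans (lerD (Ha isT) (Hb isT)).
by rewrite -mulrDr -mulrDl divff ?mulr1// gt_eqF.
Qed.

Variables (h : I -> R[i] -> R[i]) (holh : forall i, hol (h i)) (M g : R).
Hypotheses (M0 : 0 <= M) (g01 : 0 < g <= 1).
Local Notation G := (chen_int h).

Let g0 : 0 < g. Proof. by case/andP: g01. Qed.

Lemma powR_line_deriv (b l x : R) : 0 < b + x * l ->
  is_derive x 1 (fun y : R => M / g * (b + y * l) `^ g) (M * l * (b + x * l) `^ (g - 1)).
Proof.
move=> bx.
have d1 : is_derive x 1 (fun y : R => b + y * l) l.
  have := is_deriveD (is_derive_cst b x 1) (is_deriveZ l (is_derive_id x 1)).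
  rewrite add0r [_ *: 1]mulr1; congr is_derive; apply/funext => y.
  by rewrite mulrC.
have d2 := @is_derive1_comp R (fun y : R => y `^ g) (fun y => b + y * l) x _ _ (is_derive1_powR g bx) d1.
have := is_deriveZ (M / g) d2; congr is_derive.
rewrite /GRing.scale /=.
have gn : g != 0 by rewrite gt_eqF.
by field.
Qed.

(** The bound [M y^(g - 1)] has primitive [M / g y^g], whose increments are at most [M / g l^g] by
    subadditivity, however close to the boundary the segment starts. Going down, the primitive
    changes sign. *)
Lemma chen_bound_vertical w (a b l b' : R) : 0 < b -> 0 < b' -> `|b' - b| <= l ->
  (forall i x, 0 <= x <= 1 ->
     cmod (h i (a +i* (b + x * (b' - b)))) <= M * (b + x * (b' - b)) `^ (g - 1)) ->
  cmod (G w (a +i* b') (a +i* b)) <= (M / g * l `^ g) ^+ size w.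
Proof.
move=> b0 b'0 bl hM.
have l0 : 0 <= l by rewrite (le_trans _ bl).
have segE x : seg_param (a +i* b) (a +i* b') x = a +i* (b + x * (b' - b)).
  by rewrite /seg_param; simpc; congr (_ +i* _); ring.
have pos x : 0 <= x <= 1 -> 0 < b + x * (b' - b).
  move=> x01.
  have := @seg_upper_half R (a +i* b) (a +i* b') x b0 b'0 x01.
  by rewrite segE.
have tsE : cmod ((a +i* b') - (a +i* b)) = `|b' - b|.
  by rewrite -cmod_imag; congr cmod; simpc; congr (_ +i* _); rewrite subrr.
have A0 : 0 <= M / g * l `^ g by rewrite mulr_ge0 ?powR_ge0// divr_ge0// ltW.
have [bb|bb] := leP b b'.
- apply: (@chen_bound_seg _ _ h holh (fun y => M / g * (b + y * (b' - b)) `^ g)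
    (fun y => M * (b' - b) * (b + y * (b' - b)) `^ (g - 1)) (M / g * l `^ g)
    (a +i* b) (a +i* b') b0 b'0 A0).
  + by move=> x x01; apply: powR_line_deriv; exact: pos.
  + move=> i x x01; rewrite segE tsE ger0_norm ?subr_ge0//.
    by rewrite mulrAC ler_wpM2r ?subr_ge0// hM.
  + move=> x x01; have [x0 x1] := andP x01.
    rewrite mul0r addr0 -mulrBr ler_wpM2l ?divr_ge0 ?(ltW g0)//.
    have xb : 0 <= x * (b' - b) by rewrite mulr_ge0// subr_ge0.
    rewrite lerBlDl (le_trans (powR_subadd g01 (ltW b0) xb))// lerD2l.
    rewrite ge0_ler_powR ?nnegrE ?(ltW g0)//.
    rewrite ger0_norm ?subr_ge0// in bl.
    by rewrite (le_trans _ bl)// ler_piMl// subr_ge0.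
- apply: (@chen_bound_seg _ _ h holh (fun y => - (M / g * (b + y * (b' - b)) `^ g))
    (fun y => - (M * (b' - b) * (b + y * (b' - b)) `^ (g - 1))) (M / g * l `^ g)
    (a +i* b) (a +i* b') b0 b'0 A0).
  + by move=> x x01; apply: is_deriveN; apply: powR_line_deriv; exact: pos.
  + move=> i x x01; rewrite segE tsE ltr0_norm ?subr_lt0//.
    rewrite -mulNr -mulrN mulrAC ler_wpM2r ?oppr_ge0 ?subr_le0 ?(ltW bb)//.
    by rewrite hM.
  + move=> x x01; have [x0 x1] := andP x01.
    rewrite mul0r addr0 opprK addrC -mulrBr ler_wpM2l ?divr_ge0 ?(ltW g0)//.
    have xb : 0 <= x * (b - b') by rewrite mulr_ge0// subr_ge0 ltW.
    have E : b = (b + x * (b' - b)) + x * (b - b') by ring.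
    rewrite lerBlDl {1}E (le_trans (powR_subadd g01 (ltW (pos _ x01)) xb))// lerD2l.
    rewrite ge0_ler_powR ?nnegrE ?(ltW g0)//.
    rewrite distrC ger0_norm ?subr_ge0 ?(ltW bb)// in bl.
    by rewrite (le_trans _ bl)// ler_piMl// subr_ge0 ltW.
Qed.

(** At height at least [l] the integrand is at most [M l^(g - 1)], on a length at most [l]. *)
Lemma chen_bound_horizontal w (a a' b l : R) : 0 < l -> l <= b -> `|a' - a| <= l ->
  (forall i x, 0 <= x <= 1 ->
     cmod (h i ((a + x * (a' - a)) +i* b)) <= M * b `^ (g - 1)) ->
  cmod (G w (a' +i* b) (a +i* b)) <= (M * l `^ g) ^+ size w.
Proof.
move=> l0 lb al hM; have b0 : 0 < b := lt_le_trans l0 lb.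
have segE x : seg_param (a +i* b) (a' +i* b) x = (a + x * (a' - a)) +i* b.
  by rewrite /seg_param; simpc; congr (_ +i* _); ring.
have tsE : cmod ((a' +i* b) - (a +i* b)) = `|a' - a|.
  by rewrite -cmod_real; congr cmod; simpc; congr (_ +i* _); rewrite subrr.
have A0 : 0 <= M * l `^ g by rewrite mulr_ge0 ?powR_ge0.
apply: (@chen_bound_seg _ _ h holh (fun y => M * l `^ g * y) (fun=> M * l `^ g) (M * l `^ g)
    (a +i* b) (a' +i* b) b0 b0 A0).
- move=> x _; have := is_deriveZ (M * l `^ g) (is_derive_id x 1).
  by rewrite [_ *: 1]mulr1.
- move=> i x x01; rewrite segE tsE (le_trans (ler_pM _ _ (hM i x x01) al)) ?cmod_ge0//.
  rewrite -mulrA ler_wpM2l// -(mulr_powRB1 (ltW l0) g0) mulrC ler_wpM2l ?(ltW l0)//.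
  rewrite -(opprB 1 g) !powRN lef_pV2 ?posrE ?powR_gt0//.
  by rewrite ge0_ler_powR ?nnegrE ?subr_ge0 ?(ltW l0) ?(ltW b0)//; case/andP: g01.
- by move=> x /andP[x0 x1]; rewrite mulr0 subr0 ler_piMr.
Qed.

(* The integral along [s, t] is computed along a path which first goes up by about
   [|t - s|], then across, then down: there the integrands are integrable. *)
Lemma chen_bound (rho : R) w s t : upper_half s -> upper_half t ->
  cmod s <= rho / 3 -> cmod t <= rho / 3 ->
  (forall i z, `|complex.Re z| <= rho -> 0 < complex.Im z <= rho ->
     cmod (h i z) <= M * complex.Im z `^ (g - 1)) ->
  cmod (G w t s) <= (6 * M / g * cmod (t - s) `^ g) ^+ size w.
Proof.
move=> sP' tP' sr tr hM; case: s t sP' tP' sr tr => [a b] [a' b'] sP' tP' sr tr.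
have b0 : 0 < b := sP'; have b'0 : 0 < b' := tP'.
have [ts|ts] := eqVneq (a' +i* b') (a +i* b).
  rewrite ts subrr cmod0; case: w => [|i w].
    by change (cmod (1 : R[i]) <= 1); rewrite cmod1.
  by rewrite chen_diag cmod0 exprn_ge0// mulr_ge0 ?powR_ge0// divr_ge0 ?mulr_ge0// ltW.
set dl := cmod (_ - _).
have dl0 : 0 < dl by rewrite cmod_gt0 subr_eq0.
have bs : `|b| <= rho / 3 by have := le_trans (cmod_Im (a +i* b)) sr.
have bt : `|b'| <= rho / 3 by have := le_trans (cmod_Im (a' +i* b')) tr.
have as' : `|a| <= rho / 3 by have := le_trans (cmod_Re (a +i* b)) sr.
have at' : `|a'| <= rho / 3 by have := le_trans (cmod_Re (a' +i* b')) tr.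
have daa : `|a' - a| <= dl by have := cmod_Re ((a' +i* b') - (a +i* b)); rewrite cReB.
have dbb : `|b' - b| <= dl by have := cmod_Im ((a' +i* b') - (a +i* b)); rewrite cImB.
have dlr : dl <= 2 * rho / 3.
  by rewrite (le_trans (cmodB _ _))//; move: sr tr; move: (cmod _) (cmod _) => ? ?; lra.
move: bs bt as' at' daa dbb; rewrite !ler_norml.
move=> /andP[bs1 bs2] /andP[bt1 bt2] /andP[as1 as2] /andP[at1 at2] /andP[da1 da2] /andP[db1 db2].
(* This height is at least [dl], is at most [2 dl] above either end point, and is at most [rho]
   because the end points are within [rho / 3] and [dl <= 2 rho / 3]. *)
pose top := Num.max b b' + dl.
have topb : b <= top - dl by rewrite addrK le_max lexx.
have topb' : b' <= top - dl by rewrite addrK le_max lexx orbT.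
have topM : top - dl <= b \/ top - dl <= b'.
  by rewrite addrK; case: (leP b b') => _; [right|left].
have top0 : 0 < top by lra.
have topr : top <= rho by case: topM; lra.
have rg (c y x z' : R) : 0 <= x <= 1 -> c <= rho -> - rho <= c -> 0 < y -> y <= rho -> 0 < z' -> z' <= rho ->
    `|complex.Re (c +i* (y + x * (z' - y)))| <= rho /\
    0 < complex.Im (c +i* (y + x * (z' - y))) <= rho.
  move=> /andP[x0 x1] c1 c2 y0 yr z0 zr /=; rewrite ler_norml c1 c2; split => //.
  have xz : 0 <= x * z' by rewrite mulr_ge0// ltW.
  have xz' : x * z' <= x * rho by rewrite ler_wpM2l.
  have xy : 0 <= (1 - x) * y by rewrite mulr_ge0 ?subr_ge0// ltW.
  have xy' : (1 - x) * y <= (1 - x) * rho by rewrite ler_wpM2l// subr_ge0.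
  have E : y + x * (z' - y) = (1 - x) * y + x * z' by ring.
  have [xx|xx] := eqVneq x 0; first by rewrite xx mul0r addr0 y0 yr.
  have xp : 0 < x by rewrite lt_neqAle eq_sym xx.
  have : 0 < x * z' by rewrite mulr_gt0.
  rewrite E => xz2; apply/andP; split; lra.
have A0 : 0 <= M / g * (2 * dl) `^ g.
  by rewrite mulr_ge0 ?powR_ge0// divr_ge0// ltW.
have up w' : cmod (G w' (a +i* top) (a +i* b)) <= (M / g * (2 * dl) `^ g) ^+ size w'.
  apply: chen_bound_vertical => //.
    by rewrite ger0_norm; case: topM; lra.
  move=> i x x01; have [||||||R1 R2] := rg a b x top x01; try lra.
  exact: hM.
have down w' : cmod (G w' (a' +i* b') (a' +i* top)) <= (M / g * (2 * dl) `^ g) ^+ size w'.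
  apply: chen_bound_vertical => //.
    by rewrite distrC ger0_norm; case: topM; lra.
  move=> i x x01; have [||||||R1 R2] := rg a' top x b' x01; try lra.
  exact: hM.
have across w' : cmod (G w' (a' +i* top) (a +i* top)) <= (M / g * (2 * dl) `^ g) ^+ size w'.
  apply: (le_trans (chen_bound_horizontal w' (l := dl) dl0 _ _ _)).
  - lra.
  - by rewrite ler_norml da1 da2.
  - move=> i x /andP[x0 x1]; apply: (hM i ((a + x * (a' - a)) +i* top)) => /=; last by rewrite top0.
    have xz : x * a' <= x * (rho / 3) by rewrite ler_wpM2l.
    have xz' : x * (- (rho / 3)) <= x * a' by rewrite ler_wpM2l.
    have xy : (1 - x) * a <= (1 - x) * (rho / 3) by rewrite ler_wpM2l// subr_ge0.
    have xy' : (1 - x) * (- (rho / 3)) <= (1 - x) * a by rewrite ler_wpM2l// subr_ge0.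
    have E : a + x * (a' - a) = (1 - x) * a + x * a' by ring.
    rewrite E ler_norml; apply/andP; split; lra.
  rewrite lerXn2r ?nnegrE ?mulr_ge0 ?powR_ge0 ?invr_ge0 ?(ltW g0)//.
  rewrite ler_pM ?powR_ge0//.
    by rewrite ler_peMr// invf_ge1//; case/andP: g01.
  rewrite ge0_ler_powR ?nnegrE ?(ltW g0) ?(ltW dl0) ?mulr_ge0 ?(ltW dl0)//; lra.
have tP : upper_half (a' +i* top) by [].
have sP : upper_half (a +i* top) by [].
have B1 := chen_bound_concat holh A0 A0 tP sP (b0 : upper_half (a +i* b)) across up.
have B2 := chen_bound_concat holh A0 (addr_ge0 A0 A0) (b'0 : upper_half (a' +i* b')) tP
  (b0 : upper_half (a +i* b)) down B1.
apply: (le_trans (B2 w)); rewrite lerXn2r ?nnegrE ?mulr_ge0 ?powR_ge0 ?invr_ge0 ?addr_ge0 ?mulr_ge0 ?powR_ge0 ?invr_ge0 ?(ltW g0)//.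
(* Three pieces, each with a factor [2] from the length [2 dl]: hence the constant [6]. *)
have p2 : (2 * dl) `^ g <= 2 * dl `^ g.
  rewrite powRM ?(ltW dl0)// ler_wpM2r ?powR_ge0// -[leRHS]powRr1//.
  by rewrite ler_powR ?ler1n//; case/andP: g01.
have : M / g * (2 * dl) `^ g <= M / g * (2 * dl `^ g).
  by rewrite ler_wpM2l// divr_ge0// ltW.
have -> : 6 * M / g * dl `^ g = 3 * (M / g * (2 * dl `^ g)) by ring.
move: (M / g * _) (M / g * _) => ? ?; lra.
Qed.

End PathBounds.

(** * Cauchy estimates on squares *)

Section CauchySquare.
Variable R : realType.
Implicit Types (f g F H : R[i] -> R[i]) (c z u p q : R[i]) (r : R).

Definition riemann_sum g p q N : R[i] :=
  \sum_(j < N.+1) (q - p) / N.+1%:R * g (seg_param p q (j%:R / N.+1%:R)).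

Lemma frac_unit N (j : 'I_N.+1) : 0 <= (j%:R / N.+1%:R : R) <= 1.
Proof.
rewrite divr_ge0//= ler_pdivrMr ?ltr0Sn// mul1r ler_nat; exact/ltnW/ltn_ord.
Qed.

(** The increment of the primitive [H] telescopes over the subdivision, and each piece is the term
    of the sum up to a uniformly small error. Cauchy's formula is kept in this discrete form, as
    finite sums of random variables are measurable. *)
Lemma ctends_riemann_sum g H p q : hol g -> upper_half p -> upper_half q ->
  (forall u, upper_half u -> cderiv H u (g u)) ->
  ctends (riemann_sum g p q) (H q - H p).
Proof.
move=> hg pP qP dH e e0.
have hH : hol H by apply: hol_intro dH _ => u uP; exact: hol_ccont.
have qp : 0 < 1 + cmod (q - p) by rewrite ltr_pwDl// cmod_ge0.
pose e1 := e / (1 + cmod (q - p)).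
have e10 : 0 < e1 by rewrite divr_gt0.
have [dl dl0 Hdl] := hol_taylor1_seg hH pP qP e10.
pose N0 := Num.truncn ((1 + cmod (q - p)) / dl).
have N0P : (1 + cmod (q - p)) / dl < N0.+1%:R by exact: truncnS_gt.
exists N0 => N NN0.
pose u (j : nat) := seg_param p q (j%:R / N.+1%:R).
have N1 : 0 < N.+1%:R :> R by rewrite ltr0Sn.
have NC : N.+1%:R = (N.+1%:R : R)%:C :> R[i] by rewrite rmorph_nat.
have NC0 : N.+1%:R != 0 :> R[i] by rewrite pnatr_eq0.
pose D := (q - p) / N.+1%:R.
have uS j : u j.+1 = u j + D.
  rewrite /u /seg_param /D -natr1 !rmorphM !rmorphD !fmorphV !rmorph_nat /=.
  by ring.
have Dd : cmod D = cmod (q - p) / N.+1%:R.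
  by rewrite /D cmodM cmodV NC cmod_real ger0_norm.
have Ddl : cmod D < dl.
  rewrite Dd ltr_pdivrMr// mulrC -ltr_pdivrMr//.
  apply: (@lt_le_trans _ _ N0.+1%:R); last by rewrite ler_nat.
  by apply: le_lt_trans N0P; rewrite ler_pM2r ?invr_gt0// lerDr.
have -> : H q - H p = \sum_(j < N.+1) (H (u j.+1) - H (u j)).
  rewrite -(big_mkord xpredT (fun j => H (u j.+1) - H (u j))) telescope_sumr//.
  congr (H _ - H _); rewrite /u /seg_param.
    by rewrite divff ?gt_eqF// rmorph1 mul1r addrC subrK.
  by rewrite mul0r rmorph0 mul0r addr0.
rewrite /riemann_sum -sumrB (le_trans (cmod_sum _ _ _))//.
apply: (@le_trans _ _ (\sum_(j < N.+1) e1 * cmod D)).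
  apply: ler_sum => j _; rewrite cmod_distC uS.
  have x01 := frac_unit j.
  have [+ _] := Hdl _ x01 _ Ddl.
  by rewrite (cderive_eq (dH _ (seg_upper_half pP qP x01))).
rewrite sumr_const card_ord -mulr_natr Dd.
have -> : e1 * (cmod (q - p) / N.+1%:R) * N.+1%:R = e1 * cmod (q - p).
  by field; rewrite gt_eqF.
rewrite /e1 mulrAC ler_pdivrMr// ler_wpM2l ?(ltW e0)// lerDr//.
Qed.

(** The corners of the square of side [2 r], counterclockwise from the lower left. The power of ['i]
    reduces each side to the bottom one by rotation. *)
Definition square_vertex c r (k : nat) : R[i] := c + r%:C * (-1 -i* 1) * 'i ^+ k.

Definition square_node c r N (k : nat) (j : nat) : R[i] :=
  seg_param (square_vertex c r k) (square_vertex c r k.+1) (j%:R / N.+1%:R).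

Lemma square_side c r k :
  square_vertex c r k.+1 - square_vertex c r k = (2 * r)%:C * 'i ^+ k.
Proof.
rewrite /square_vertex exprS opprD addrACA subrr add0r.
have -> : r%:C * (-1 -i* 1) * ('i * 'i ^+ k) - r%:C * (-1 -i* 1) * 'i ^+ k =
  r%:C * ((-1 -i* 1) * ('i - 1)) * 'i ^+ k by ring.
congr (_ * _); simpc; congr (_ +i* _); ring.
Qed.

Lemma iexp_cases k : ('i : R[i]) ^+ k \in [:: 1; 'i; -1; -'i].
Proof.
elim: k => [|k IH]; first by rewrite expr0 !inE eqxx.
rewrite exprS; move: IH; rewrite !inE => /or4P[] /eqP ->.
- by rewrite mulr1 eqxx ?orbT.
- by rewrite -expr2 sqr_i eqxx !orbT.
- by rewrite mulrN1 eqxx !orbT.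
- by rewrite mulrN -expr2 sqr_i opprK eqxx.
Qed.

Lemma iexp_cmod k : cmod (('i : R[i]) ^+ k) = 1.
Proof. by rewrite cmodX (_ : cmod 'i = 1) ?expr1n// cmod_imag normr1. Qed.

Lemma square_node_upper c r N k (j : 'I_N.+1) : 0 < r -> r < complex.Im c ->
  upper_half (square_node c r N k j).
Proof.
move=> r0 rc.
have vP n : upper_half (square_vertex c r n).
  rewrite /upper_half /= /square_vertex cImD.
  have : `|complex.Im (r%:C * (-1 -i* 1) * 'i ^+ n)| <= r; last first.
    by rewrite ler_norml => /andP[? _]; lra.
  have [-> | ->] : complex.Im (r%:C * (-1 -i* 1) * 'i ^+ n) = r \/
      complex.Im (r%:C * (-1 -i* 1) * 'i ^+ n) = - r.
    have := iexp_cases n; rewrite !inE => /or4P[] /eqP ->; rewrite !(cImM, cReM) /=;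
      by [right; ring|right; ring|left; ring|left; ring].
    by rewrite (ger0_norm (ltW r0)).
  by rewrite normrN (ger0_norm (ltW r0)).
exact: seg_upper_half (vP _) (vP _) (frac_unit j).
Qed.

(* The winding of the boundary of a square around a point well inside it. *)
Lemma square_kernel c r z N k (j : 'I_N.+1) : 0 < r ->
  `|complex.Re (z - c)| <= 2 * r / 3 -> `|complex.Im (z - c)| <= 2 * r / 3 ->
  [/\ square_node c r N k j - z != 0,
   cmod ((2 * r)%:C * 'i ^+ k / (square_node c r N k j - z)) <= 6 &
   1 / 10 <= complex.Im ((2 * r)%:C * 'i ^+ k / (square_node c r N k j - z))].
Proof.
move=> r0 zre zim; set x : R := j%:R / N.+1%:R.
have /andP[x0 x1] : 0 <= x <= 1 by exact: frac_unit.
have ik0 : ('i : R[i]) ^+ k != 0 by rewrite -cmod_gt0 iexp_cmod.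
(* Rotating by ['i ^- k] makes the side number [k] the bottom one; the square of half-size [2 r / 3]
   containing [z] is invariant. *)
have [zeta zetaE [zr zi]] : exists2 zeta : R[i], z - c = zeta * 'i ^+ k &
    `|complex.Re zeta| <= 2 * r / 3 /\ `|complex.Im zeta| <= 2 * r / 3.
  exists ((z - c) / 'i ^+ k); first by rewrite mulfVK.
  move: zre zim; move: (z - c) => [a b] /= zre zim.
  have := iexp_cases k; rewrite !inE => /or4P[] /eqP ->.
  - by rewrite invr1 mulr1.
  - have -> : ('i : R[i])^-1 = - 'i.
      by apply: (mulfI (_ : 'i != 0)); rewrite ?mulfV -?cmod_gt0 ?cmod_imag ?normr1// mulrN -expr2 sqr_i opprK.
    by simpc => /=; rewrite normrN.
  - by rewrite invrN invr1 mulrN1 /= !normrN.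
  - have -> : (- 'i : R[i])^-1 = 'i.
      by apply: (mulfI (_ : - 'i != 0)); rewrite ?mulfV -?cmod_gt0 ?cmodN ?cmod_imag ?normr1// mulNr -expr2 sqr_i opprK.
    by simpc => /=; rewrite normrN.
case: zeta zetaE zr zi => a b zetaE /= zr zi.
pose D : R[i] := (2 * r * x - r - a) -i* (r + b).
have DE : square_node c r N k j - z = D * 'i ^+ k.
  have -> : z = c + (a +i* b) * 'i ^+ k by rewrite -zetaE addrC subrK.
  rewrite /square_node /seg_param square_side -/x /square_vertex.
  have -> : c + r%:C * (-1 -i* 1) * 'i ^+ k + x%:C * ((2 * r)%:C * 'i ^+ k) -
    (c + (a +i* b) * 'i ^+ k) = (r%:C * (-1 -i* 1) + x%:C * (2 * r)%:C - (a +i* b)) * 'i ^+ k.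
    by ring.
  by congr (_ * _); rewrite /D; simpc; congr (_ +i* _); ring.
rewrite DE.
move: zr zi; rewrite !ler_norml => /andP[a1 a2] /andP[b1 b2].
have rx : 0 <= r * x by rewrite mulr_ge0// ltW.
have rx1 : r * x <= r by rewrite ler_piMr// ltW.
have D2 : 0 < (2 * r * x - r - a) ^+ 2 + (r + b) ^+ 2.
  by rewrite ltr_wpDl ?sqr_ge0// exprn_gt0//; lra.
have D0 : D != 0.
  apply/eqP => /eqP; rewrite /D eq_complex /= => /andP[_ /eqP]; lra.
have quo : (2 * r)%:C * 'i ^+ k / (D * 'i ^+ k) = (2 * r)%:C / D.
  by rewrite -mulf_div divff// mulr1.
split; first by rewrite mulf_neq0.
  rewrite quo cmodM cmodV cmod_real ger0_norm ?mulr_ge0 ?(ltW r0)//.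
  rewrite ler_pdivrMr ?cmod_gt0//.
  have := cmod_Im D; rewrite /= normrN ger0_norm; lra.
have -> : complex.Im ((2 * r)%:C * 'i ^+ k / (D * 'i ^+ k)) =
    2 * r * (r + b) / ((2 * r * x - r - a) ^+ 2 + (r + b) ^+ 2).
  by rewrite quo Im_real_mul /D /= sqrrN mulNr opprK mulrA.
rewrite ler_pdivlMr//.
(* The imaginary part is at least [(2 r^2 / 3) / (2 (5 r / 3)^2) = 3 / 25], which exceeds
   [1 / 10]. *)
have S1 : (2 * r * x - r - a) ^+ 2 <= (5 * r / 3) ^+ 2.
  rewrite -(real_normK (num_real (2 * r * x - r - a))) lerXn2r ?nnegrE//; first lra.
  by rewrite ler_norml; apply/andP; split; lra.
have S2 : (r + b) ^+ 2 <= (5 * r / 3) ^+ 2 by rewrite lerXn2r ?nnegrE//; lra.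
have S3 : 2 * r * (r / 3) <= 2 * r * (r + b) by rewrite ler_wpM2l//; lra.
have : 0 < r ^+ 2 by rewrite exprn_gt0.
move: S1 S2 S3; rewrite !expr2; nra.
Qed.

Definition square_mean (phi : R[i] -> R) c r N : R :=
  \sum_(k < 4) N.+1%:R^-1 * \sum_(j < N.+1) phi (square_node c r N k j).

(** The function [g] has a primitive, so its Riemann sums around the square tend to [0]. They are
    [A - B F(z)], with [A] a weighted mean of [F] and [B] a discrete winding number. As [|A|] is at
    most [6] times the mean and [|B| >= 4 / 10], the constant is [6 / (2 / 5) = 15]. *)
Lemma cauchy_square F g c r z : 0 < r -> r < complex.Im c ->
  `|complex.Re (z - c)| <= 2 * r / 3 -> `|complex.Im (z - c)| <= 2 * r / 3 ->
  hol g -> (forall u, F u - F z = g u * (u - z)) ->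
  forall e : R, 0 < e -> exists N0, forall N, (N0 <= N)%N ->
    cmod (F z) <= 15 * square_mean (fun u => cmod (F u)) c r N + e.
Proof.
move=> r0 rc zre zim hg Fg e e0.
have cP : upper_half c by rewrite /upper_half /=; lra.
pose H u := seg_int g c u.
have dH u : upper_half u -> cderiv H u (g u) by move=> uP; exact: cderiv_seg_int.
have vP k : upper_half (square_vertex c r k).
  have := @square_node_upper c r 0 k ord0 r0 rc.
  by rewrite /square_node /seg_param mul0r rmorph0 mul0r addr0.
have v4 : square_vertex c r 4 = square_vertex c r 0.
  by rewrite /square_vertex (exprM _ 2 2) sqr_i sqrrN expr1n expr0.
have E0 : \sum_(k < 4) (H (square_vertex c r k.+1) - H (square_vertex c r k)) = 0.
  rewrite -(big_mkord xpredT (fun k => H (square_vertex c r k.+1) - H (square_vertex c r k))).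
  by rewrite telescope_sumr// v4 subrr.
have lim0 : ctends (fun N => \sum_(k < 4) riemann_sum g (square_vertex c r k) (square_vertex c r k.+1) N)
    (\sum_(k < 4) (H (square_vertex c r k.+1) - H (square_vertex c r k))).
  by apply: ctends_sum => k; exact: ctends_riemann_sum.
rewrite E0 in lim0.
have e25 : 0 < 2 / 5 * e by rewrite mulr_gt0// divr_gt0.
have [N0 HN0] := lim0 _ e25; exists N0 => N /HN0; rewrite subr0 => {}HN0.
pose K (k : 'I_4) (j : 'I_N.+1) := (2 * r)%:C * 'i ^+ k / (square_node c r N k j - z).
pose A := \sum_(k < 4) N.+1%:R^-1 * \sum_(j < N.+1) K k j * F (square_node c r N k j).
pose B := \sum_(k < 4) N.+1%:R^-1 * \sum_(j < N.+1) K k j.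
have E : \sum_(k < 4) riemann_sum g (square_vertex c r k) (square_vertex c r k.+1) N = A - B * F z.
  rewrite /A /B mulr_suml -sumrB; apply: eq_bigr => k _.
  rewrite -mulrA -mulrBr mulr_suml -sumrB mulr_sumr; apply: eq_bigr => j _.
  rewrite square_side -/(square_node c r N k j) -mulrBr Fg.
  have [n0 _ _] := square_kernel k j r0 zre zim.
  by rewrite /K; move: (N.+1%:R^-1) => a; field.
rewrite E in HN0.
have N1 : 0 < N.+1%:R :> R by rewrite ltr0Sn.
have NC : (N.+1%:R^-1 : R[i]) = (N.+1%:R^-1 : R)%:C by rewrite fmorphV rmorph_nat.
have AB : cmod A <= 6 * square_mean (fun u => cmod (F u)) c r N.
  rewrite /A (le_trans (cmod_sum _ _ _))// /square_mean mulr_sumr ler_sum// => k _.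
  rewrite cmodM NC cmod_real ger0_norm ?invr_ge0// mulrCA ler_wpM2l ?invr_ge0//.
  rewrite (le_trans (cmod_sum _ _ _))// mulr_sumr ler_sum// => j _.
  rewrite cmodM ler_wpM2r ?cmod_ge0//.
  by have [_ + _] := square_kernel k j r0 zre zim.
have BB : 2 / 5 <= cmod B.
  apply: le_trans (le_trans (ler_norm _) (cmod_Im B)).
  rewrite /B cIm_sum.
  apply: (@le_trans _ _ (\sum_(k < 4) 1 / 10)).
    rewrite sumr_const card_ord -mulr_natr; lra.
  rewrite ler_sum// => k _; rewrite NC Im_real_mul cIm_sum.
  rewrite ler_pdivlMl//.
  apply: (@le_trans _ _ (\sum_(j < N.+1) 1 / 10)).
    by rewrite sumr_const card_ord mulr_natl.
  rewrite ler_sum// => j _.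
  by have [_ _] := square_kernel k j r0 zre zim.
have : cmod B * cmod (F z) <= 6 * square_mean (fun u => cmod (F u)) c r N + 2 / 5 * e.
  rewrite -cmodM; have -> : B * F z = A - (A - B * F z) by ring.
  by rewrite (le_trans (cmodB _ _))// lerD.
have : 2 / 5 * cmod (F z) <= cmod B * cmod (F z) by rewrite ler_wpM2r ?cmod_ge0.
move: (cmod (F z)) (square_mean _ _ _ _) (cmod B * _) => a b c'; lra.
Qed.

(** Cauchy's formula for [f ^+ n] bounds [|f|^n] by its own means, a form in which expectations can
    be taken. The quotient for [f ^+ n] is that of [f] times a polynomial in [f]. *)
Lemma cauchy_square_power f n c r z : analytic_on (upper_half (R := R)) f ->
  0 < r -> r < complex.Im c ->
  `|complex.Re (z - c)| <= 2 * r / 3 -> `|complex.Im (z - c)| <= 2 * r / 3 ->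
  forall e : R, 0 < e -> exists N0, forall N, (N0 <= N)%N ->
    cmod (f z) ^+ n <= 15 * square_mean (fun u => cmod (f u) ^+ n) c r N + e.
Proof.
move=> af r0 rc zre zim e e0; have hf := analytic_hol af.
have zP : upper_half z.
  move: zim; rewrite cImB ler_norml /upper_half /= => /andP[? _]; lra.
pose g u := dquot f z u * \sum_(i < n) f u ^+ (n.-1 - i) * f z ^+ i.
have hg : hol g.
  apply: holM (hol_dquot af zP) _.
  elim: (index_enum _) => [|i s IH].
    have := hol_cst (0 : R[i]); congr hol; apply/funext => u; by rewrite big_nil.
  have := holD (holM (holX (n.-1 - i) hf) (hol_cst (f z ^+ i))) IH.
  by congr hol; apply/funext => u; rewrite big_cons.
have Fg u : f u ^+ n - f z ^+ n = g u * (u - z).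
  rewrite subrXX /g /dquot mulrAC; congr (_ * _).
  have [->|uz] := eqVneq u z; first by rewrite !subrr mulr0.
  by rewrite mulfVK// subr_eq0.
have [N0 H] := cauchy_square r0 rc zre zim hg Fg e0.
exists N0 => N /H; rewrite cmodX; congr (_ <= 15 * _ + _).
by rewrite /square_mean; apply: eq_bigr => k _; congr (_ * _); apply: eq_bigr => j _; rewrite cmodX.
Qed.

End CauchySquare.

(** * Moments of the derivative process *)

Section GaussianMoments.
Variable R : realType.
Local Open Scope ereal_scope.
Import HBNNSimple.

(** A simple function below [f] is summed over its level sets, which are disjoint. Applied to normal
    laws, this compares a moment with the total mass of a wider law by comparing densities on each
    set. *)
Lemma integral_le_measure d (T : measurableType d) (nu nu' : {measure set T -> \bar R})
    (c : R) (f : T -> \bar R) : (0 <= c)%R -> (forall x, 0 <= f x) ->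
  (forall (r : R) A, (0 <= r)%R -> measurable A -> (forall x, A x -> r%:E <= f x) ->
     r%:E * nu A <= c%:E * nu' A) ->
  \int[nu]_x f x <= c%:E * nu' setT.
Proof.
move=> c0 f0 H; rewrite ge0_integralTE//; apply: ub_ereal_sup => _ /= [h hf <-].
rewrite sintegralE.
apply: (@le_trans _ _ (\sum_(r \in range h) c%:E * nu' (h @^-1` [set r]))).
  apply: lee_fsum => // _ [x _ <-].
  apply: H; [exact: fun_ge0| exact: measurable_sfunP |].
  by move=> y /= <-; exact: hf.
rewrite -ge0_mule_fsumr// -measure_fin_bigcup//.
  apply: lee_wpmul2l; first by rewrite lee_fin.
  apply: le_measure; rewrite ?inE//; apply: fin_bigcup_measurable => // r _.
exact: trivIset_preimage1.
Qed.

Lemma measurable_normal_pdfE (s : R) (A : set (measurableTypeR R)) :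
  measurable_fun A (fun x : measurableTypeR R => (normal_pdf 0 s x)%:E : \bar R).
Proof. by apply/measurable_EFinP; exact: measurable_funTS (measurable_normal_pdf _ _). Qed.

(** Half of the exponent [x^2 / (2 s^2)] makes the density of variance [2 s^2]; the other half
    absorbs the power of [x], by [t^m / m! <= exp t] at [t = x^2 / (4 s^2)]. *)
Lemma normal_pdf_widen (s x : R) (m : nat) : (0 < s)%R -> (0 < m)%N ->
  (x ^+ (2 * m) * normal_pdf 0 s x <=
   Num.sqrt 2 * m`!%:R * (4 * s ^+ 2) ^+ m * normal_pdf 0 (Num.sqrt 2 * s) x)%R.
Proof.
move=> s0 m0.
have s2 : (0 < Num.sqrt 2 :> R)%R by rewrite sqrtr_gt0.
have sn : s != 0%R by rewrite gt_eqF.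
have s2n : (Num.sqrt 2 * s != 0)%R by rewrite mulf_neq0// gt_eqF.
rewrite !normal_pdfE// /normal_peak /normal_fun subr0.
have -> : ((Num.sqrt 2 * s) ^+ 2 = 2 * s ^+ 2 :> R)%R by rewrite exprMn sqr_sqrtr.
have -> : (2 * s ^+ 2 * pi *+ 2 = 2 * (s ^+ 2 * pi *+ 2) :> R)%R by rewrite -mulrA mulrnAr.
rewrite sqrtrM// invfM.
set p := (Num.sqrt (s ^+ 2 * pi *+ 2))^-1%R.
have p0 : (0 <= p)%R by rewrite invr_ge0 sqrtr_ge0.
have -> : (Num.sqrt 2 * m`!%:R * (4 * s ^+ 2) ^+ m * ((Num.sqrt 2)^-1 * p * expR (- x ^+ 2 / (2 * s ^+ 2 *+ 2))) =
  p * (m`!%:R * (4 * s ^+ 2) ^+ m * expR (- x ^+ 2 / (2 * s ^+ 2 *+ 2))))%R.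
  by field; rewrite gt_eqF.
rewrite mulrCA ler_wpM2l//.
have -> : (- x ^+ 2 / (s ^+ 2 *+ 2) = - x ^+ 2 / (2 * s ^+ 2 *+ 2) + - (x ^+ 2 / (4 * s ^+ 2)))%R.
  by field.
rewrite expRD expRN mulrCA [X in (_ <= X)%R]mulrC ler_wpM2l ?expR_ge0//.
rewrite ler_pdivrMr ?expR_gt0//.
have t0 : (0 <= x ^+ 2 / (4 * s ^+ 2))%R by rewrite divr_ge0 ?sqr_ge0// mulr_ge0// sqr_ge0.
have := expR_ge1Dxn m.-1 t0; rewrite prednK// => /(le_trans (ltW _)) H.
have {}H : ((x ^+ 2 / (4 * s ^+ 2)) ^+ m / m`!%:R <= expR (x ^+ 2 / (4 * s ^+ 2)))%R.
  by apply: H; rewrite ltrDr.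
have f0 : (0 < m`!%:R :> R)%R by rewrite ltr0n fact_gt0.
have q0 : (0 < (4 * s ^+ 2) ^+ m)%R by rewrite exprn_gt0// mulr_gt0// exprn_gt0.
rewrite ler_pdivrMr// expr_div_n ler_pdivrMr// in H.
by rewrite exprM (le_trans H)// [X in (X * _ <= _)%R]mulrC mulrAC.
Qed.

Definition normal_moment_cst (m : nat) : R := (Num.sqrt 2 * m`!%:R * 4 ^+ m)%R.

Lemma normal_moment (s : R) (m : nat) : (0 < s)%R -> (0 < m)%N ->
  \int[normal_prob 0 s]_x (x ^+ (2 * m))%:E <= (normal_moment_cst m * s ^+ (2 * m))%:E.
Proof.
move=> s0 m0; have s2 : (0 < Num.sqrt 2 :> R)%R by rewrite sqrtr_gt0.
pose nu' : probability (measurableTypeR R) R := normal_prob 0 (Num.sqrt 2 * s).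
have c0 : (0 <= normal_moment_cst m * s ^+ (2 * m))%R.
  by rewrite !mulr_ge0 ?sqrtr_ge0 ?exprn_ge0// ltW.
apply: (le_trans (integral_le_measure (nu' := nu') c0 _ _)).
- by move=> x; rewrite lee_fin exprM exprn_ge0// sqr_ge0.
- move=> r A r0 mA Ar; rewrite /normal_prob -ge0_integralZl_EFin//; last 2 first.
  + by move=> x _; rewrite lee_fin normal_pdf_ge0.
  + exact: measurable_normal_pdfE.
  rewrite -ge0_integralZl_EFin//; last 2 first.
  + by move=> x _; rewrite lee_fin normal_pdf_ge0.
  + exact: measurable_normal_pdfE.
  apply: ge0_le_integral => //.
  + by move=> x _; rewrite -EFinM lee_fin mulr_ge0// normal_pdf_ge0.
  + by apply: measurable_funeM; exact: measurable_normal_pdfE.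
  + by apply: measurable_funeM; exact: measurable_normal_pdfE.
  + move=> x Ax; rewrite -!EFinM lee_fin.
    have := Ar _ Ax; rewrite lee_fin => rx.
    apply: (le_trans (ler_wpM2r (normal_pdf_ge0 _ _ _) rx)).
    apply: (le_trans (normal_pdf_widen x s0 m0)).
    by rewrite /normal_moment_cst exprMn -exprM mulrA.
by rewrite [X in _ * X](probability_setT nu') mule1.
Qed.

(** The interval has length [s] and the density is at most [1 / (s sqrt (2 pi))], with
    [2 pi >= 4]. *)
Lemma normal_central_interval (s : R) : (0 < s)%R ->
  normal_prob 0 s `](- (s / 2))%R, (s / 2)%R[ <= (2^-1)%:E.
Proof.
move=> s0; have sn : s != 0%R by rewrite gt_eqF.
rewrite /normal_prob.
apply: (@le_trans _ _ (\int[lebesgue_measure]_(x in `](- (s / 2))%R, (s / 2)%R[) (normal_peak s)%:E)).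
  apply: ge0_le_integral => //.
  + by move=> x _; rewrite lee_fin normal_pdf_ge0.
  + exact: measurable_normal_pdfE.
  + by move=> x _; rewrite lee_fin normal_pdf_ub.
rewrite integral_cst//= lebesgue_measure_itv /= lte_fin ifT; last by lra.
rewrite -EFinD -EFinM lee_fin opprK -splitr /normal_peak.
have q0 : (0 < Num.sqrt (s ^+ 2 * pi *+ 2))%R.
  by rewrite sqrtr_gt0 mulrn_wgt0// mulr_gt0 ?pi_gt0// exprn_gt0.
rewrite mulrC ler_pdivrMr// ler_pdivlMl//.
rewrite -[X in (X <= _)%R]ger0_norm ?mulr_ge0 ?(ltW s0)// -sqrtr_sqr ler_wsqrtr//.
rewrite exprMn -mulrnAr [X in (X <= _)%R]mulrC ler_wpM2l ?sqr_ge0//.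
by have := @pi_ge2 R; rewrite mulr2n expr2; lra.
Qed.

End GaussianMoments.

Section GaussianVariables.
Context {R : realType} {disp : measure_display} {T : measurableType disp}.
Variable P : probability T R.
Local Open Scope ereal_scope.

Definition gaussian_cst (m : nat) : R := (normal_moment_cst R m * 8 ^+ m)%R.

Lemma gaussian_transfer (X : T -> R) (s : R) n : measurable_fun setT X ->
  (forall B, measurable B -> P (X @^-1` B) = normal_prob 0 s B) ->
  \int[P]_w (X w ^+ (2 * n))%:E = \int[normal_prob 0 s]_x (x ^+ (2 * n))%:E.
Proof.
move=> mX lawX.
have mX' : measurable_fun setT (X : T -> measurableTypeR R) := mX.
pose X' : {mfun T >-> measurableTypeR R} :=
  @mfun_Sub _ _ T (measurableTypeR R) X (mem_set mX').
have E : forall A, measurable A -> A `<=` setT -> distribution P X' A = normal_prob 0 s A.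
  by move=> A mA _; exact: lawX.
transitivity (\int[distribution P X']_x (x ^+ (2 * n))%:E); last first.
  have := @eq_measure_integral _ (measurableTypeR R) R setT (normal_prob 0 s) (distribution P X').
  by move=> H; apply: H.
rewrite ge0_integral_distribution//.
  by apply/measurable_EFinP; exact: measurable_funX.
by move=> x; rewrite lee_fin exprM exprn_ge0// sqr_ge0.
Qed.

Lemma gaussian_sqr_finite (X : T -> R) : centered_gaussian P X ->
  \int[P]_w (X w ^+ 2)%:E < +oo.
Proof.
move=> [mX [X0|[s s0 lawX]]].
  have -> : \int[P]_w (X w ^+ 2)%:E = \int[P]_w (cst 0) w.
    apply: ae_eq_integral => //.
      by apply/measurable_EFinP; exact: measurable_funX.
    by apply: filterS X0 => w Xw _; rewrite Xw expr0n.
  by rewrite integral0 ltry.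
have := gaussian_transfer 1 mX lawX; rewrite muln1 => ->.
by rewrite (le_lt_trans (normal_moment (m := 1) s0 _))// ltry.
Qed.

(** The deviation [s] of the law is controlled by the second moment through Chebyshev's inequality:
    [|X| >= s / 2] has probability at least [1 / 2], so [s^2 / 8 <= v]. This is the origin of
    [8 ^+ m] in [gaussian_cst]. *)
Lemma gaussian_moment (X : T -> R) (m : nat) (v : R) : centered_gaussian P X -> (0 < m)%N ->
  \int[P]_w (X w ^+ 2)%:E <= v%:E ->
  \int[P]_w (X w ^+ (2 * m))%:E <= (gaussian_cst m * v ^+ m)%:E.
Proof.
move=> [mX X0] m0 Xv.
have v0 : (0 <= v)%R.
  by rewrite -lee_fin (le_trans _ Xv)// integral_ge0// => w _; rewrite lee_fin sqr_ge0.
have mXn n : measurable_fun setT (fun w => (X w ^+ n)%:E : \bar R).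
  by apply/measurable_EFinP; exact: measurable_funX.
have gc0 : (0 <= gaussian_cst m)%R by rewrite !mulr_ge0 ?sqrtr_ge0 ?exprn_ge0.
case: X0 => [X0|[s s0 lawX]].
  have -> : \int[P]_w (X w ^+ (2 * m))%:E = \int[P]_w (cst 0) w.
    apply: ae_eq_integral => //.
    apply: filterS X0 => w Xw _; rewrite Xw expr0n muln_eq0 /=.
    by rewrite eqn0Ngt m0.
  by rewrite integral0 lee_fin mulr_ge0 ?exprn_ge0.
have s8 : (s ^+ 2 <= 8 * v)%R.
  have mB : measurable (X @^-1` `](- (s / 2))%R, (s / 2)%R[).
    by rewrite -[X in measurable X]setTI; exact: mX.
  have PB : P (X @^-1` `](- (s / 2))%R, (s / 2)%R[) <= (2^-1)%:E.
    by rewrite lawX//; exact: normal_central_interval.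
  have PC : (2^-1)%:E <= P (~` (X @^-1` `](- (s / 2))%R, (s / 2)%R[)).
    rewrite probability_setC//.
    have -> : (2^-1)%:E = 1 - (2^-1)%:E :> \bar R by rewrite -EFinB; congr EFin; lra.
    exact: leeB.
  have : ((s / 2) ^+ 2)%:E * P (~` (X @^-1` `](- (s / 2))%R, (s / 2)%R[)) <= v%:E.
    apply: le_trans Xv.
    rewrite -integral_cst//=; last exact: measurableC.
    apply: (@le_trans _ _ (\int[P]_(w in ~` (X @^-1` `](- (s / 2))%R, (s / 2)%R[)) (X w ^+ 2)%:E)).
      apply: ge0_le_integral => //.
      - exact: measurableC.
      - by move=> w _; rewrite lee_fin sqr_ge0.
      - exact: measurable_funTS.
      - move=> w /=; rewrite in_itv /= => /negP; rewrite -ltr_norml -leNgt lee_fin => sX.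
        rewrite -[(X w ^+ 2)%R]real_normK ?num_real// lerXn2r ?nnegrE ?divr_ge0 ?(ltW s0)//.
    apply: ge0_subset_integral => //; first exact: measurableC.
    by move=> w _; rewrite lee_fin sqr_ge0.
  move=> /(le_trans (lee_wpmul2l _ PC)).
  rewrite lee_fin sqr_ge0 => /(_ isT).
  rewrite -EFinM lee_fin expr_div_n; lra.
rewrite (gaussian_transfer m mX lawX); apply: (le_trans (normal_moment s0 m0)).
rewrite lee_fin /gaussian_cst -mulrA ler_wpM2l ?mulr_ge0 ?sqrtr_ge0 ?exprn_ge0//.
by rewrite exprM -exprMn lerXn2r ?nnegrE ?sqr_ge0// mulr_ge0.
Qed.

End GaussianVariables.

(** * Supremum of the derivative process over Whitney squares *)

Section AfbmSupremum.
Context {R : realType} {disp : measure_display} {T : measurableType disp}.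
Variables (P : probability T R) (alpha : R) (X' : T -> R[i] -> R[i]).
Hypothesis afX : afBm_derivative P alpha X'.
Implicit Types (z u c : R[i]) (m j : nat).

Lemma afBm_cmeasurable z : upper_half z -> cmeasurable (X' ^~ z).
Proof. by case: afX => -[+ _] _ _ _; apply. Qed.

Lemma afBm_gaussian z (c : R[i]) : upper_half z ->
  centered_gaussian P (fun w => complex.Re (c * X' w z)).
Proof.
case: afX => -[_ +] _ _ _ zP.
move=> /(_ 1%N (fun=> z) (fun=> c) (fun=> zP)).
congr centered_gaussian; apply/funext => w; by rewrite big_ord1.
Qed.

Lemma afBm_gaussian_Re z : upper_half z -> centered_gaussian P (fun w => complex.Re (X' w z)).
Proof.
move=> zP; have := afBm_gaussian 1 zP.
congr centered_gaussian; apply/funext => w; by rewrite mul1r.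
Qed.

Lemma afBm_gaussian_Im z : upper_half z -> centered_gaussian P (fun w => complex.Im (X' w z)).
Proof.
move=> zP; have := afBm_gaussian (0 +i* -1) zP.
congr centered_gaussian; apply/funext => w.
by rewrite cReM /= mul0r sub0r mulN1r opprK.
Qed.

Let K : R := alpha * (1 - 2 * alpha) / (2 * cos (pi * alpha)).

Lemma Cpow_real (x a : R) : 0 < x -> complex.Re (Cpow x%:C a) = x `^ a.
Proof.
move=> x0; rewrite /Cpow Re_real_mul cmod_real gtr0_norm//=.
have -> : Carg x%:C = 0.
  rewrite /Carg cmod_real gtr0_norm//= lexx divff ?gt_eqF//.
  exact: acos1.
by rewrite mulr0 cos0 mulr1.
Qed.

(** On the diagonal the base of the power is [- i (z - conj z) = 2 Im z], a positive real.
    Gaussianity gives finiteness, without which the real-valued expectation would not determine the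
    extended integrals. *)
Lemma afBm_second_moment z : upper_half z ->
  (\int[P]_w (complex.Re (X' w z) ^+ 2)%:E + \int[P]_w (complex.Im (X' w z) ^+ 2)%:E
   = (K * (2 * complex.Im z) `^ (2 * alpha - 2))%:E)%E.
Proof.
move=> zP; have [mre mim] := afBm_cmeasurable zP.
have fre := gaussian_sqr_finite (afBm_gaussian_Re zP).
have fim := gaussian_sqr_finite (afBm_gaussian_Im zP).
have msq (f : T -> R) : measurable_fun setT f -> measurable_fun setT (fun w => (f w ^+ 2)%:E : \bar R).
  by move=> mf; apply/measurable_EFinP; exact: measurable_funX.
have E w : complex.Re (X' w z * conjc (X' w z)) = complex.Re (X' w z) ^+ 2 + complex.Im (X' w z) ^+ 2.
  by case: (X' w z) => a b /=; rewrite mulrN opprK -!expr2.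
have S : (\int[P]_w (complex.Re (X' w z) ^+ 2)%:E + \int[P]_w (complex.Im (X' w z) ^+ 2)%:E
    = \int[P]_w (complex.Re (X' w z * conjc (X' w z)))%:E)%E.
  rewrite -ge0_integralD//; last 4 first.
  - by move=> w _; rewrite lee_fin sqr_ge0.
  - exact: msq.
  - by move=> w _; rewrite lee_fin sqr_ge0.
  - exact: msq.
  by apply: eq_integral => w _; rewrite E EFinD.
have [_ _ _ /(_ z z zP zP)] := afX.
move=> /(congr1 (@complex.Re R)).
rewrite Re_real_mul -/K.
have -> : - (0 +i* 1) * (z - conjc z) = (2 * complex.Im z)%:C.
  by case: (z) => a b /=; simpc; congr (_ +i* _); ring.
rewrite Cpow_real ?mulr_gt0// => <-.
rewrite /= /Rintegral -S fineK// ge0_fin_numE; first exact: lte_add_pinfty.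
by rewrite adde_ge0// integral_ge0// => w _; rewrite lee_fin sqr_ge0.
Qed.

Lemma cmod_expr_even z m : cmod z ^+ (2 * m) = (complex.Re z ^+ 2 + complex.Im z ^+ 2) ^+ m.
Proof. by rewrite exprM cmod_sqr. Qed.

Lemma measurable_cmod_even z m : upper_half z ->
  measurable_fun setT (fun w => cmod (X' w z) ^+ (2 * m)).
Proof.
move=> zP; have [mre mim] := afBm_cmeasurable zP.
under eq_fun do rewrite cmod_expr_even.
by apply: measurable_funX; apply: measurable_funD; exact: measurable_funX.
Qed.

Lemma exprD_le (a b : R) m : 0 <= a -> 0 <= b -> (a + b) ^+ m <= 2 ^+ m * (a ^+ m + b ^+ m).
Proof.
move=> a0 b0; have [ab|/ltW ba] := leP a b.
  apply: (@le_trans _ _ ((2 * b) ^+ m)).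
    by rewrite lerXn2r ?nnegrE ?addr_ge0 ?mulr_ge0//; lra.
  by rewrite exprMn ler_wpM2l ?exprn_ge0// lerDr exprn_ge0.
apply: (@le_trans _ _ ((2 * a) ^+ m)).
  by rewrite lerXn2r ?nnegrE ?addr_ge0 ?mulr_ge0//; lra.
by rewrite exprMn ler_wpM2l ?exprn_ge0// lerDl exprn_ge0.
Qed.

Lemma afBm_moment m : (0 < m)%N -> exists2 C : R, 0 <= C & forall z, upper_half z ->
  (\int[P]_w (cmod (X' w z) ^+ (2 * m))%:E <=
   (C * complex.Im z `^ ((alpha - 1) * (2 * m)%:R))%:E)%E.
Proof.
move=> m0; pose a := (2 : R) `^ (2 * alpha - 2).
have gc0 : 0 <= (gaussian_cst m : R).
  by rewrite !mulr_ge0 ?sqrtr_ge0 ?exprn_ge0.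
(* The sign is read off the second moment at the point ['i]. *)
have KK : 0 <= K * a.
  have iP : upper_half ('i : R[i]) by rewrite /upper_half /= ltr01.
  have := afBm_second_moment iP; rewrite /= mulr1 => /(congr1 (fun x => (0 <= x)%E)).
  rewrite lee_fin => <-; rewrite adde_ge0// integral_ge0// => w _; rewrite lee_fin sqr_ge0//.
exists (2 ^+ m * ((gaussian_cst m : R) * (K * a) ^+ m * 2)).
  by rewrite !mulr_ge0 ?exprn_ge0.
move=> z zP; have [mre mim] := afBm_cmeasurable zP.
pose v := K * (2 * complex.Im z) `^ (2 * alpha - 2).
have vm : v ^+ m = (K * a) ^+ m * complex.Im z `^ ((alpha - 1) * (2 * m)%:R).
  rewrite /v powRM ?(ltW zP)// mulrA exprMn; congr (_ * _).
  rewrite -powR_mulrn ?powR_ge0// -powRrM natrM; congr (_ `^ _); ring.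
have sm := afBm_second_moment zP.
have Hre : (\int[P]_w (complex.Re (X' w z) ^+ 2)%:E <= v%:E)%E.
  by rewrite -sm leeDl// integral_ge0// => w _; rewrite lee_fin sqr_ge0.
have Him : (\int[P]_w (complex.Im (X' w z) ^+ 2)%:E <= v%:E)%E.
  by rewrite -sm leeDr// integral_ge0// => w _; rewrite lee_fin sqr_ge0.
have Mre := gaussian_moment (afBm_gaussian_Re zP) m0 Hre.
have Mim := gaussian_moment (afBm_gaussian_Im zP) m0 Him.
have msq (f : T -> R) k : measurable_fun setT f -> measurable_fun setT (fun w => (f w ^+ k)%:E : \bar R).
  by move=> mf; apply/measurable_EFinP; exact: measurable_funX.
have ev (x : R) : 0 <= x ^+ (2 * m) by rewrite exprM exprn_ge0// sqr_ge0.
apply: (@le_trans _ _ (\int[P]_w ((2 ^+ m)%:E * ((complex.Re (X' w z) ^+ (2 * m))%:E + (complex.Im (X' w z) ^+ (2 * m))%:E)))%E).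
  apply: ge0_le_integral => //.
  - by move=> w _; rewrite lee_fin exprn_ge0// cmod_ge0.
  - by apply/measurable_EFinP; exact: measurable_cmod_even.
  - by apply: measurable_funeM; apply: emeasurable_funD; exact: msq.
  - move=> w _; rewrite -EFinD -EFinM lee_fin cmod_expr_even.
    by rewrite (le_trans (exprD_le _ (sqr_ge0 _) (sqr_ge0 _)))// -!exprM.
rewrite ge0_integralZl_EFin//; last 2 first.
- by move=> w _; rewrite -EFinD lee_fin addr_ge0.
- by apply: emeasurable_funD; exact: msq.
rewrite ge0_integralD//; last 4 first.
- by move=> w _; rewrite lee_fin.
- exact: msq.
- by move=> w _; rewrite lee_fin.
- exact: msq.
rewrite -mulrA EFinM lee_wpmul2l ?lee_fin ?exprn_ge0//.
apply: (le_trans (leeD Mre Mim)); rewrite -EFinD lee_fin vm.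
by rewrite -mulr2n -mulr_natr; rewrite le_eqVlt; apply/orP; left; apply/eqP; ring.
Qed.

Variables (g rho : R) (m : nat).
Hypotheses (rho0 : 0 < rho) (m0 : (0 < m)%N) (g1 : g <= 1) (alpha1 : alpha <= 1)
  (gm : 2 <= (alpha - g) * (2 * m)%:R).

(** Scale [j] covers the heights between [ell j / 2] and [ell j]. Around a centre at height
    [3 ell j / 4], the square of half-size [3 ell j / 8] stays at heights at least [3 ell j / 8],
    and its [2 / 3] part, of half-size [ell j / 4], fills the strip. Steps of [ell j / 4] from
    [- rho] to [rho] make [8 * 2 ^ j + 1] centres. *)
Let ell (j : nat) : R := rho / 2 ^+ j.
Let centre (j a : nat) : R[i] := (- rho + a%:R * (ell j / 4)) +i* (3 * ell j / 4).
Let mean (j a N : nat) (w : T) : R :=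
  square_mean (fun u => cmod (X' w u) ^+ (2 * m)) (centre j a) (3 * ell j / 8) N.
Let weight (j : nat) : R := 15 * ell j `^ ((1 - g) * (2 * m)%:R).

(* The supremum over a Whitney square is controlled by the mean over the boundary of a
   larger square; these are summed over all squares. *)
Definition whitney_sum (w : T) : \bar R :=
  (\sum_(0 <= j <oo) \sum_(0 <= a < (8 * 2 ^ j).+1)
    (weight j)%:E * limn_einf (fun N => (mean j a N w)%:E))%E.

Let ell0 j : 0 < ell j. Proof. by rewrite divr_gt0// exprn_gt0. Qed.

Let node_upper j a N k (i : 'I_N.+1) :
  upper_half (square_node (centre j a) (3 * ell j / 8) N k i) /\
  3 * ell j / 8 <= complex.Im (square_node (centre j a) (3 * ell j / 8) N k i).
Proof.
have l0 := ell0 j.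
split; first by apply: square_node_upper => /=; lra.
suff H n : 3 * ell j / 8 <= complex.Im (square_vertex (centre j a) (3 * ell j / 8) n).
  have /andP[x0 x1] := frac_unit R i.
  rewrite /square_node /seg_param cImD Im_real_mul cImB.
  set p := complex.Im _; set q := complex.Im _.
  have Hp : 3 * ell j / 8 <= p by exact: H.
  have Hq : 3 * ell j / 8 <= q by exact: H.
  move: x0 x1; set x := (_ / _) => x0 x1.
  have E1 : (1 - x) * (3 * ell j / 8) <= (1 - x) * p by rewrite ler_wpM2l// subr_ge0.
  have E2 : x * (3 * ell j / 8) <= x * q by rewrite ler_wpM2l.
  have -> : p + x * (q - p) = (1 - x) * p + x * q by ring.
  by move: E1 E2; rewrite mulrBl mul1r; move: (x * _) (x * _) (_ * p) => ? ? ?; lra.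
rewrite /square_vertex cImD.
have [-> | ->] : complex.Im ((3 * ell j / 8)%:C * (-1 -i* 1) * 'i ^+ n) = 3 * ell j / 8 \/
    complex.Im ((3 * ell j / 8)%:C * (-1 -i* 1) * 'i ^+ n) = - (3 * ell j / 8).
  have := iexp_cases R n; rewrite !inE => /or4P[] /eqP ->; rewrite !(cImM, cReM) /=;
    by [right; ring|right; ring|left; ring|left; ring].
  by rewrite /=; lra.
by rewrite /=; lra.
Qed.

Let mean_ge0 j a N w : 0 <= mean j a N w.
Proof.
rewrite /mean /square_mean sumr_ge0// => k _; rewrite mulr_ge0 ?invr_ge0// sumr_ge0// => i _.
by rewrite exprn_ge0// cmod_ge0.
Qed.

Let measurable_mean j a N : measurable_fun setT (mean j a N).
Proof.
apply: measurable_sum => k; apply: measurable_funM => //.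
apply: measurable_sum => i; apply: measurable_cmod_even.
exact: (node_upper _ _ _ _).1.
Qed.

Let einf_ge0 j a w : (0 <= limn_einf (fun N => (mean j a N w)%:E))%E.
Proof.
rewrite limn_einf_lim; apply: lime_ge; first exact: is_cvg_einfs.
apply: nearW => n; apply: le_ereal_inf_tmp => _ [k _ <-].
by rewrite lee_fin.
Qed.

Let weight_ge0 j : 0 <= weight j. Proof. by rewrite mulr_ge0 ?powR_ge0. Qed.

Let inner_ge0 j w : (0 <= \sum_(0 <= a < (8 * 2 ^ j).+1)
    (weight j)%:E * limn_einf (fun N => (mean j a N w)%:E))%E.
Proof. by apply: sume_ge0 => a _; rewrite mule_ge0// lee_fin. Qed.

Let measurable_einf j a : measurable_fun setT (fun w => limn_einf (fun N => (mean j a N w)%:E)).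
Proof.
apply: measurableT_comp => //.
apply: (measurable_fun_limn_esup (f := fun N w => (- (mean j a N w)%:E)%E)) => N.
by apply: measurableT_comp => //; apply/measurable_EFinP.
Qed.

Let measurable_inner j : measurable_fun setT (fun w => \sum_(0 <= a < (8 * 2 ^ j).+1)
    (weight j)%:E * limn_einf (fun N => (mean j a N w)%:E))%E.
Proof. by apply: emeasurable_sum => a; apply: measurable_funeM. Qed.

Lemma whitney_sum_ge0 w : (0 <= whitney_sum w)%E.
Proof. by apply: nneseries_ge0 => j _ _. Qed.

Lemma measurable_whitney_sum : measurable_fun setT whitney_sum.
Proof.
by apply: (ge0_emeasurable_sum (P := xpredT)) => [k w _ _|k _]; [exact: inner_ge0|].
Qed.

Lemma whitney_sum_bound w z : `|complex.Re z| <= rho -> 0 < complex.Im z <= rho ->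
  ((cmod (X' w z) ^+ (2 * m) * complex.Im z `^ ((1 - g) * (2 * m)%:R))%:E <= whitney_sum w)%E.
Proof.
case: z => x y /= xr /andP[y0 yr].
(* The least [j] satisfying the first inequality; minimality gives the second one, and at [j = 0] it
   is [y <= rho]. *)
have [j /andP[yj1 yj2]] : exists j, ell j / 2 < y <= ell j.
  have ex : exists j, ell j / 2 < y.
    exists (Num.truncn (rho / y)).
    have : rho / y < (Num.truncn (rho / y)).+1%:R by exact: truncnS_gt.
    rewrite ltr_pdivrMr// => H.
    rewrite /ell -mulrA -invfM ltr_pdivrMr ?mulr_gt0 ?exprn_gt0//.
    rewrite (lt_le_trans H)// mulrC ler_wpM2l ?(ltW y0)// -exprSr -natrX ler_nat.
    by rewrite (leq_trans (ltn_expl _ (isT : 1 < 2)%N))// leq_exp2l.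
  case: (ex_minnP ex) => j H1 H2; exists j; rewrite H1/=.
  case: j H1 H2 => [|j] H1 H2; first by rewrite /ell expr0 divr1.
  rewrite leNgt; apply/negP => Hlt.
  suff /H2 : ell j / 2 < y by rewrite ltnn.
  by move: Hlt; rewrite /ell exprSr invfM mulrA.
have l0 := ell0 j.
move: xr; rewrite ler_norml => /andP[xr1 xr2].
pose a := Num.truncn ((x + rho) / (ell j / 4)).
have xa0 : 0 <= (x + rho) / (ell j / 4) by rewrite divr_ge0 ?divr_ge0 ?(ltW l0)//; lra.
have a1 : a%:R * (ell j / 4) <= x + rho.
  by rewrite -ler_pdivlMr ?divr_gt0// truncn_le.
have a2 : x + rho < a.+1%:R * (ell j / 4).
  by rewrite -ltr_pdivrMr ?divr_gt0// truncnS_gt.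
have ab : (a < (8 * 2 ^ j).+1)%N.
  rewrite ltnS -(ler_nat R) natrM natrX.
  have : a%:R <= (x + rho) / (ell j / 4) by rewrite truncn_le.
  move=> /le_trans; apply; rewrite ler_pdivrMr ?divr_gt0// /ell.
  have p0 : 0 < 2 ^+ j :> R by rewrite exprn_gt0.
  rewrite (_ : 8 * 2 ^+ j * (rho / 2 ^+ j / 4) = 2 * rho); first lra.
  by field; rewrite gt_eqF.
have HB : ((weight j)%:E * limn_einf (fun N => (mean j a N w)%:E) <= whitney_sum w)%E.
  apply: le_trans (nneseries_lim_ge j.+1 _); last by move=> n _ _; exact: inner_ge0.
  rewrite big_nat_recr//=; apply: le_trans (leeDr _ _); last by apply: sume_ge0.
  rewrite (big_nat_widenl _ 0)// big_mkcond /= (bigD1_seq a) ?mem_index_iota ?iota_uniq//=.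
  by rewrite leeDl// sume_ge0// => b _; rewrite mule_ge0// lee_fin.
apply: le_trans HB.
have af : analytic_on (upper_half (R := R)) (X' w) by case: afX.
have rl : 3 * ell j / 8 < complex.Im (centre j a) by rewrite /=; lra.
have r0 : 0 < 3 * ell j / 8 by lra.
have c1 : `|complex.Re ((x +i* y) - centre j a)| <= 2 * (3 * ell j / 8) / 3.
  rewrite cReB /= ler_norml; rewrite -natr1 mulrDl mul1r in a2.
  apply/andP; split; lra.
have c2 : `|complex.Im ((x +i* y) - centre j a)| <= 2 * (3 * ell j / 8) / 3.
  by rewrite cImB /= ler_norml; apply/andP; split; lra.
(* The Cauchy estimate holds for all large [N], with an error that tends to [0]: this is exactly a
   bound by the lower limit. *)
have H : ((cmod (X' w (x +i* y)) ^+ (2 * m) / 15)%:E <= limn_einf (fun N => (mean j a N w)%:E))%E.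
  apply/lee_addgt0Pr => e e0.
  have e15 : 0 < 15 * e by rewrite mulr_gt0.
  have [N0 HN0] := cauchy_square_power (2 * m) af r0 rl c1 c2 e15.
  rewrite -leeBlDr// -EFinB limn_einf_lim.
  apply: (@le_trans _ _ (einfs (fun N => (mean j a N w)%:E) N0)).
    apply: le_ereal_inf_tmp => _ [N /= NN0 <-]; rewrite lee_fin.
    have := HN0 N NN0; rewrite -/(mean j a N w); lra.
  rewrite (cvg_lim _ (ereal_nondecreasing_cvgn (nondecreasing_einfs _)))//.
  by apply: ereal_sup_ubound; exists N0.
apply: (@le_trans _ _ ((weight j)%:E * (cmod (X' w (x +i* y)) ^+ (2 * m) / 15)%:E)%E); last first.
  by rewrite lee_wpmul2l ?lee_fin.
rewrite -EFinM lee_fin /weight mulrC.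
have -> : 15 * ell j `^ ((1 - g) * (2 * m)%:R) * (cmod (X' w (x +i* y)) ^+ (2 * m) / 15) =
  ell j `^ ((1 - g) * (2 * m)%:R) * cmod (X' w (x +i* y)) ^+ (2 * m) by field.
rewrite ler_wpM2r ?exprn_ge0 ?cmod_ge0//.
by rewrite ge0_ler_powR ?nnegrE ?(ltW y0) ?(ltW l0) ?mulr_ge0 ?subr_ge0.
Qed.

(** A square of scale [j] contributes a multiple of [ell j] to the power [(alpha - g) 2m], which is
    at most a multiple of [4^-j] by [gm]; there are at most [9 * 2^j] of them, so the series is
    geometric. *)
Lemma whitney_sum_integral : (\int[P]_w whitney_sum w < +oo)%E.
Proof.
have [C C0 HC] := afBm_moment m0.
pose D : R := 4 * C * (3 / 8) `^ ((alpha - 1) * (2 * m)%:R).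
have D0 : 0 <= D by rewrite !mulr_ge0 ?powR_ge0.
have meanI j a N : (\int[P]_w (mean j a N w)%:E <= (D * ell j `^ ((alpha - 1) * (2 * m)%:R))%:E)%E.
  have l0 := ell0 j.
  pose b := C * (3 * ell j / 8) `^ ((alpha - 1) * (2 * m)%:R).
  have -> : D * ell j `^ ((alpha - 1) * (2 * m)%:R) = 4 * b.
    rewrite /b (_ : 3 * ell j / 8 = 3 / 8 * ell j); last by ring.
    rewrite (@powRM _ (3 / 8) (ell j)) ?(ltW l0)// /D; ring.
  have nodeI k (i : 'I_N.+1) : (\int[P]_w (cmod (X' w (square_node (centre j a) (3 * ell j / 8) N k i)) ^+ (2 * m))%:E <= b%:E)%E.
    have [uP uI] := node_upper j a k i.
    apply: (le_trans (HC _ uP)); rewrite lee_fin ler_wpM2l//.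
    (* The exponent is nonpositive, so the lowest possible height of a node gives the largest
       bound. *)
    rewrite -[alpha - 1]opprB mulNr !powRN lef_pV2 ?posrE ?powR_gt0//; last by lra.
    have q0 : 0 <= (1 - alpha) * (2 * m)%:R by rewrite mulr_ge0// subr_ge0.
    by apply: ge0_ler_powR => //; rewrite nnegrE ?(ltW uP)//; lra.
  rewrite /mean /square_mean.
  under eq_integral do rewrite -sumEFin.
  rewrite ge0_integral_sum//; last 2 first.
  - move=> k; apply/measurable_EFinP; apply: measurable_funM => //.
    apply: measurable_sum => i; apply: measurable_cmod_even; exact: (node_upper _ _ _ _).1.
  - move=> k w _; rewrite lee_fin mulr_ge0 ?invr_ge0// sumr_ge0// => i _.
    by rewrite exprn_ge0// cmod_ge0.
  apply: (@le_trans _ _ (\sum_(k < 4) b%:E)%E); last first.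
    by rewrite sumEFin lee_fin sumr_const card_ord mulr_natl.
  apply: lee_sum => k _.
  under eq_integral do rewrite EFinM.
  rewrite ge0_integralZl_EFin ?invr_ge0//; last 2 first.
  - move=> w _; rewrite lee_fin sumr_ge0// => i _; by rewrite exprn_ge0// cmod_ge0.
  - apply/measurable_EFinP; apply: measurable_sum => i; apply: measurable_cmod_even.
    exact: (node_upper _ _ _ _).1.
  rewrite lee_pdivrMl ?ltr0Sn//.
  under eq_integral do rewrite -sumEFin.
  rewrite ge0_integral_sum//; last 2 first.
  - move=> i; apply/measurable_EFinP; apply: measurable_cmod_even; exact: (node_upper _ _ _ _).1.
  - by move=> i w _; rewrite lee_fin exprn_ge0// cmod_ge0.
  apply: (@le_trans _ _ (\sum_(i < N.+1) b%:E)%E); first by apply: lee_sum => i _; exact: nodeI.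
  by rewrite sumEFin sumr_const card_ord -EFinM mulr_natl.
pose E : R := 15 * D * 9 * rho `^ ((alpha - g) * (2 * m)%:R).
have E0 : 0 <= E by rewrite !mulr_ge0 ?powR_ge0.
rewrite /whitney_sum integral_nneseries//.
apply: (@le_lt_trans _ _ (\sum_(j <oo) ((2 * E) / (2 ^ j.+1)%:R)%:E)%E); last first.
  apply: (@le_lt_trans _ _ (2 * E)%:E); last by rewrite ltry.
  by apply: (epsilon_trick0 xpredT); rewrite mulr_ge0.
apply: lee_nneseries => [j _ _|j _].
  by apply: integral_ge0 => w _.
rewrite ge0_integral_sum//; last 2 first.
- by move=> a; apply: measurable_funeM.
- by move=> a w _; rewrite mule_ge0// lee_fin.
apply: (@le_trans _ _ (\sum_(0 <= a < (8 * 2 ^ j).+1)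
    (weight j * (D * ell j `^ ((alpha - 1) * (2 * m)%:R)))%:E)%E).
  apply: lee_sum => a _.
  rewrite (@ge0_integralZl_EFin _ _ _ P _ measurableT (fun w => limn_einf (fun N => (mean j a N w)%:E)))// (EFinM (weight j)).
  rewrite lee_wpmul2l ?lee_fin//.
  (* Fatou's lemma exchanges the expectation and the lower limit of the Riemann means. *)
  have F : (\int[P]_w limn_einf (fun N => (mean j a N w)%:E) <=
      limn_einf (fun N => \int[P]_w (mean j a N w)%:E))%E.
    apply: fatou => // [N|N w _]; first exact/measurable_EFinP.
    by rewrite lee_fin.
  apply: (le_trans F).
  rewrite limn_einf_lim; apply: lime_le; first exact: is_cvg_einfs.
  apply: nearW => N; apply: (le_trans _ (meanI j a N)).
  by apply: ereal_inf_lbound; exists N => /=.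
rewrite sumEFin big_const_nat iter_addr addr0 subn0 lee_fin.
rewrite -[_ *+ _]mulr_natr.
have -> : weight j * (D * ell j `^ ((alpha - 1) * (2 * m)%:R)) =
   15 * D * ell j `^ ((alpha - g) * (2 * m)%:R).
  rewrite /weight.
  have -> : (alpha - g) * (2 * m)%:R = (1 - g) * (2 * m)%:R + (alpha - 1) * (2 * m)%:R by ring.
  rewrite powRD; first by ring.
  by apply/implyP => _; rewrite gt_eqF.
have p0 : 0 < 2 ^+ j :> R by rewrite exprn_gt0.
have ellp : ell j `^ ((alpha - g) * (2 * m)%:R) <= rho `^ ((alpha - g) * (2 * m)%:R) / 4 ^+ j.
  rewrite /ell powRM ?(ltW rho0) ?invr_ge0 ?(ltW p0)// ler_wpM2l ?powR_ge0//.
  rewrite -(powR_inv1 (ltW p0)) -powRrM mulN1r powRN lef_pV2 ?posrE ?powR_gt0 ?exprn_gt0//.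
  apply: (@le_trans _ _ ((2 ^+ j) `^ 2)); last first.
    by rewrite ler_powR// exprn_ege1// ler1n.
  rewrite (powR_mulrn 2 (ltW p0)) -exprM mulnC exprM.
  by rewrite (_ : 2 ^+ 2 = 4 :> R)//; ring.
have cnt : (8 * 2 ^ j).+1%:R <= 9 * 2 ^+ j :> R.
  rewrite -natr1 natrM natrX; have : 1 <= 2 ^+ j :> R by rewrite exprn_ege1// ler1n.
  lra.
apply: (@le_trans _ _ (15 * D * (rho `^ ((alpha - g) * (2 * m)%:R) / 4 ^+ j) * (9 * 2 ^+ j))).
  by rewrite ler_pM ?mulr_ge0 ?powR_ge0// ler_wpM2l// mulr_ge0.
rewrite natrX exprS /E le_eqVlt; apply/orP; left; apply/eqP.
rewrite (_ : 4 ^+ j = 2 ^+ j * 2 ^+ j :> R); last by rewrite -exprMn; congr (_ ^+ _); ring.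
by field; rewrite gt_eqF.
Qed.

End AfbmSupremum.

(** * Extension to the closed half plane *)

Section BoundaryExtension.
Variables (R : realType) (I : Type).
Implicit Types (w v : seq I) (s t u z : R[i]) (m n : nat) (e : R).

Definition half_disk (r : R) z := upper_half z /\ cmod z <= r.

Definition closed_half_disk (r : R) z := closed_upper_half z /\ cmod z <= r.

Definition above m z : R[i] := ishift m.+1%:R^-1 z.

Lemma ishiftB e e' z : ishift e z - ishift e' z = 0 +i* (e - e').
Proof. by apply: eq_ReIm; rewrite !ReIm /=; ring. Qed.

Lemma ishift_dist e z z' : ishift e z - ishift e z' = z - z'.
Proof. by rewrite /ishift; ring. Qed.

Lemma ishift_upper_half e z : 0 < e -> closed_upper_half z -> upper_half (ishift e z).
Proof.
rewrite /closed_upper_half /upper_half /ishift /= => e0 zP.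
by rewrite cImD /= ltr_wpDl.
Qed.

Lemma cmod_ishift e z : 0 <= e -> cmod (ishift e z) <= cmod z + e.
Proof. by move=> e0; rewrite (le_trans (cmodD _ _))// cmod_imag ger0_norm. Qed.

Lemma invS_small (e : R) : 0 < e -> exists N, forall m, (N <= m)%N -> m.+1%:R^-1 <= e.
Proof.
move=> e0; exists (Num.truncn e^-1) => m Nm.
have : e^-1 < (Num.truncn e^-1).+1%:R by exact: truncnS_gt.
move=> H; rewrite -[leRHS]invrK lef_pV2 ?posrE ?invr_gt0 ?ltr0Sn//.
by rewrite (le_trans (ltW H))// ler_nat ltnS.
Qed.

Lemma powR_small (g : R) (e : R) : 0 < g -> 0 < e ->
  exists2 dl : R, 0 < dl & forall x, 0 <= x <= dl -> x `^ g <= e.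
Proof.
move=> g0 e0; exists (e `^ g^-1); first by rewrite powR_gt0.
move=> x /andP[x0 xd]; apply: (@le_trans _ _ ((e `^ g^-1) `^ g)).
  by apply: ge0_ler_powR => //; rewrite ?nnegrE ?powR_ge0 ?ltW.
by rewrite -powRrM mulVf ?gt_eqF// powRr1// ltW.
Qed.

Lemma size_shuffles w v : all (fun l => size l == size w + size v)%N (shuffles w v).
Proof.
elim: w v => [|i w IHw] v; first by case: v => [|j v] //=; rewrite eqxx.
elim: v => [|j v IHv]; first by rewrite /= addn0 eqxx.
rewrite [shuffles _ _]/= all_cat !all_map; apply/andP; split.
  by apply: sub_all (IHw (j :: v)) => l /= /eqP ->.
by apply: sub_all IHv => l /= /eqP ->; rewrite addnS.
Qed.

Variables (h : I -> R[i] -> R[i]) (M g r : R) (n : nat).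
Hypotheses (holh : forall i, hol (h i)) (M0 : 0 <= M) (g01 : 0 < g <= 1) (r0 : 0 <= r).
Hypothesis hM : forall i z, `|complex.Re z| <= 3 * r -> 0 < complex.Im z <= 3 * r ->
  cmod (h i z) <= M * complex.Im z `^ (g - 1).
Local Notation G := (chen_int h).

(** The base dominates [1], [6 M / g] and [6 M / g |t - s|^g] for points of the disk, whose distance
    is at most [2 r]. In [chen_cst], [n.+1] counts the terms of Chen's relation. *)
Definition chen_base (g r M : R) : R := 1 + 6 * M / g * (1 + (2 * r) `^ g).
Definition chen_cst (g r M : R) n : R := n.+1%:R * chen_base g r M ^+ n.
Local Notation B := (chen_base g r M).
Local Notation K := (chen_cst g r M n).

Let g0 : 0 < g. Proof. by case/andP: g01. Qed.

Let A0 : 0 <= 6 * M / g. Proof. by rewrite divr_ge0 ?mulr_ge0// ltW. Qed.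

Local Notation disk := (half_disk r).

Let B1 : 1 <= B.
Proof. by rewrite /chen_base lerDl mulr_ge0// addr_ge0// powR_ge0. Qed.

Lemma chen_cst_ge0 : 0 <= K.
Proof. by rewrite mulr_ge0// exprn_ge0// (le_trans ler01 B1). Qed.

Let BK k : (k <= n)%N -> B ^+ k <= K.
Proof.
move=> kn; rewrite /chen_cst (@le_trans _ _ (B ^+ n)) ?ler_weXn2l//.
by rewrite ler_peMl ?exprn_ge0 ?(le_trans ler01 B1)// ler1n.
Qed.

Let dist_le s t : disk s -> disk t -> cmod (t - s) `^ g <= (2 * r) `^ g.
Proof.
move=> [_ sr] [_ tr]; rewrite ge0_ler_powR ?nnegrE ?cmod_ge0 ?(ltW g0) ?mulr_ge0//.
rewrite (le_trans (cmodB _ _))//; lra.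
Qed.

Let bound s t w : disk s -> disk t -> cmod (G w t s) <= (6 * M / g * cmod (t - s) `^ g) ^+ size w.
Proof.
move=> [sP sr] [tP tr].
apply: (@chen_bound R I h holh M g M0 g01 (3 * r)) => //; lra.
Qed.

Let ABd s t : disk s -> disk t -> 6 * M / g * cmod (t - s) `^ g <= B.
Proof.
move=> sD tD; rewrite /chen_base mulrDr mulr1.
have := ler_wpM2l A0 (dist_le sD tD); move: (_ * _ `^ _) (_ * _ `^ _) A0 => ? ? ?; lra.
Qed.

Let bound1 s t w : disk s -> disk t -> cmod (G w t s) <= B ^+ size w.
Proof.
move=> sD tD; rewrite (le_trans (bound w sD tD))//.
apply: lerXn2r; rewrite ?nnegrE; [|exact: le_trans ler01 B1|exact: ABd].
by rewrite mulr_ge0 ?powR_ge0.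
Qed.

Lemma chen_int_bound s t w : disk s -> disk t -> (size w <= n)%N ->
  cmod (G w t s) <= K * cmod (t - s) `^ ((size w)%:R * g).
Proof.
move=> sD tD wn; rewrite (le_trans (bound w sD tD))// exprMn.
rewrite -[X in _ * X]powR_mulrn ?powR_ge0// -powRrM [g * _]mulrC ler_wpM2r ?powR_ge0//.
rewrite (le_trans _ (BK wn))// lerXn2r ?nnegrE// ?(le_trans ler01 B1)//.
rewrite /chen_base; move: A0 => /ler_wpM2l /(_ _ _ (powR_ge0 (2 * r) g)).
rewrite mulr0 mulrDr mulr1; move: (_ * _ `^ _) => ?; lra.
Qed.

(** A single power of [|t - s|^g] is kept; all other factors are absorbed into powers of the
    base. *)
Let term_le s t j k : disk s -> disk t -> (j < k <= n)%N ->
  (6 * M / g * cmod (t - s) `^ g) ^+ j.+1 * B ^+ (k - j.+1) <= B ^+ n * cmod (t - s) `^ g.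
Proof.
move=> sD tD /andP[jk kn].
have d0 : 0 <= cmod (t - s) `^ g by exact: powR_ge0.
have B0 : 0 <= B := le_trans ler01 B1.
have AB := ABd sD tD.
have AB' : 6 * M / g <= B.
  rewrite /chen_base; have := mulr_ge0 A0 (powR_ge0 (2 * r) g).
  rewrite mulrDr mulr1; move: (_ * _ `^ _) => ?; lra.
move: d0 AB; set d := _ `^ g; move: (6 * M / g) A0 AB' => A Age0 AB' d0 AB.
have Ad0 : 0 <= A * d by rewrite mulr_ge0.
rewrite exprS -!mulrA (mulrC d) !mulrA ler_wpM2r//.
apply: (@le_trans _ _ (B * B ^+ j * B ^+ (k - j.+1))).
  by rewrite !ler_pM ?mulr_ge0 ?exprn_ge0// lerXn2r ?nnegrE.
by rewrite -exprS -exprD ler_weXn2l// subnKC.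
Qed.

Let sum_term (a : nat -> R[i]) s t k : disk s -> disk t -> (k <= n)%N ->
  (forall j : 'I_k, cmod (a j) <= B ^+ n * cmod (t - s) `^ g) ->
  cmod (\sum_(j < k) a j) <= K * cmod (t - s) `^ g.
Proof.
move=> sD tD kn H; rewrite (le_trans (cmod_sum _ _ _))//.
apply: (@le_trans _ _ (\sum_(j < k) B ^+ n * cmod (t - s) `^ g)).
  by apply: ler_sum => j _.
have B0 : 0 <= B := le_trans ler01 B1.
rewrite sumr_const card_ord -[leLHS]mulr_natl /chen_cst mulrA ler_wpM2r ?powR_ge0//.
by rewrite ler_wpM2r ?exprn_ge0// ler_nat (leq_trans kn).
Qed.

(** In Chen's relation through [t'] the term [j = 0] is the integral ending at [t']; every other
    term has a nontrivial factor between [t'] and [t]. *)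
Lemma chen_int_modulus_left s t t' w : disk s -> disk t -> disk t' -> (size w <= n)%N ->
  cmod (G w t s - G w t' s) <= K * cmod (t - t') `^ g.
Proof.
move=> sD tD tD' wn; rewrite (@chen_relation _ _ h holh w t t' s); [|exact: tD.1|exact: tD'.1|exact: sD.1].
rewrite big_ord_recl take0 drop0 [G [::] _ _]/= mul1r addrAC subrr add0r.
apply: (sum_term (a := fun j => G (take j.+1 w) t t' * G (drop j.+1 w) t' s)) => // j.
apply: le_trans (term_le (j := j) (k := size w) tD' tD _); last by rewrite ltn_ord.
rewrite cmodM ler_pM ?cmod_ge0//.
  by rewrite (le_trans (bound _ tD' tD))// size_takel.
by rewrite (le_trans (bound1 _ sD tD'))// size_drop.
Qed.

Lemma chen_int_modulus_right s s' t w : disk s -> disk s' -> disk t -> (size w <= n)%N ->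
  cmod (G w t s - G w t s') <= K * cmod (s - s') `^ g.
Proof.
move=> sD sD' tD wn; rewrite (@chen_relation _ _ h holh w t s' s); [|exact: tD.1|exact: sD'.1|exact: sD.1].
rewrite big_ord_recr take_size drop_size /= mulr1 addrK cmod_distC.
(* Here the small factor is the tail of the word, of length [size w - j]: hence the reversed index
   below. *)
apply: (sum_term (a := fun j => G (take j w) t s' * G (drop j w) s' s)) => // j.
apply: le_trans (term_le (j := size w - j.+1) (k := size w) sD sD' _); last first.
  by rewrite wn andbT; have := ltn_ord j; lia.
rewrite cmodM mulrC ler_pM ?cmod_ge0//.
  by rewrite (le_trans (bound _ sD sD'))// size_drop subnSK.
rewrite (le_trans (bound1 _ sD' tD))// size_takel 1?ltnW//.
by rewrite ler_weXn2l//; have := ltn_ord j; lia.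
Qed.

Lemma chen_int_modulus s s' t t' w : disk s -> disk s' -> disk t -> disk t' -> (size w <= n)%N ->
  cmod (G w t s - G w t' s') <= K * (cmod (t - t') `^ g + cmod (s - s') `^ g).
Proof.
move=> sD sD' tD tD' wn; rewrite (le_trans (cmod_distD (G w t' s) _ _))// mulrDr.
by rewrite lerD// ?chen_int_modulus_left ?chen_int_modulus_right.
Qed.

(* The limit of the iterated integrals from above, with junk value [0]. *)
Definition chen_lim w t s : R[i] :=
  xget 0 [set l | ctends (fun m => G w (above m t) (above m s)) l].

Local Notation cdisk := (closed_half_disk (r - 1)).

(** The margin [1] in the radius of [cdisk] leaves room for shifts by at most [1]. *)
Let disk_ishift e s : 0 < e <= 1 -> cdisk s -> disk (ishift e s).
Proof.
move=> /andP[e0 e1] [sP sr]; split; first exact: ishift_upper_half.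
by rewrite (le_trans (cmod_ishift _ (ltW e0)))//; lra.
Qed.

Let disk_above m s : cdisk s -> disk (above m s).
Proof. by apply: disk_ishift; rewrite invr_gt0 ltr0Sn invf_le1 ?ltr0Sn// ler1n. Qed.

Let Kgt0 : 0 < K.
Proof. by rewrite mulr_gt0// exprn_gt0// (lt_le_trans ltr01 B1). Qed.

Lemma chen_lim_ctends w t s : cdisk t -> cdisk s -> (size w <= n)%N ->
  ctends (fun m => G w (above m t) (above m s)) (chen_lim w t s).
Proof.
move=> tD sD wn; rewrite /chen_lim; case: xgetP => //.
have [|l Hl] := @ctends_cauchy _ (fun m => G w (above m t) (above m s)); last first.
  by move=> /(_ l).
move=> e e0; have e2 : 0 < e / (2 * K) by rewrite divr_gt0// mulr_gt0.
have [dl dl0 Hdl] := powR_small g0 e2.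
have [N HN] := invS_small dl0; exists N => p q Np Nq.
have := chen_int_modulus (disk_above p sD) (disk_above q sD) (disk_above p tD) (disk_above q tD) wn.
move=> /le_trans; apply; rewrite /above !ishiftB cmod_imag.
have : `|p.+1%:R^-1 - q.+1%:R^-1| `^ g <= e / (2 * K).
  apply: Hdl; rewrite normr_ge0 ler_norml /=.
  have := HN _ Np; have := HN _ Nq.
  have : 0 < p.+1%:R^-1 :> R by rewrite invr_gt0.
  have : 0 < q.+1%:R^-1 :> R by rewrite invr_gt0.
  move: (_^-1) (_^-1) => x y ? ? ? ?; apply/andP; split; lra.
have K2 : 0 < 2 * K by rewrite mulr_gt0.
rewrite ler_pdivlMr// => H; apply: le_trans H.
by rewrite -mulr2n -[_ *+ 2]mulr_natl mulrCA mulrA mulrC.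
Qed.

Lemma chen_lim_bound w t s : cdisk t -> cdisk s -> (size w <= n)%N ->
  cmod (chen_lim w t s) <= K * cmod (t - s) `^ ((size w)%:R * g).
Proof.
move=> tD sD wn; apply: (ctends_cmod_le (chen_lim_ctends tD sD wn)) => m.
by have := chen_int_bound (disk_above m sD) (disk_above m tD) wn; rewrite ishift_dist.
Qed.

Lemma chen_lim_modulus w t t' s s' : cdisk t -> cdisk t' -> cdisk s -> cdisk s' ->
  (size w <= n)%N ->
  cmod (chen_lim w t s - chen_lim w t' s') <= K * (cmod (t - t') `^ g + cmod (s - s') `^ g).
Proof.
move=> tD tD' sD sD' wn.
apply: (ctends_cmod_le (ctendsB (chen_lim_ctends tD sD wn) (chen_lim_ctends tD' sD' wn))) => m.
have := chen_int_modulus (disk_above m sD) (disk_above m sD') (disk_above m tD) (disk_above m tD') wn.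
by rewrite !ishift_dist.
Qed.

Lemma chen_lim_rate w t s e : cdisk t -> cdisk s -> (size w <= n)%N -> 0 < e <= 1 ->
  cmod (G w (ishift e t) (ishift e s) - chen_lim w t s) <= 2 * K * e `^ g.
Proof.
move=> tD sD wn e01; have [e0 _] := andP e01.
have [N HN] := invS_small e0.
(* Starting the sequence at [N] makes its shifts at most [e], so that they differ from [e] by at
   most [e]. *)
have lim := ctends_shift N (ctendsB (ctends_cst (G w (ishift e t) (ishift e s))) (chen_lim_ctends tD sD wn)).
apply: (ctends_cmod_le lim) => m /=.
have := chen_int_modulus (disk_ishift e01 sD) (disk_above (m + N) sD) (disk_ishift e01 tD) (disk_above (m + N) tD) wn.
move=> /le_trans; apply; rewrite /above !ishiftB cmod_imag.
rewrite -mulr2n -[_ *+ 2]mulr_natl mulrCA -mulrA ler_wpM2l// ler_wpM2l ?(ltW Kgt0)//.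
apply: ge0_ler_powR; rewrite ?nnegrE ?(ltW g0) ?(ltW e0)// ler_norml.
have := HN (m + N)%N (leq_addl _ _).
have : 0 < (m + N).+1%:R^-1 :> R by rewrite invr_gt0.
move: (_^-1) => x ? ?; apply/andP; split; lra.
Qed.

Lemma chen_lim_relation w t u s : cdisk t -> cdisk u -> cdisk s -> (size w <= n)%N ->
  chen_lim w t s = \sum_(j < (size w).+1) chen_lim (take j w) t u * chen_lim (drop j w) u s.
Proof.
move=> tD uD sD wn; apply: (ctends_unique (chen_lim_ctends tD sD wn)).
apply: ctends_ext; last first.
  apply: ctends_sum => j; apply: ctendsM; apply: chen_lim_ctends => //.
    by rewrite size_take_min (leq_trans (geq_minr _ _)).
  by rewrite size_drop (leq_trans (leq_subr _ _)).
move=> m /=; rewrite -(@chen_relation _ _ h holh)//.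
- exact: (disk_above m tD).1.
- exact: (disk_above m uD).1.
- exact: (disk_above m sD).1.
Qed.

Lemma chen_lim_shuffle w v t s : cdisk t -> cdisk s -> (size w + size v <= n)%N ->
  chen_lim w t s * chen_lim v t s = \sum_(l <- shuffles w v) chen_lim l t s.
Proof.
move=> tD sD wvn.
have wn : (size w <= n)%N by rewrite (leq_trans _ wvn)// leq_addr.
have vn : (size v <= n)%N by rewrite (leq_trans _ wvn)// leq_addl.
apply: (ctends_unique (ctendsM (chen_lim_ctends tD sD wn) (chen_lim_ctends tD sD vn))).
have sh : all (fun l => size l <= n)%N (shuffles w v).
  by apply: sub_all (size_shuffles w v) => l /eqP ->.
suff H : ctends (fun m => \sum_(l <- shuffles w v) G l (above m t) (above m s))
    (\sum_(l <- shuffles w v) chen_lim l t s).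
  apply: ctends_ext H => m /=; rewrite -(@chen_shuffle _ _ h holh)//.
  - exact: (disk_above m tD).1.
  - exact: (disk_above m sD).1.
elim: (shuffles w v) sh => [_|l ls IH /= /andP[ln /IH lsn]].
  by rewrite big_nil; apply: ctends_ext (ctends_cst 0) => m; rewrite big_nil.
rewrite big_cons; apply: ctends_ext (ctendsD (chen_lim_ctends tD sD ln) lsn) => m.
by rewrite big_cons.
Qed.

End BoundaryExtension.

(** * The path as a primitive, from integrals starting at the boundary point 0 *)

Section ImproperPrimitive.
Variable R : realType.
Local Notation mu := (@lebesgue_measure R).

(** The primitive may be singular at [0]; integrability makes the integral over [[0, a]] vanish with
    [a]. *)
Lemma FTC_improper (F f : R -> R) (e : R) : mu.-integrable `[0, 1] (EFin \o f) ->
  (forall x : R, 0 < x <= 1 -> is_derive x 1 F (f x)) ->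
  (forall x : R, 0 < x <= 1 -> {for x, continuous f}) -> 0 < e ->
  exists2 dl : R, 0 < dl & forall a, 0 < a < dl -> a < 1 ->
    `|F 1 - F a - \int[mu]_(x in `[0, 1]) f x| <= e.
Proof.
move=> intf Ff cf e0.
have := parameterized_integral_cvg_left ltr01 intf.
move=> /cvgrPdist_le /(_ e e0) [dl /= dl0 H]; exists dl => // a /andP[a0 adl] a1.
have -> : F 1 - F a = \int[mu]_(x in `[a, 1]) f x.
  rewrite /Rintegral (@continuous_FTC2 _ f F a 1)//.
  - apply: continuous_in_subspaceT => x; rewrite inE /= in_itv /= => /andP[ax x1].
    by apply: cf; rewrite (lt_le_trans a0).
  - have cF (x : R) : a <= x <= 1 -> {for x, continuous F}.
      move=> /andP[ax x1].
      have /Ff[dF _] : 0 < x <= 1 by rewrite (lt_le_trans a0).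
      by apply: differentiable_continuous; exact/derivable1_diffP.
    split; last 2 first.
    + by apply: cvg_at_right_filter; apply: cF; rewrite lexx ltW.
    + by apply: cvg_at_left_filter; apply: cF; rewrite lexx ltW.
    move=> x; rewrite in_itv /= => /andP[ax /ltW x1].
    by have [] : is_derive x 1 F (f x) by apply: Ff; rewrite (lt_trans a0).
  - move=> x; rewrite in_itv /= => /andP[ax /ltW x1].
    have [_ <-] : is_derive x 1 F (f x) by apply: Ff; rewrite (lt_trans a0).
    by rewrite derive1E.
have sub (i : interval R) : [set` i] `<=` [set` `[0, 1]] -> measurable [set` i] ->
    mu.-integrable [set` i] (EFin \o f).
  by move=> i01 mi; apply: integrableS intf.
have <- : \int[mu]_(x in `]a, 1]) f x = \int[mu]_(x in `[a, 1]) f x.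
  rewrite Rintegral_itv_obnd_cbnd//; apply: sub => //.
  by apply: subset_itvScc; rewrite bnd_simp// ltW.
rewrite -(@Rintegral_itvB _ f (BLeft 0) (BRight 1) a)//; try by rewrite bnd_simp ltW.
rewrite addrAC subrr sub0r normrN.
have := H a; rewrite sub0r normrN /parameterized_integral; apply.
by rewrite /= sub0r normrN gtr0_norm.
Qed.

Variables (I : Type) (h : I -> R[i] -> R[i]) (holh : forall i, hol (h i)).
Local Notation G := (chen_int h).

Lemma chen_int1D i t u s : upper_half t -> upper_half u -> upper_half s ->
  G [:: i] t s = G [:: i] t u + G [:: i] u s.
Proof.
move=> tP uP sP; rewrite (@chen_relation _ _ h holh _ t u s)//.
by rewrite !big_ord_recl big_ord0 /bump /= mul1r mulr1 addr0 addrC.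
Qed.

Lemma chen_int1_improper i z (e : R) : upper_half z -> seg_integrable (h i) 0 z -> 0 < e ->
  exists2 dl : R, 0 < dl & forall a : R, 0 < a < dl -> a < 1 ->
    cmod (G [:: i] z (a%:C * z) - seg_int (h i) 0 z) <= e.
Proof.
move=> zP [ire iim] e0.
have z0 : z != 0 by apply/negP => /eqP zz; move: zP; rewrite zz /upper_half /= ltxx.
pose F u := G [:: i] u z.
have param x : seg_param 0 z x = x%:C * z by rewrite /seg_param subr0 add0r.
have xP x : 0 < x -> upper_half (x%:C * z).
  by move=> x0; rewrite /upper_half /= Im_real_mul mulr_gt0.
have dF (c : R[i]) (x : R) : 0 < x <= 1 ->
    is_derive x 1 (fun y : R => complex.Re (c * F (y%:C * z))) (complex.Re (c * (h i (x%:C * z) * z))).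
  move=> /andP[x0 _].
  have := @cderiv_line R F 0 z c (h i (x%:C * z) * 1) x; rewrite add0r => /(_ (cderiv_chen holh i [::] zP (xP _ x0))).
  rewrite mulr1; congr is_derive; apply/funext => y; by rewrite add0r.
have cF (c : R[i]) (x : R) : 0 < x <= 1 -> {for x, continuous (fun y : R => complex.Re (c * (h i (y%:C * z) * z)))}.
  move=> /andP[x0 _].
  have := @ccont_line R (h i) 0 z (c * z) x; rewrite add0r => /(_ (hol_ccont (holh i) (xP _ x0))).
  apply: continuous_for_ext => y; by rewrite add0r mulrAC mulrA.
have rot (u : R[i]) : complex.Re ((0 -i* 1) * u) = complex.Im u.
  by rewrite cReM /= mul0r sub0r mulN1r opprK.
have zz : z^-1 * z = 1 by rewrite mulVf.
have K0 : 0 < cmod z by rewrite cmod_gt0.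
have e2 : 0 < e / (2 * cmod z) by rewrite divr_gt0// mulr_gt0.
(* Along the ray the primitive has derivative [h i (x z) z], whereas integrability is known without
   the factor [z]; it is divided out inside the linear form [c]. *)
have ireE : (fun x : R => (complex.Re (h i (seg_param 0 z x)))%:E) =
    EFin \o (fun x : R => complex.Re (z^-1 * (h i (x%:C * z) * z))).
  by apply/funext => x /=; rewrite param [z^-1 * _]mulrC mulfK.
have iimE : (fun x : R => (complex.Im (h i (seg_param 0 z x)))%:E) =
    EFin \o (fun x : R => complex.Re ((0 -i* 1) * z^-1 * (h i (x%:C * z) * z))).
  apply/funext => x /=; rewrite param [h i _ * _]mulrC -!mulrA mulKf//.
  by rewrite cReM /= mul0r sub0r mulN1r opprK.
rewrite ireE in ire; rewrite iimE in iim.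
have [d1 d10 H1] := FTC_improper ire (dF _) (cF _) e2.
have [d2 d20 H2] := FTC_improper iim (dF _) (cF _) e2.
exists (Num.min d1 d2); first by rewrite lt_min d10.
move=> a /andP[a0]; rewrite lt_min => /andP[ad1 ad2] a1.
have := H1 a; rewrite a0 ad1 => /(_ isT a1) {}H1.
have := H2 a; rewrite a0 ad2 => /(_ isT a1) {}H2.
have E : G [:: i] z (a%:C * z) = F (1%:C * z) - F (a%:C * z).
  rewrite mul1r /F (@chen_int1D i z (a%:C * z) z)//; last exact: xP.
  by rewrite addrK.
rewrite E seg_intE subr0.
have -> : F (1%:C * z) - F (a%:C * z) = z * (z^-1 * (F (1%:C * z) - F (a%:C * z))) by rewrite mulVKf.
rewrite -mulrBr cmodM mulrC -ler_pdivlMr//.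
rewrite (le_trans (cmod_le_ReIm _))//.
have -> : e / cmod z = e / (2 * cmod z) + e / (2 * cmod z) by field; rewrite gt_eqF.
apply: lerD.
  apply: le_trans H1; rewrite le_eqVlt; apply/orP; left; apply/eqP; congr `|_|.
  rewrite cReB mulrBr cReB; congr (_ - _) => /=.
  by apply: eq_Rintegral => x _; rewrite param [in RHS]mulrC mulfK.
apply: le_trans H2; rewrite le_eqVlt; apply/orP; left; apply/eqP; congr `|_|.
rewrite cImB mulrBr cImB -!mulrA; congr (_ - _) => /=.
  by rewrite !rot.
by apply: eq_Rintegral => x _; rewrite param [h i _ * _]mulrC -!mulrA mulKf// rot.
Qed.

Variables (X : R[i] -> R[i]) (i : I) (g : R).
Hypothesis g01 : 0 < g <= 1.
Hypothesis hX : forall z, upper_half z ->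
  seg_integrable (h i) 0 z /\ X z = seg_int (h i) 0 z.
Hypothesis hB : forall N : nat, exists2 M : R, 0 <= M & forall i z,
  `|complex.Re z| <= N%:R -> 0 < complex.Im z <= N%:R ->
  cmod (h i z) <= M * complex.Im z `^ (g - 1).

(* The iterated integrals from [a z'] to [a z] are Hoelder, hence vanish with [a]. *)
Lemma primitive_increment z z' : upper_half z -> upper_half z' -> X z - X z' = G [:: i] z z'.
Proof.
move=> zP zP'; apply/eqP; rewrite -subr_eq0; apply/eqP/cmod_small0 => e e0.
have g0 : 0 < g by case/andP: g01.
have [zi zE] := hX zP; have [zi' zE'] := hX zP'.
pose N := (Num.truncn (3 * (cmod z + cmod z'))).+1.
have NE : 3 * (cmod z + cmod z') <= N%:R by rewrite ltW// truncnS_gt.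
have [M M0 HM] := hB N.
pose K := 6 * M / g * cmod (z - z') `^ g + 1.
have K0 : 0 < K by rewrite ltr_wpDl// mulr_ge0 ?powR_ge0// divr_ge0 ?mulr_ge0// ltW.
have e3 : 0 < e / 3 by rewrite divr_gt0.
have [d1 d10 H1] := chen_int1_improper zP zi e3.
have [d2 d20 H2] := chen_int1_improper zP' zi' e3.
have eK : 0 < e / 3 / K by rewrite divr_gt0.
have [d3 d30 H3] := powR_small g0 eK.
pose a := Num.min (Num.min (d1 / 2) (d2 / 2)) (Num.min d3 (1 / 2)).
have a0 : 0 < a by rewrite !lt_min !divr_gt0// d30.
have al : [/\ a <= d1 / 2, a <= d2 / 2, a <= d3 & a <= 1 / 2].
  by split; rewrite /a !ge_min lexx ?orbT.
have [a1 a2 a3 a4] := al.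
have := H1 a; rewrite a0 => {}H1.
have := H2 a; rewrite a0 => {}H2.
have := H3 a; rewrite (ltW a0) a3 => /(_ isT) {}H3.
have {}H1 : cmod (G [:: i] z (a%:C * z) - X z) <= e / 3 by rewrite zE; apply: H1; lra.
have {}H2 : cmod (G [:: i] z' (a%:C * z') - X z') <= e / 3 by rewrite zE'; apply: H2; lra.
have aP u : upper_half u -> upper_half (a%:C * u).
  by move=> uP; rewrite /upper_half /= Im_real_mul mulr_gt0.
have ac u : cmod (a%:C * u) <= cmod u.
  by rewrite cmodM cmod_real gtr0_norm// ler_piMl ?cmod_ge0//; lra.
have cz := cmod_ge0 z; have cz' := cmod_ge0 z'; have az := ac z; have az' := ac z'.
have H : cmod (G [:: i] (a%:C * z) (a%:C * z')) <= e / 3.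
  have rz : cmod (a%:C * z) <= N%:R / 3 by move: NE az cz'; move: (N%:R) => N' *; lra.
  have rz' : cmod (a%:C * z') <= N%:R / 3 by move: NE az' cz; move: (N%:R) => N' *; lra.
  have := @chen_bound R I h holh M g M0 g01 N%:R [:: i] (a%:C * z') (a%:C * z) (aP _ zP') (aP _ zP) rz' rz HM.
  move/le_trans; apply; rewrite [size _]/= expr1 -mulrBr cmodM cmod_real gtr0_norm//.
  rewrite powRM ?(ltW a0) ?cmod_ge0// mulrCA.
  have Kg0 : 0 <= 6 * M / g * cmod (z - z') `^ g.
    by rewrite mulr_ge0 ?powR_ge0// divr_ge0 ?mulr_ge0// ltW.
  rewrite (le_trans (ler_wpM2r Kg0 H3))// -[_ / K * _]mulrA ler_piMr ?(ltW e3)//.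
  by rewrite mulrC ler_pdivrMr// mul1r /K lerDl.
(* The path from [z'] to [z] goes through [a z'] and [a z]; the two radial pieces approximate [X z']
   and [X z]. *)
have -> : X z - X z' - G [:: i] z z' =
    - (G [:: i] z (a%:C * z) - X z) - G [:: i] (a%:C * z) (a%:C * z')
    + (G [:: i] z' (a%:C * z') - X z').
  rewrite (chen_int1D i zP (aP _ zP) zP') (chen_int1D i (aP _ zP) (aP _ zP') zP').
  have := chen_int1D i zP' (aP _ zP') zP'; rewrite chen_diag => /esym/eqP; rewrite addr_eq0 => /eqP ->.
  ring.
rewrite (le_trans (cmodD _ _))// (_ : e = e / 3 + e / 3 + e / 3); last by field.
rewrite lerD// (le_trans (cmodB _ _))// lerD// cmodN//.
Qed.

Lemma cderiv_primitive z : upper_half z -> cderiv X z (h i z).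
Proof.
move=> zP.
have iP : upper_half ('i : R[i]) by rewrite /upper_half /= ltr01.
have := cderivD (cderiv_cst (X 'i) z) (cderiv_chen holh i [::] iP zP).
rewrite mulr1 add0r; apply: cderiv_near zP _ => u uz.
by rewrite -primitive_increment ?subrKC//; exact: upper_half_ball.
Qed.

End ImproperPrimitive.

Lemma shuffles_cons (B : Type) (i j : B) (s t : seq B) : shuffles (i :: s) (j :: t) =
  [seq i :: l | l <- shuffles s (j :: t)] ++ [seq j :: l | l <- shuffles (i :: s) t].
Proof. by []. Qed.

(** * Shuffles *)

Section ShuffleLists.
Variables (A : eqType).
Implicit Types (w v l : seq A).

Lemma map_shuffles (B : Type) (f : A -> B) w v :
  shuffles (map f w) (map f v) = [seq map f l | l <- shuffles w v].
Proof.
elim: w v => [|i w IHw] v; first by case: v.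
elim: v => [|j v IHv] //.
rewrite shuffles_cons map_cat -!map_comp ![map f (_ :: _)]/= shuffles_cons.
by rewrite -[f j :: _]/(map f (j :: v)) IHw -[f i :: _]/(map f (i :: w)) IHv -!map_comp.
Qed.

Variable p : pred A.

(** When [p] tells the letters of [w] from those of [v], a shuffle is recognized by its two
    subwords, and each occurs once in the list. *)
Lemma mem_shuffles w v l : all p w -> all (predC p) v ->
  (l \in shuffles w v) = (seq.filter p l == w) && (seq.filter (predC p) l == v).
Proof.
elim: w v l => [|i w IHw] v l.
  move=> _ pv; have -> : shuffles [::] v = [:: v] by case: v {pv}.
  rewrite inE; apply/eqP/andP => [->|[/eqP fl /eqP <-]].
    split; last by apply/eqP/all_filterP.
    rewrite -size_eq0 size_filter -leqn0 leqNgt -has_count -all_predC.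
    exact: pv.
  apply/esym/all_filterP; rewrite all_predC has_count -size_filter fl //.
rewrite [all p (i :: w)]/= => /andP[pi pw]; elim: v l => [|j v IHv] l.
  move=> _; rewrite inE; apply/eqP/andP => [->|[/eqP fl /eqP fl']].
    rewrite /= pi /=; split; first by apply/eqP; congr cons; apply/all_filterP.
    rewrite -size_eq0 size_filter -leqn0 leqNgt -has_count -all_predC.
    by apply: sub_all pw => x /=; rewrite negbK.
  rewrite -fl; apply/esym/all_filterP.
  have : all (predC (predC p)) l by rewrite all_predC has_count -size_filter fl'.
  by apply: sub_all => x /=; rewrite negbK.
move=> pv'; have /andP[pj pv] : ~~ p j && all (predC p) v := pv'.
rewrite shuffles_cons mem_cat; case: l => [|x l].
  rewrite [RHS]/=; apply/negbTE; rewrite negb_or; apply/andP; split; apply/mapP; by case.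
have inj (y : A) : injective (cons y) by move=> ? ? [].
have mem_cons (y : A) s : (x :: l \in [seq y :: l' | l' <- s]) = (x == y) && (l \in s).
  apply/mapP/andP => [[l' l's [-> ->]]|[/eqP -> ls]]; first by rewrite eqxx.
  by exists l.
rewrite !mem_cons IHw//= IHv//.
case px : (p x) => /=.
  have -> : (x == j) = false by apply/negbTE/eqP => xj; move: pj; rewrite -xj px.
  by rewrite orbF eqseq_cons andbA.
have -> : (x == i) = false by apply/negbTE/eqP => xi; move: pi; rewrite -xi px.
by rewrite eqseq_cons /= andbCA.
Qed.

Lemma uniq_shuffles w v : all p w -> all (predC p) v -> uniq (shuffles w v).
Proof.
elim: w v => [|i w IHw] v; first by case: v.
rewrite [all p (i :: w)]/= => /andP[pi pw]; elim: v => [|j v IHv] //.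
move=> pv'; have /andP[pj pv] : ~~ p j && all (predC p) v := pv'.
rewrite shuffles_cons cat_uniq !map_inj_uniq ?IHw ?IHv//; try by move=> ? ? [].
rewrite andbT /=; apply/hasPn => _ /mapP[l _ ->]; apply/mapP => -[l' _ [ij _]].
by move: pj; rewrite ij pi.
Qed.

End ShuffleLists.

(** * Shuffles of words and shuffle permutations *)

Section ShufflePermutations.
Variables (k m : nat).
Local Notation N := (k + m)%N.

(** The permuted identity tuple, as a word of positions: it lists the positions in increasing order
    of their images under [sg]. *)
Let word (sg : 'S_N) : seq 'I_N := [seq (sg^-1)%g q | q <- enum 'I_N].
Let p (x : 'I_N) := (x < k)%N.
Let w0 := [seq lshift m a | a <- enum 'I_k].
Let v0 := [seq rshift k b | b <- enum 'I_m].

Let sorted_enum n : sorted (fun a b : 'I_n => (a < b)%N) (enum 'I_n).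
Proof. by have := iota_ltn_sorted 0 n; rewrite -val_enum_ord sorted_map. Qed.

Let pw0 : all p w0. Proof. by apply/allP => _ /mapP[a _ ->]; rewrite /p /=. Qed.
Let pv0 : all (predC p) v0.
Proof. by apply/allP => _ /mapP[a _ ->]; rewrite /p /= -leqNgt leq_addr. Qed.

Let word_sorted (sg : 'S_N) : sorted (fun x y : 'I_N => (sg x < sg y)%N) (word sg).
Proof.
rewrite /word sorted_map; apply: sub_sorted (sorted_enum N) => a b /=.
by rewrite !permKV.
Qed.

Let lt_trans (T : Type) (f : T -> nat) : transitive (fun x y => (f x < f y)%N).
Proof. by move=> y x z; apply: ltn_trans. Qed.

Let mem_word (sg : 'S_N) x : x \in word sg.
Proof. by apply/mapP; exists (sg x); rewrite ?mem_enum// permK. Qed.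

(** The selected part of [word sg] is sorted for the order of the images. It is the increasing list
    [s] of the same elements precisely when [sg] is increasing on them. *)
Let part_sorted (sg : 'S_N) (q : pred 'I_N) (s : seq 'I_N) :
  sorted (fun x y : 'I_N => (x < y)%N) s -> (forall x, (x \in s) = q x) ->
  (seq.filter q (word sg) == s) =
  [forall x : 'I_N, forall y : 'I_N, [&& q x, q y & (x < y)%N] ==> (sg x < sg y)%N].
Proof.
move=> ss sq; apply/eqP/forallP => [fs x|H].
  apply/forallP => y; apply/implyP => /and3P[qx qy xy].
  have : sorted (fun x y : 'I_N => (sg x < sg y)%N) s.
    by rewrite -fs sorted_filter//; exact: lt_trans.
  move=> s2; rewrite ltnNge leq_eqVlt; apply/negP => /orP[|yx].
    by move=> /eqP /val_inj /perm_inj yx; move: xy; rewrite yx ltnn.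
  have xs : x \in s by rewrite sq.
  have ys : y \in s by rewrite sq.
  have [|ixy] := leqP (index y s) (index x s).
    rewrite leq_eqVlt => /orP[/eqP iyx|iyx].
      by move: xy; rewrite -(nth_index x xs) -iyx nth_index// ltnn.
    have := @sorted_ltn_nth _ _ (lt_trans (f := fun x : 'I_N => val x)) x s ss (index y s) (index x s).
    rewrite !inE !index_mem ys xs => /(_ isT isT iyx); rewrite !nth_index//= => yx'.
    by move: (ltn_trans yx' xy); rewrite ltnn.
  have := @sorted_ltn_nth _ _ (lt_trans (f := fun x : 'I_N => val (sg x))) x s s2 (index x s) (index y s).
  rewrite !inE !index_mem ys xs => /(_ isT isT ixy); rewrite !nth_index//= => xy'.
  by move: (ltn_trans yx xy'); rewrite ltnn.
apply: (@irr_sorted_eq _ (fun x y : 'I_N => (x < y)%N)) => //.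
- by move=> x /=; rewrite ltnn.
- apply: (@sub_in_sorted _ q (fun x y : 'I_N => (sg x < sg y)%N)).
  + move=> x y qx qy sxy; rewrite ltnNge leq_eqVlt; apply/negP => /orP[/eqP /val_inj yx|yx].
      by move: sxy; rewrite yx ltnn.
    have /forallP /(_ x) /implyP := H y; rewrite (qx : q x) (qy : q y) yx => /(_ isT) yx'.
    by move: (ltn_trans sxy yx'); rewrite ltnn.
  + by apply/allP => x; rewrite mem_filter => /andP[].
  + by apply: sorted_filter => //; exact: lt_trans.
- by move=> x; rewrite mem_filter mem_word andbT sq.
Qed.

Let mem_w0 x : (x \in w0) = p x.
Proof.
apply/mapP/idP => [[a _ ->]|px]; first by rewrite /p /=.
by exists (Ordinal px); rewrite ?mem_enum//; apply: val_inj.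
Qed.

Let mem_v0 x : (x \in v0) = predC p x.
Proof.
apply/mapP/idP => [[a _ ->]|]; first by rewrite /p /= -leqNgt leq_addr.
rewrite /p /= -leqNgt => kx.
have xm : (x - k < m)%N by rewrite ltn_subLR.
by exists (Ordinal xm); rewrite ?mem_enum//; apply: val_inj => /=; rewrite subnKC.
Qed.

Let is_shuffleE (sg : 'S_N) : is_shuffle sg = (word sg \in shuffles w0 v0).
Proof.
rewrite (mem_shuffles _ pw0 pv0) (part_sorted _ _ mem_w0) ?(part_sorted _ _ mem_v0).
- rewrite /is_shuffle; congr (_ && _).
  + apply/'forall_forallP/'forall_forallP => H x y; apply/implyP.
      move=> /and3P[px py xy].
      have := H (Ordinal px) (Ordinal py); rewrite /= xy.
      by congr (is_true (_ < _)%N); congr (val (sg _)); apply: val_inj.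
    move=> xy; have := H (lshift m x) (lshift m y); rewrite /p /= !ltn_ord xy; exact.
  + apply/'forall_forallP/'forall_forallP => H x y; apply/implyP.
      rewrite /p /= -!leqNgt => /and3P[px py xy].
      have xm : (x - k < m)%N by rewrite ltn_subLR.
      have ym : (y - k < m)%N by rewrite ltn_subLR.
      have := H (Ordinal xm) (Ordinal ym); rewrite /= ltn_sub2r ?(leq_ltn_trans px)//=.
      by congr (is_true (_ < _)%N); congr (val (sg _)); apply: val_inj; rewrite /= subnKC.
    move=> xy; have := H (rshift k x) (rshift k y).
    by rewrite /p /= -!leqNgt !leq_addr ltn_add2l xy; exact.
- by rewrite /v0 sorted_map; apply: sub_sorted (sorted_enum m) => a b /=; rewrite ltn_add2l.
- by rewrite /w0 sorted_map; apply: sub_sorted (sorted_enum k) => a b.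
Qed.

Let word_inj : injective word.
Proof.
move=> s1 s2 /eq_in_map H; apply/eqP; rewrite -(inj_eq (@invg_inj _)); apply/eqP/permP => q.
by apply: H; rewrite mem_enum.
Qed.

Let word_surj l : l \in shuffles w0 v0 -> exists sg, word sg = l.
Proof.
rewrite (mem_shuffles _ pw0 pv0) => /andP[/eqP fw /eqP fv].
have pl : perm_eq l (w0 ++ v0) by rewrite -fw -fv perm_sym perm_filterC.
have ul : uniq l.
  rewrite (perm_uniq pl) cat_uniq (map_inj_uniq (@lshift_inj _ _)).
  rewrite (map_inj_uniq (@rshift_inj _ _)) !enum_uniq.
  rewrite /= andbT; apply/hasPn => x; rewrite mem_v0 mem_w0; exact.
have sl : size l = N 
  by rewrite (perm_size pl) size_cat; congr (_ + _)%N; rewrite size_map size_enum_ord.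
(* Reading a word without repetition as a map of positions gives the inverse of the wanted
   permutation. *)
pose f (q : 'I_N) := nth q l q.
have f_inj : injective f.
  move=> q q' /eqP; rewrite /f (set_nth_default q' q) ?sl// nth_uniq ?sl// => /eqP; exact: val_inj.
exists (perm f_inj)^-1%g; rewrite /word invgK.
case E : l => [|x0 l0].
  by apply/eqP; rewrite -size_eq0 size_map size_enum_ord -sl E.
rewrite -E; apply: (@eq_from_nth _ x0) => [|q]; first by rewrite size_map size_enum_ord sl.
rewrite size_map size_enum_ord => qN.
rewrite (nth_map (Ordinal qN)) ?size_enum_ord// permE /f nth_enum_ord//.
by apply: set_nth_default; rewrite sl.
Qed.

(** Letters may repeat in [i] and [j], but positions do not: the bijection is made on words of
    positions and then mapped to letters, which keeps multiplicities. *)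
Lemma sum_is_shuffle (V : nmodType) (A : Type) (F : seq A -> V) (i : k.-tuple A) (j : m.-tuple A) :
  \sum_(sg : 'S_N | is_shuffle sg) F (permute_tuple sg (cat_tuple i j)) =
  \sum_(l <- shuffles i j) F l.
Proof.
set x := cat_tuple i j.
have -> : shuffles i j = [seq map (tnth x) l | l <- shuffles w0 v0].
  rewrite -map_shuffles /w0 /v0 -(map_comp (tnth x) (@lshift k m)) -(map_comp (tnth x) (@rshift k m)).
  congr shuffles.
    rewrite -[in LHS](map_tnth_enum i); apply: eq_map => a /=.
    by rewrite tnth_lshift.
  rewrite -[in LHS](map_tnth_enum j); apply: eq_map => a /=.
  by rewrite tnth_rshift.
rewrite big_map.
have pe : perm_eq [seq word sg | sg <- enum [pred sg | is_shuffle sg]] (shuffles w0 v0).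
  apply: uniq_perm; rewrite ?(uniq_shuffles pw0 pv0)// ?map_inj_uniq ?enum_uniq// => l.
  apply/mapP/idP => [[sg]|ls]; first by rewrite mem_enum inE is_shuffleE => + ->.
  have [sg E] := word_surj ls; exists sg => //.
  by rewrite mem_enum inE is_shuffleE E.
rewrite -(perm_big _ pe) big_map big_enum /=; apply: eq_bigr => sg _; congr F.
by rewrite /permute_tuple /= /word -(map_comp (tnth x) (sg^-1)%g).
Qed.

End ShufflePermutations.

(** * Hoelder norms and Borel measurability *)

Section Functionals.
Variables (R : realType) (d n : nat) (Omega : set R[i]).
Implicit Types (x y : mult_functional R d) (v : seq 'I_d) (s t z : R[i]) (mu c : R).

(** Treats all levels uniformly, words of length one being read on the path component of the
    pair. *)
Definition incr x v t s : R[i] :=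
  if v is [:: i] then x.1 t i - x.1 s i else word_coord x.2 t s v.

Lemma incr_sub x y v t s : incr (mf_sub x y) v t s = incr x v t s - incr y v t s.
Proof.
case: v => [|i [|j v]]; rewrite /incr /word_coord /= !ffunE//; ring.
Qed.

Lemma hoelder_norm_le (I : finType) (h : R[i] -> R[i] -> {ffun I -> R[i]}) mu c : 0 <= c ->
  (forall t s i, Omega t -> Omega s -> cmod (h t s i) <= c * cmod (t - s) `^ mu) ->
  (hoelder_norm mu Omega h <= c%:E)%E.
Proof.
move=> c0 H; apply: ub_ereal_sup => _ [s [t [sO tO st ->]]].
rewrite lee_fin ler_pdivrMr ?powR_gt0 ?cmod_gt0 ?subr_eq0 1?eq_sym//.
rewrite /vnorm; apply: bigmax_le => [|i _]; last exact: H.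
by rewrite mulr_ge0// powR_ge0.
Qed.

(** Two distinct points guard against the supremum of the empty set, which is [-oo]. *)
Lemma hoelder_norm_ge0 (I : finType) (h : R[i] -> R[i] -> {ffun I -> R[i]}) mu :
  (exists s t, [/\ Omega s, Omega t & s != t]) -> (0 <= hoelder_norm mu Omega h)%E.
Proof.
move=> [s [t [sO tO st]]]; apply: ereal_sup_ge; exists (vnorm (h t s) / cmod (t - s) `^ mu)%:E.
  by exists s, t.
rewrite lee_fin divr_ge0 ?powR_ge0// /vnorm.
by elim/big_rec: _ => // i x _ x0; rewrite le_max x0 orbT.
Qed.

Definition incr_bound mu c (Y : seq 'I_d -> R[i] -> R[i] -> R[i]) :=
  forall v t s, (0 < size v <= n)%N -> Omega t -> Omega s ->
    cmod (Y v t s) <= c * cmod (t - s) `^ ((size v)%:R * mu).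

Lemma incr_bound1 mu c x : 0 <= c -> incr_bound mu c (incr x) -> (0 < n)%N ->
  (hoelder_norm mu Omega (delta1 x.1) <= c%:E)%E.
Proof.
move=> c0 H n0; apply: hoelder_norm_le => // t s i tO sO.
have := H [:: i] t s; rewrite /= mul1r n0 => /(_ isT tO sO).
by rewrite /incr /delta1 !ffunE.
Qed.

Lemma incr_tuple x k (i : k.-tuple 'I_d) t s : (2 <= k)%N -> incr x i t s = x.2 k t s i.
Proof.
move=> k2; case: i => -[|a [|b v]] /= sv.
- by exfalso; move: k2; rewrite -(eqP sv).
- by exfalso; move: k2; rewrite -(eqP sv).
have kk : (size v).+2 = k := eqP sv.
by subst k; congr (x.2 _ t s _); exact: val_inj.
Qed.

Lemma incr_bound2 mu c x k : incr_bound mu c (incr x) -> (2 <= k <= n)%N ->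
  forall t s i, Omega t -> Omega s ->
  cmod (x.2 k t s i) <= c * cmod (t - s) `^ (k%:R * mu).
Proof.
move=> H /andP[k2 kn] t s i tO sO; have := H i t s; rewrite size_tuple incr_tuple//.
by rewrite kn (ltnW k2) => /(_ isT tO sO).
Qed.

Lemma mf_norm_le mu c x : 0 <= c -> (0 < n)%N -> incr_bound mu c (incr x) ->
  (mf_norm n mu Omega x <= (n%:R * c)%:E)%E.
Proof.
move=> c0 n0 H; rewrite /mf_norm.
have -> : n%:R * c = c + \sum_(2 <= k < n.+1) c.
  rewrite big_const_nat iter_addr addr0 subSS subn1 -[in LHS](prednK n0).
  by rewrite -natr1 mulrDl mul1r addrC mulr_natl.
rewrite EFinD leeD//; first exact: incr_bound1.
rewrite -sumEFin big_nat [leRHS]big_nat; apply: lee_sum => k k2.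
by apply: hoelder_norm_le => // t s i tO sO; apply: incr_bound2.
Qed.

Lemma mf_space_incr mu c x : 0 <= c -> 0 < mu -> (0 < n)%N -> incr_bound mu c (incr x) ->
  mf_space n mu Omega x.
Proof.
move=> c0 mu0 n0 H; split.
  by apply: le_lt_trans (ltry c); exact: incr_bound1.
move=> k k2; have Hk := incr_bound2 H k2; split; last first.
  by apply: le_lt_trans (ltry c); exact: hoelder_norm_le.
move=> t tO; apply/ffunP => i; rewrite ffunE; apply: cmod_small0 => e e0.
rewrite (le_trans (Hk t t i tO tO))// subrr cmod0 powR0 ?mulr0 ?(ltW e0)//.
by rewrite gt_eqF// mulr_gt0// ltr0n; lia.
Qed.

Lemma interpolate (x a b th : R) : 0 <= x -> x <= a -> x <= b -> 0 <= th <= 1 ->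
  x <= a `^ th * b `^ (1 - th).
Proof.
move=> x0 xa xb /andP[th0 th1].
have [->|xn] := eqVneq x 0; first by rewrite mulr_ge0 ?powR_ge0.
have -> : x = x `^ th * x `^ (1 - th).
  rewrite -powRD ?subrKC ?powRr1//.
  by apply/implyP => _; rewrite xn.
by apply: ler_pM; rewrite ?powR_ge0//; apply: ge0_ler_powR;
  rewrite ?nnegrE ?subr_ge0 ?(le_trans x0 xa) ?(le_trans x0 xb).
Qed.

Definition incr_modulus g c (Y : seq 'I_d -> R[i] -> R[i] -> R[i]) :=
  forall v t t' s s', (0 < size v <= n)%N -> Omega t -> Omega t' -> Omega s -> Omega s' ->
    cmod (Y v t s - Y v t' s') <= c * (cmod (t - t') `^ g + cmod (s - s') `^ g).

(** Interpolation between the [g]-Hoelder bound and a uniform bound [b]: the constant for [gam]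
    tends to [0] with [b]. *)
Lemma incr_bound_interpolate g gam c b Y : 0 < gam < g -> 0 <= c ->
  incr_bound g c Y ->
  (forall v t s, (0 < size v <= n)%N -> Omega t -> Omega s -> cmod (Y v t s) <= b) ->
  incr_bound gam (c `^ (gam / g) * b `^ (1 - gam / g)) Y.
Proof.
move=> /andP[gam0 gamg] c0 H Hb v t s vn tO sO.
have g0 : 0 < g := lt_trans gam0 gamg.
have th : 0 <= gam / g <= 1 
  by rewrite divr_ge0 ?(ltW gam0) ?(ltW g0)//= ler_pdivrMr// mul1r ltW.
apply: (le_trans (interpolate (cmod_ge0 _) (H v t s vn tO sO) (Hb v t s vn tO sO) th)).
rewrite powRM ?powR_ge0// -powRrM le_eqVlt; apply/orP; left; apply/eqP.
rewrite (_ : (size v)%:R * g * (gam / g) = (size v)%:R * gam); first by ring.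
by field; rewrite gt_eqF.
Qed.

Lemma incr_bound_widen g gam r : 0 < gam < g -> (forall z, Omega z -> cmod z <= r) ->
  exists2 L, 0 <= L & forall c Y, 0 <= c -> incr_bound g c Y -> incr_bound gam (L * c) Y.
Proof.
move=> gg Or; have [gam0 gamg] := andP gg; have g0 : 0 < g := lt_trans gam0 gamg.
(* Distances are at most [1 + 2 |r|], and as this is at least [1] its power [n g] serves all
   levels. *)
exists (((1 + 2 * `|r|) `^ (n%:R * g)) `^ (1 - gam / g)); first exact: powR_ge0.
move=> c Y c0 H.
have -> : ((1 + 2 * `|r|) `^ (n%:R * g)) `^ (1 - gam / g) * c =
    c `^ (gam / g) * (c * (1 + 2 * `|r|) `^ (n%:R * g)) `^ (1 - gam / g).
  rewrite powRM ?powR_ge0// mulrA mulrC; congr (_ * _).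
  have [->|cn] := eqVneq c 0.
    by rewrite powR0 ?mul0r// gt_eqF// divr_gt0.
  by rewrite -powRD ?subrKC ?powRr1//; apply/implyP => _; rewrite cn.
apply: (incr_bound_interpolate gg c0 H) => v t s vn tO sO.
rewrite (le_trans (H v t s vn tO sO))// ler_wpM2l//.
have [_ vn'] := andP vn.
have rr := ler_norm r; have rn := normr_ge0 r.
apply: (@le_trans _ _ ((1 + 2 * `|r|) `^ ((size v)%:R * g))).
  apply: ge0_ler_powR; rewrite ?nnegrE ?cmod_ge0 ?mulr_ge0 ?(ltW g0)// ?addr_ge0 ?mulr_ge0//.
  rewrite (le_trans (cmodB _ _))//; have := Or _ tO; have := Or _ sO.
  by move=> ? ?; lra.
by rewrite ler_powR ?lerDl ?mulr_ge0// ler_wpM2r ?(ltW g0)// ler_nat.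
Qed.

(** The plane is cut into squares of side [eta / 2], and one point of [Omega] is picked in each
    square that meets it; for the other squares the default value [0] is also in [Omega]. *)
Lemma bounded_net (r eta : R) : Omega 0 -> (forall z, Omega z -> cmod z <= r) -> 0 < eta ->
  exists2 S : seq R[i], forall z, z \in S -> Omega z &
    forall z, Omega z -> exists2 p, p \in S & cmod (z - p) <= eta.
Proof.
move=> O0 Or eta0; pose l := eta / 2; have l0 : 0 < l by rewrite divr_gt0.
have r0 : 0 <= r by have := Or _ O0; rewrite cmod0.
pose cell (a b : nat) : set R[i] := [set z | Omega z /\
  (a%:R * l <= complex.Re z + r <= a.+1%:R * l) /\ (b%:R * l <= complex.Im z + r <= b.+1%:R * l)].
pose L := (Num.truncn (2 * r / l)).+1.
exists [seq xget 0 (cell a b) | a <- iota 0 L, b <- iota 0 L].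
  by move=> z /allpairsP[[a b] /= [_ _ ->]]; case: xgetP => [y _ [] //|_].
move=> z zO.
pose a := Num.truncn ((complex.Re z + r) / l); pose b := Num.truncn ((complex.Im z + r) / l).
have := le_trans (cmod_Re z) (Or _ zO); rewrite ler_norml => /andP[x1 x2].
have := le_trans (cmod_Im z) (Or _ zO); rewrite ler_norml => /andP[y1 y2].
have tr (u : R) : - r <= u -> u <= r -> (Num.truncn ((u + r) / l) < L)%N /\
    (Num.truncn ((u + r) / l))%:R * l <= u + r <= (Num.truncn ((u + r) / l)).+1%:R * l.
  move=> u1 u2; have u0 : 0 <= (u + r) / l by rewrite divr_ge0 ?(ltW l0)//; lra.
  split; first by rewrite ltnS le_truncn// ler_wpM2r ?invr_ge0 ?(ltW l0)//; lra.
  apply/andP; split; first by rewrite -ler_pdivlMr// truncn_le.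
  by rewrite -ler_pdivrMr// ltW// truncnS_gt.
have [aL ax] := tr _ x1 x2; have [bL bx] := tr _ y1 y2.
exists (xget 0 (cell a b)).
  by apply/allpairsP; exists (a, b); rewrite !mem_iota /= !add0n.
case: xgetP => [p _ [_ [pa pb]]|/(_ z)]; last by case.
rewrite (le_trans (cmod_le_ReIm _))// cReB cImB (_ : eta = l + l); last by rewrite /l; field.
move: pa pb ax bx; rewrite -!natr1 -/a -/b !mulrDl !mul1r.
move: (a%:R * l) (b%:R * l) => al bl /andP[? ?] /andP[? ?] /andP[? ?] /andP[? ?].
by apply: lerD; rewrite ler_norml; apply/andP; split; lra.
Qed.

End Functionals.

Section Words.
Variables d n : nat.

Definition words : seq (seq 'I_d) :=
  flatten [seq [seq tval u | u <- enum {: k.-tuple 'I_d}] | k <- iota 0 n.+1].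

Lemma mem_words (v : seq 'I_d) : (size v <= n)%N -> v \in words.
Proof.
move=> vn; apply/flattenP; exists [seq tval u | u <- enum {: (size v).-tuple 'I_d}].
  by apply/mapP; exists (size v) => //; rewrite mem_iota add0n.
by apply/mapP; exists (in_tuple v) => //; rewrite mem_enum.
Qed.

End Words.

(** * Measurability of preimages of open sets of functionals *)

Section BorelMeasurability.
Context {R : realType} {disp : measure_display} {T : measurableType disp}.
Variables (P : probability T R) (d n : nat) (Omega : set R[i]).
Hypothesis P_complete : measure_is_complete P.
Variables (X : T -> mult_functional R d) (D : set T) (K : T -> R) (g gam r : R).
Hypotheses (Dneg : P.-negligible (~` D)) (n0 : (0 < n)%N) (gg : 0 < gam < g).
Hypotheses (O0 : Omega 0) (Or : forall z, Omega z -> cmod z <= r).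
Hypotheses (K0 : forall w, D w -> 0 <= K w) (mK : measurable_fun D K).
Hypothesis XK : forall w, D w -> incr_bound n Omega g (K w) (incr (X w)).
Hypothesis XKm : forall w, D w -> incr_modulus n Omega g (K w) (incr (X w)).
Hypothesis mX : forall v t s, (0 < size v <= n)%N -> Omega t -> Omega s ->
  measurable_fun D (fun w => complex.Re (incr (X w) v t s)) /\
  measurable_fun D (fun w => complex.Im (incr (X w) v t s)).

Let mD : measurable D.
Proof. by rewrite -[D]setCK; apply: measurableC; exact: P_complete. Qed.

Let idx := (seq 'I_d * R[i] * R[i])%type.
Let ok (a : idx) := (0 < size a.1.1 <= n)%N /\ Omega a.1.2 /\ Omega a.2.
Let step (j : nat) : R := j.+1%:R.
Let cell j (a : idx) (w : T) : int * int :=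
  (Num.floor (complex.Re (incr (X w) a.1.1 a.1.2 a.2) * step j),
   Num.floor (complex.Im (incr (X w) a.1.1 a.1.2 a.2) * step j)).

Let measurable_floor_fiber (f : T -> R) (c : int) : measurable_fun D f ->
  measurable (D `&` [set w | Num.floor (f w) = c]).
Proof.
move=> mf; have := mf mD [set` `[(c%:~R : R), (c + 1)%:~R[] (measurable_itv _).
congr measurable; apply/seteqP; split=> w /= [Dw].
  rewrite in_itv /= => H; split => //; exact: floor_def.
move=> <-; split => //; rewrite in_itv /=; exact: floor_itv.
Qed.

Let measurable_cell j a c : ok a -> measurable (D `&` [set w | cell j a w = c]).
Proof.
move=> [vn [tO sO]]; have [mre mim] := mX vn tO sO.
have ms : measurable_fun D (fun=> step j) by exact: measurable_cst.
have := measurableI _ _ (measurable_floor_fiber c.1 (measurable_funM mre ms))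
  (measurable_floor_fiber c.2 (measurable_funM mim ms)).
congr measurable; apply/seteqP; split=> w /=.
  by move=> [[Dw H1] [_ H2]]; split => //; rewrite /cell H1 H2; case: (c).
by move=> [Dw H]; rewrite -H.
Qed.

Let measurable_cells j (s : seq idx) c : (forall a, a \in s -> ok a) ->
  measurable (D `&` [set w | [seq cell j a w | a <- s] = c]).
Proof.
elim: s c => [|a s IH] c sok.
  case: c => [|x c].
    by rewrite (_ : [set w | _] = setT) ?setIT//; apply/seteqP; split.
  by rewrite (_ : [set w | _] = set0) ?setI0//; apply/seteqP; split.
case: c => [|x c].
  by rewrite (_ : [set w | _] = set0) ?setI0//; apply/seteqP; split.
have mc := measurable_cell j x (sok a (mem_head _ _)).
have ms : measurable (D `&` [set w | [seq cell j a w | a <- s] = c]).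
  by apply: IH => b bs; apply: sok; rewrite inE bs orbT.
have := measurableI _ _ mc ms; congr measurable; apply/seteqP; split=> w /=.
  by move=> [[Dw ->] [_ ->]].
by move=> [Dw [-> ->]].
Qed.

Let cell_close j a w w' : cell j a w = cell j a w' ->
  cmod (incr (X w) a.1.1 a.1.2 a.2 - incr (X w') a.1.1 a.1.2 a.2) <= 2 / step j.
Proof.
have s0 : 0 < step j by rewrite ltr0Sn.
have fl (x y : R) : Num.floor (x * step j) = Num.floor (y * step j) -> `|x - y| <= 1 / step j.
  move=> H; rewrite ler_pdivlMr// -[X in _ * X]ger0_norm ?(ltW s0)// -normrM mulrBl.
  have /andP[x1 x2] := floor_itv (x * step j).
  have /andP[y1 y2] := floor_itv (y * step j).
  move: x1 x2 y1 y2; rewrite H intrD; move: (_ * _) (_ * _) => u v *.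
  by rewrite ler_norml; apply/andP; split; lra.
move=> [/fl H1 /fl H2]; rewrite (le_trans (cmod_le_ReIm _))// cReB cImB.
by rewrite (le_trans (lerD H1 H2))// -mulrDl.
Qed.

(* Up to null events, the law of [X] is carried by the sets [K <= N], on which finitely
   many cells of the values at a net determine [X] up to a small error: this makes the
   preimage of an open set a countable union of measurable sets. *)
Lemma measurable_preimage_open U : mf_open n gam Omega U -> measurable (X @^-1` U).
Proof.
move=> [Usub Uopen].
have /boolp.choice[S HS] : forall j : nat, exists S : seq R[i], (forall z, z \in S -> Omega z) /\
    forall z, Omega z -> exists2 p, p \in S & cmod (z - p) <= (step j)^-1.
  move=> j; have [|S S1 S2] := @bounded_net R Omega r (step j)^-1 O0 Or.
    by rewrite invr_gt0 ltr0Sn.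
  by exists S.
pose tests j : seq idx := [seq (vt, s) | vt <- [seq (v, t) | v <- [seq v <- words d n | (0 < size v <= n)%N], t <- S j], s <- S j].
have tests_ok j a : a \in tests j -> ok a.
  move=> /allpairsP[[vt s] /= [/allpairsP[[v t] /= [vw tS ->]] sS ->]].
  by move: vw; rewrite mem_filter => /andP[vn _]; do !split => //=; apply: (HS j).1.
have mem_tests j v t s : (0 < size v <= n)%N -> t \in S j -> s \in S j -> (v, t, s) \in tests j.
  move=> vn tS sS; apply/allpairsP; exists ((v, t), s); split=> //=.
  apply/allpairsP; exists (v, t); split=> //=; rewrite mem_filter vn mem_words//.
  by case/andP: vn.
pose code j w := [seq cell j a w | a <- tests j].
pose A N := [set w | D w /\ K w <= N%:R].
(* A property of the code alone, which need not be decided measurably: it only selects which of the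
   countably many measurable pieces enter the union. *)
pose good N j (c : seq (int * int)) := forall w, A N w -> code j w = c -> U (X w).
have close_code w : D w -> U (X w) -> forall N, A N w -> exists j, good N j (code j w).
  move=> Dw UX N Aw; have [rr rr0 Hr] := Uopen _ UX.
  have [gam0 gamg] := andP gg; have g0 : 0 < g := lt_trans gam0 gamg.
  pose th := gam / g; have th1 : 0 < 1 - th by rewrite subr_gt0 ltr_pdivrMr// mul1r.
  pose C := (2 * N%:R : R) `^ th; have C0 : 0 <= C by exact: powR_ge0.
  have nR : 0 < n%:R :> R by rewrite ltr0n.
  (* Chosen so that the norm bound [n C b^(1 - th)] is at most [rr / 2]; the [+ 1] avoids dividing
     by zero when [N = 0]. *)
  have e10 : 0 < rr / (2 * (n%:R * (C + 1))).
    by rewrite divr_gt0// !mulr_gt0// ltr_wpDl.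
  have [dl dl0 Hdl] := powR_small th1 e10.
  have N4 : 0 < 4 * N%:R + 1 :> R by rewrite ltr_wpDl// mulr_ge0.
  have e20 : 0 < dl / 2 / (4 * N%:R + 1) by rewrite !divr_gt0.
  have [dl' dl'0 Hdl'] := powR_small g0 e20.
  have m0 : 0 < Num.min dl' (dl / 4) by rewrite lt_min dl'0 divr_gt0.
  have [j0 Hj0] := invS_small m0; exists j0.
  have := Hj0 _ (leqnn _); rewrite -/(step j0) le_min => /andP[j1 j2].
  have s0 : 0 < (step j0)^-1 by rewrite invr_gt0 ltr0Sn.
  (* Uniform distance of two functionals with the same code: the diameter of a cell, plus the
     oscillation of both between a point and the net. *)
  pose b := 2 / step j0 + 4 * N%:R * (step j0)^-1 `^ g.
  have b0 : 0 <= b by rewrite addr_ge0 ?mulr_ge0 ?(ltW s0) ?powR_ge0.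
  have bdl : b <= dl.
    have /Hdl' : 0 <= (step j0)^-1 <= dl' by rewrite (ltW s0).
    rewrite ler_pdivlMr// => H.
    have p0 := powR_ge0 (step j0)^-1 g.
    have : 4 * N%:R * (step j0)^-1 `^ g <= dl / 2.
      by apply: le_trans H; rewrite mulrC ler_wpM2l// lerDl.
    have : 2 / step j0 <= dl / 2 by move: j2; move: (step j0)^-1 => x; lra.
    rewrite /b; move: (2 / _) (_ * _ `^ _) => x y; lra.
  move=> w' [Dw' Kw'] cw; have [_ Kw] := Aw.
  have K0' := K0 Dw'.
  have XK' v t s : (0 < size v <= n)%N -> Omega t -> Omega s ->
      cmod (incr (mf_sub (X w') (X w)) v t s) <= b.
    move=> vn tO sO; rewrite incr_sub.
    have [p pS tp] := (HS j0).2 _ tO; have [q qS sq] := (HS j0).2 _ sO.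
    have pO := (HS j0).1 _ pS; have qO := (HS j0).1 _ qS.
    have cl := @cell_close j0 (v, p, q) w' w.
    have /cl /= {}cl : cell j0 (v, p, q) w' = cell j0 (v, p, q) w.
      by move/eq_in_map : cw; apply; exact: mem_tests.
    have gl (x : R) : 0 <= x -> x <= (step j0)^-1 -> x `^ g <= (step j0)^-1 `^ g.
      by move=> x0 xs; apply: ge0_ler_powR; rewrite ?nnegrE ?(ltW g0) ?(ltW s0).
    have B z : D z -> K z <= N%:R -> cmod (incr (X z) v t s - incr (X z) v p q) <= 2 * N%:R * (step j0)^-1 `^ g.
      move=> Dz Kz; rewrite (le_trans (XKm Dz vn tO pO sO qO))//.
      have g1 := gl _ (cmod_ge0 _) tp; have g2 := gl _ (cmod_ge0 _) sq.
      rewrite (le_trans (ler_pM (K0 Dz) _ Kz (lerD g1 g2))) ?addr_ge0 ?powR_ge0//.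
      by rewrite -mulr2n -[_ *+ 2]mulr_natl mulrCA mulrA.
    have B1 := B _ Dw' Kw'; have B2 := B _ Dw Kw.
    have -> : incr (X w') v t s - incr (X w) v t s = (incr (X w') v p q - incr (X w) v p q)
       + ((incr (X w') v t s - incr (X w') v p q) - (incr (X w) v t s - incr (X w) v p q)) by ring.
    rewrite (le_trans (cmodD _ _))// /b lerD// (le_trans (cmodB _ _))//.
    rewrite (le_trans (lerD B1 B2))// le_eqVlt; apply/orP; left; apply/eqP; ring.
  have XK2 : incr_bound n Omega g (2 * N%:R) (incr (mf_sub (X w') (X w))).
    move=> v t s vn tO sO; rewrite incr_sub (le_trans (cmodB _ _))//.
    rewrite mulr2n !mulrDl mul1r lerD//.
      by rewrite (le_trans (XK Dw' vn tO sO))// ler_wpM2r ?powR_ge0.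
    by rewrite (le_trans (XK Dw vn tO sO))// ler_wpM2r ?powR_ge0.
  have N20 : 0 <= 2 * N%:R :> R by rewrite mulr_ge0.
  have XKg := incr_bound_interpolate gg N20 XK2 XK'.
  apply: Hr.
    have [L L0 H'] := incr_bound_widen d n gg Or.
    exact: mf_space_incr (mulr_ge0 L0 K0') gam0 n0 (H' _ _ K0' (XK Dw')).
  have C'0 : 0 <= C * b `^ (1 - th) by rewrite mulr_ge0 ?powR_ge0.
  apply: (le_lt_trans (mf_norm_le C'0 n0 XKg)); rewrite lte_fin.
  have /Hdl H : 0 <= b <= dl by rewrite b0.
  have H2 : n%:R * (C * b `^ (1 - th)) <= n%:R * (C * (rr / (2 * (n%:R * (C + 1))))).
    by rewrite ler_wpM2l// ler_wpM2l.
  apply: (le_lt_trans H2).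
  have -> : n%:R * (C * (rr / (2 * (n%:R * (C + 1))))) = rr / 2 * (C / (C + 1)).
    by field; rewrite !gt_eqF// ltr_wpDl.
  apply: (@le_lt_trans _ _ (rr / 2)); last by move: rr0; lra.
  rewrite ler_piMr// ?divr_ge0 ?(ltW rr0)// ler_pdivrMr ?mul1r ?lerDl//.
  by rewrite ltr_wpDl.
pose F N j k : set T := if unpickle k is Some c then
  (if `[< good N j c >] then A N `&` (D `&` [set w | code j w = c]) else set0) else set0.
have mA N : measurable (A N).
  have -> : A N = D `&` K @^-1` [set` `]-oo, (N%:R : R)]].
    by apply/seteqP; split=> w /=; rewrite in_itv.
  exact: mK.
have mF N j k : measurable (F N j k).
  rewrite /F; case: unpickle => [c|]; last exact: measurable0.
  case: asboolP => _; last exact: measurable0.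
  by apply: measurableI => //; apply: measurable_cells => a; exact: tests_ok.
(* The part outside [D] is negligible, hence measurable by completeness; codes are enumerated by
   [pickle]. *)
have XE : X @^-1` U = (X @^-1` U `&` ~` D) `|` \bigcup_N \bigcup_j \bigcup_k F N j k.
  apply/seteqP; split=> w; last first.
    move=> [[]//|[N _ [j _ [k _]]]]; rewrite /F; case: unpickle => // c.
    by case: asboolP => // gc [Aw [_ cw]]; exact: gc cw.
  move=> UX; have [Dw|] := pselect (D w); last by left.
  right; exists (Num.truncn (K w)).+1 => //.
  set N := (Num.truncn (K w)).+1.
  have Aw : A N w by split => //; rewrite ltW// truncnS_gt.
  have [j Hj] : exists j, good N j (code j w).
    exact: close_code.
  exists j => //; exists (pickle (code j w)) => //.
  by rewrite /F pickleK; case: asboolP.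
rewrite XE; apply: measurableU.
  by apply: P_complete; apply: negligibleS Dneg => w [].
by do 3! (apply: bigcup_measurable => ? _).
Qed.

End BorelMeasurability.

(** * Random constants *)

Section ComplexMeasurability.
Context {R : realType} {disp : measure_display} {T : measurableType disp}.
Implicit Types (D : set T) (X Y : T -> R[i]) (z : R[i]).

Definition cmeasurable_on D X :=
  measurable_fun D (fun w => complex.Re (X w)) /\ measurable_fun D (fun w => complex.Im (X w)).

Lemma cmeasurableD D X Y : cmeasurable_on D X -> cmeasurable_on D Y ->
  cmeasurable_on D (fun w => X w + Y w).
Proof.
move=> [x1 x2] [y1 y2]; split.
  by under eq_fun do rewrite cReD; exact: measurable_funD.
by under eq_fun do rewrite cImD; exact: measurable_funD.
Qed.

Lemma cmeasurableM D X Y : cmeasurable_on D X -> cmeasurable_on D Y ->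
  cmeasurable_on D (fun w => X w * Y w).
Proof.
move=> [x1 x2] [y1 y2]; split.
  by under eq_fun do rewrite cReM; apply: measurable_funB; exact: measurable_funM.
by under eq_fun do rewrite cImM; apply: measurable_funD; exact: measurable_funM.
Qed.

Lemma cmeasurable_cst D z : cmeasurable_on D (fun=> z).
Proof. by split; exact: measurable_cst. Qed.

Lemma cmeasurableB D X Y : cmeasurable_on D X -> cmeasurable_on D Y ->
  cmeasurable_on D (fun w => X w - Y w).
Proof.
move=> mX mY; have := cmeasurableD mX (cmeasurableM (cmeasurable_cst D (-1)) mY).
by congr cmeasurable_on; apply/funext => w; rewrite mulN1r.
Qed.

Lemma cmeasurable_sum (I : Type) (r : seq I) D (X : I -> T -> R[i]) :
  (forall i, cmeasurable_on D (X i)) -> cmeasurable_on D (fun w => \sum_(i <- r) X i w).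
Proof.
move=> mX; elim: r => [|i r IH].
  by under eq_fun do rewrite big_nil; exact: cmeasurable_cst.
by under eq_fun do rewrite big_cons; exact: cmeasurableD.
Qed.

Lemma cmeasurable_lim D (X : nat -> T -> R[i]) Y : (forall m, cmeasurable_on D (X m)) ->
  (forall w, D w -> ctends (X ^~ w) (Y w)) -> cmeasurable_on D Y.
Proof.
move=> mX XY; split; apply/measurable_EFinP.
  apply: (@emeasurable_fun_cvg _ _ _ _ (fun m w => (complex.Re (X m w))%:E)) => [m|w Dw].
    by apply/measurable_EFinP; exact: (mX m).1.
  by apply: cvg_EFin; [exact: nearW|exact: ctends_Re (XY w Dw)].
apply: (@emeasurable_fun_cvg _ _ _ _ (fun m w => (complex.Im (X m w))%:E)) => [m|w Dw].
  by apply/measurable_EFinP; exact: (mX m).2.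
by apply: cvg_EFin; [exact: nearW|exact: ctends_Im (XY w Dw)].
Qed.

Lemma eq_cmeasurable D X Y : (forall w, D w -> X w = Y w) ->
  cmeasurable_on D X -> cmeasurable_on D Y.
Proof.
move=> XY [mre mim]; split.
  by apply: eq_measurable_fun mre => w; rewrite inE => /XY ->.
by apply: eq_measurable_fun mim => w; rewrite inE => /XY ->.
Qed.

(** By induction on the word, the iterated integral is a pointwise limit of Riemann sums, whose
    nodes do not depend on the outcome. *)
Lemma cmeasurable_chen (I : Type) D (h : I -> T -> R[i] -> R[i]) v t s :
  (forall i z, upper_half z -> cmeasurable_on D (h i ^~ z)) ->
  (forall i w, hol (h i w)) -> upper_half t -> upper_half s ->
  cmeasurable_on D (fun w => chen_int (fun i => h i w) v t s).
Proof.
move=> mh holh + sP; elim: v t => [|i v IH] t tP; first exact: cmeasurable_cst.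
pose g w u := h i w u * chen_int (fun i => h i w) v u s.
apply: (cmeasurable_lim (X := fun N w => riemann_sum (g w) s t N)) => [N|w _].
  apply: cmeasurable_sum => j; apply: cmeasurableM; first exact: cmeasurable_cst.
  have uP := seg_upper_half sP tP (frac_unit R j).
  by apply: cmeasurableM; [exact: mh|exact: IH].
have gH : hol (g w) by apply: holM => //; exact: (@hol_chen _ _ (fun i => h i w)).
have := @ctends_riemann_sum _ (g w) (fun u => chen_int (fun i => h i w) (i :: v) u s) s t gH sP tP.
have dG u : upper_half u -> cderiv (fun u => chen_int (fun i => h i w) (i :: v) u s) u (g w u).
  exact: (@cderiv_chen _ _ (fun i => h i w) (holh^~ w) i v s u sP).
by move=> /(_ dG); rewrite chen_diag subr0.
Qed.

End ComplexMeasurability.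

(** * Norms in L^p through measurable majorants *)

Section LnormBound.
Context {R : realType} {disp : measure_display} {T : measurableType disp}.
Variable P : probability T R.
Hypothesis P_complete : measure_is_complete P.

(** The integral of a nonnegative function is a supremum over simple functions below it, hence
    monotone whether or not the functions are measurable. This is what Hoelder norms call for. *)
Lemma integral_mono (f f' : T -> \bar R) : (forall w, 0 <= f w)%E -> (forall w, f w <= f' w)%E ->
  (\int[P]_w f w <= \int[P]_w f' w)%E.
Proof.
move=> f0 ff'; have f'0 w : (0 <= f' w)%E := le_trans (f0 w) (ff' w).
rewrite !ge0_integralTE//; apply: le_ereal_sup => _ [k /= kf <-].
by exists k => // w; exact: le_trans (kf w) (ff' w).
Qed.

Lemma Lnorm_le (f : T -> \bar R) (H : T -> R) (D : set T) (p c J : R) :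
  P.-negligible (~` D) -> 1 <= p -> 0 <= c -> 0 <= J ->
  (forall w, 0 <= f w)%E -> (forall w, D w -> (f w <= (c * H w)%:E)%E) ->
  measurable_fun setT H -> (forall w, 0 <= H w) ->
  (\int[P]_w ((H w) `^ p)%:E <= J%:E)%E ->
  (Lnorm P p%:E f <= (c * J `^ p^-1)%:E)%E.
Proof.
move=> Dneg p1 c0 J0 f0 fH mH H0 HJ.
have p0 : 0 < p := lt_le_trans ltr01 p1.
have mDc : measurable (~` D) by exact: P_complete.
have PD : P (~` D) = 0 by apply/negligibleP.
have mHp : measurable_fun setT (fun w => ((H w) `^ p)%:E : \bar R).
  by apply/measurable_EFinP; apply: (measurableT_comp (measurable_powR p)).
have mI : measurable_fun setT (fun w => (\1_(~` D) w)%:E : \bar R).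
  by apply/measurable_EFinP; exact: measurable_indic.
have mA : measurable_fun setT (fun w => (c `^ p)%:E * ((H w) `^ p)%:E : \bar R)%E.
  exact: measurable_funeM.
have mB : measurable_fun setT (fun w => +oo * (\1_(~` D) w)%:E : \bar R)%E.
  exact: measurable_funeM.
rewrite unlock /=.
have I1 : (\int[P]_w (`|f w| `^ p) <= (c `^ p * J)%:E)%E.
  (* A measurable majorant valid everywhere: it is infinite on the null set where nothing is known
     of [f]. *)
  apply: (@le_trans _ _ (\int[P]_w ((c `^ p)%:E * ((H w) `^ p)%:E + +oo * (\1_(~` D) w)%:E))%E).
    apply: integral_mono => [w|w]; first exact: poweR_ge0.
    rewrite gee0_abs// indicE; have [Dw|nDw] := pselect (D w).
      rewrite memNset; last by move=> /=; apply.
      rewrite mule0 adde0 -EFinM -powRM// -poweR_EFin.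
      have cH0 : 0 <= c * H w by rewrite mulr_ge0.
      apply: gt0_ler_poweR; rewrite ?(ltW p0)//; last exact: fH.
        by rewrite in_itv /= f0 leey.
      by rewrite in_itv /= lee_fin cH0 leey.
    rewrite mem_set//= mule1 addey ?leey//.
  rewrite ge0_integralD//; last by move=> w _; rewrite -EFinM lee_fin mulr_ge0 ?powR_ge0.
  have -> : (\int[P]_w (+oo * (\1_(~` D) w)%:E) = 0)%E.
    rewrite ge0_integralZl// (_ : integral _ _ _ = 0%E) ?mule0//.
    by rewrite integral_indic// setIT; exact: PD.
  rewrite adde0 ge0_integralZl//; last 2 first.
  - by move=> w _; rewrite lee_fin powR_ge0.
  - by rewrite lee_fin powR_ge0.
  rewrite EFinM.
  by rewrite lee_wpmul2l// lee_fin powR_ge0.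
have cJ : 0 <= c `^ p * J by rewrite mulr_ge0 ?powR_ge0.
apply: (@le_trans _ _ (((c `^ p * J)%:E) `^ p^-1)%E).
  apply: gt0_ler_poweR; rewrite ?invr_ge0 ?(ltW p0)//.
    by rewrite in_itv /= leey andbT integral_ge0// => w _; exact: poweR_ge0.
  by rewrite in_itv /= lee_fin cJ leey.
by rewrite poweR_EFin lee_fin powRM ?powR_ge0// -powRrM mulfV ?gt_eqF// powRr1.
Qed.

End LnormBound.

Section RandomConstants.
Context {R : realType} {disp : measure_display} {T : measurableType disp}.
Variables (P : probability T R) (alpha : R) (d : nat) (X' : 'I_d -> T -> R[i] -> R[i]).
Hypothesis afX : forall i, afBm_derivative P alpha (X' i).
Variable g : R.
Hypotheses (g0 : 0 < g) (ga : g < alpha) (alpha1 : alpha <= 1).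

Lemma derivative_bound (rho : R) (q : nat) : 0 < rho ->
  exists M : T -> R, [/\ measurable_fun setT M, forall w, 0 <= M w,
    (\int[P]_w ((1 + M w) ^+ q)%:E < +oo)%E &
    {ae P, forall w i z, `|complex.Re z| <= rho -> 0 < complex.Im z <= rho ->
      cmod (X' i w z) <= M w * complex.Im z `^ (g - 1)}].
Proof.
move=> rho0; have ag0 : 0 < alpha - g by rewrite subr_gt0.
(* Large enough both for the Whitney series to converge and for [2 m] to exceed the order [q] of the
   wanted moment. *)
pose m := (q + Num.truncn (2 / (alpha - g))).+1.
have gm : 2 <= (alpha - g) * (2 * m)%:R.
  have : 2 / (alpha - g) < (Num.truncn (2 / (alpha - g))).+1%:R by exact: truncnS_gt.
  rewrite ltr_pdivrMr// mulrC => /ltW /le_trans; apply.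
  by rewrite ler_wpM2l ?(ltW ag0)// ler_nat /m; lia.
have g1 : g <= 1 by rewrite (le_trans (ltW ga)).
pose B w := (\sum_(i < d) whitney_sum (X' i) g rho m w)%E.
have B0 w : (0 <= B w)%E by apply: sume_ge0 => i _; exact: whitney_sum_ge0.
have mB : measurable_fun setT B.
  by apply: emeasurable_sum => i; exact: (measurable_whitney_sum (afX i) g m rho0).
have intB : (\int[P]_w B w < +oo)%E.
  rewrite ge0_integral_sum//; last 2 first.
  - by move=> i; exact: (measurable_whitney_sum (afX i) g m rho0).
  - by move=> i w _; exact: whitney_sum_ge0.
  apply: lte_sum_pinfty => i _.
  exact: (whitney_sum_integral (afX i) rho0 (ltn0Sn _) alpha1 gm).
have p0 : 0 < (2 * m)%:R :> R by rewrite ltr0n.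
(* Where the sum is infinite [M] is [0] by convention; that event is null and is discarded in the
   last clause. *)
pose M w := (fine (B w)) `^ ((2 * m)%:R^-1).
have Mm w : M w ^+ (2 * m) = fine (B w).
  by rewrite -powR_mulrn ?powR_ge0// -powRrM mulVf ?gt_eqF// powRr1// fine_ge0.
exists M; split.
- by apply: (measurableT_comp (measurable_powR _)); apply: measurableT_comp mB.
- by move=> w; exact: powR_ge0.
- have le1 w : (((1 + M w) ^+ q)%:E <= (2 ^+ (2 * m))%:E * (1 + B w))%E.
    have [Bf|] := boolP (B w \is a fin_num); last first.
      rewrite ge0_fin_numE// -leNgt leye_eq => /eqP ->.
      by rewrite addey// gt0_muley ?leey// lte_fin exprn_gt0.
    rewrite -(fineK Bf) -EFinD -EFinM lee_fin -Mm.
    have M0 : 0 <= M w by exact: powR_ge0.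
    apply: (@le_trans _ _ ((1 + M w) ^+ (2 * m))).
      have qm : (q <= 2 * m)%N by rewrite /m; lia.
      by rewrite ler_weXn2l ?lerDl.
    by rewrite (le_trans (exprD_le _ _ _))// expr1n.
  apply: (@le_lt_trans _ _ (\int[P]_w ((2 ^+ (2 * m))%:E * (1 + B w)))%E).
    by apply: integral_mono => // w; rewrite lee_fin exprn_ge0// addr_ge0// powR_ge0.
  rewrite ge0_integralZl//; last 2 first.
  - exact: emeasurable_funD.
  - by move=> w _; rewrite adde_ge0.
  rewrite ge0_integralD//.
  have -> : (\int[P]_x 1 = 1 :> \bar R)%E.
    by rewrite integral_cst// mul1e; exact: probability_setT.
  by apply: lte_mul_pinfty; rewrite ?lee_fin ?exprn_ge0// lte_add_pinfty// ltry.
have Bfin : {ae P, forall w, B w \is a fin_num}.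
  have iB : P.-integrable setT B.
    by apply/integrableP; split => //; under eq_integral do rewrite gee0_abs//.
  by have := integrable_ae measurableT iB; apply: filterS => w; exact.
apply: filterS Bfin => w Bf i z zr zi.
have [zi0 _] := andP zi.
have Wi : (whitney_sum (X' i) g rho m w <= (fine (B w))%:E)%E.
  rewrite fineK// /B (bigD1 i)//= leeDl// sume_ge0// => j _; exact: whitney_sum_ge0.
have := le_trans (whitney_sum_bound (afX i) m rho0 g1 w zr zi) Wi.
rewrite lee_fin -Mm powRrM powR_mulrn ?powR_ge0// -exprMn.
rewrite ler_pXn2r ?nnegrE ?mulr_ge0 ?cmod_ge0 ?powR_ge0// => H.
by rewrite -(opprB 1 g) powRN ler_pdivlMr// powR_gt0.
Qed.

Lemma random_chen_cst (r : R) n (p : R) : 0 < r -> 1 <= p ->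
  exists K : T -> R, exists J : R, [/\ measurable_fun setT K, forall w, 0 <= K w, 0 <= J,
    (\int[P]_w ((K w) `^ p)%:E <= J%:E)%E &
    {ae P, forall w, exists2 M, 0 <= M & (forall i z, `|complex.Re z| <= 3 * r ->
      0 < complex.Im z <= 3 * r -> cmod (X' i w z) <= M * complex.Im z `^ (g - 1)) /\
      chen_cst g r M n <= K w}].
Proof.
move=> r0 p1; have p0 : 0 <= p by rewrite (le_trans ler01).
(* The constant grows like [(1 + M)^n], so its [p]-th moment asks for the order [n p] of [1 + M]. *)
pose q := (Num.truncn (n%:R * p)).+1.
have [|M [mM M0 intM MX]] := @derivative_bound (3 * r) q; first by rewrite mulr_gt0.
(* With this [a], [chen_base] is [1 + a M], which is at most [(1 + a) (1 + M)]. *)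
pose a := 6 / g * (1 + (2 * r) `^ g).
have a0 : 0 <= a by rewrite mulr_ge0 ?addr_ge0 ?powR_ge0// divr_ge0// ltW.
pose C := n.+1%:R * (1 + a) ^+ n.
have C0 : 0 <= C by rewrite mulr_ge0// exprn_ge0// addr_ge0.
have M1 w : 1 <= 1 + M w by rewrite lerDl.
have M1' w : 0 <= 1 + M w := le_trans ler01 (M1 w).
exists (fun w => C * (1 + M w) ^+ n), (C `^ p * fine (\int[P]_w ((1 + M w) ^+ q)%:E)).
have int0 : (0 <= \int[P]_w ((1 + M w) ^+ q)%:E)%E.
  by apply: integral_ge0 => w _; rewrite lee_fin exprn_ge0.
split.
- by apply: measurable_funM => //; apply: measurable_funX; exact: measurable_funD.
- by move=> w; rewrite mulr_ge0 ?exprn_ge0.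
- by rewrite mulr_ge0 ?powR_ge0// fine_ge0.
- rewrite EFinM fineK ?ge0_fin_numE// -ge0_integralZl//; last 3 first.
  + by apply/measurable_EFinP; apply: measurable_funX; exact: measurable_funD.
  + by move=> w _; rewrite lee_fin exprn_ge0.
  + by rewrite lee_fin powR_ge0.
  apply: integral_mono => w; first by rewrite lee_fin powR_ge0.
  rewrite -EFinM lee_fin powRM ?exprn_ge0// ler_wpM2l ?powR_ge0//.
  rewrite -powR_mulrn// -powRrM -powR_mulrn// ler_powR//.
  by rewrite ltW// truncnS_gt.
- apply: filterS MX => w HM; exists (M w) => //; split=> //.
  rewrite /chen_cst -mulrA ler_wpM2l// -exprMn lerXn2r ?nnegrE//.
  + by rewrite /chen_base addr_ge0// mulr_ge0 ?addr_ge0 ?powR_ge0// divr_ge0 ?mulr_ge0// ltW.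
  + by rewrite mulr_ge0// addr_ge0.
  rewrite /chen_base -/g (_ : 6 * M w / g * (1 + (2 * r) `^ g) = a * M w); last by rewrite /a; ring.
  by have := M0 w; move: (M w) => x x0; have := mulr_ge0 a0 x0; rewrite mulrDr mulr1 mulrDl mul1r; lra.
Qed.

End RandomConstants.

Section PlaneTopology.
Variable R : realType.
Implicit Types (z u : R[i]).

Lemma nbhs_cball z (Q : set R[i]) : nbhs (z : (R[i])^o) Q ->
  exists2 r : R, 0 < r & forall u, cmod (u - z) < r -> Q u.
Proof.
move=> /nbhs_ballP[e /= e0 H]; exists (complex.Re e).
  by move: e0; rewrite ltcE /= => /andP[].
move=> u uz; apply: H; rewrite /ball /= -cmod_norm cmod_distC.
by case: e e0 uz => a b /=; rewrite !ltcE /= => /andP[/eqP -> _] ->; rewrite eqxx.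
Qed.

Lemma within_ctends (f : R[i] -> R[i]) z (v : nat -> R[i]) :
  {within (closed_upper_half (R:=R) : set (R[i])^o), continuous (f : (R[i])^o -> (R[i])^o)} ->
  closed_upper_half z -> (forall m, closed_upper_half (v m)) ->
  ctends v z -> ctends (fun m => f (v m)) (f z).
Proof.
move=> cf zP vP vz e e0.
have /cvgrPdist_le := cf z; rewrite /= => /(_ e%:C).
rewrite ltcR => /(_ e0) H0.
have /nbhs_cball[dl dl0 H] : within (closed_upper_half (R:=R) : set (R[i])^o) (nbhs (z : (R[i])^o))
    [set t | `|(f z : (R[i])^o) - f t| <= e%:C].
  by rewrite nbhs_subspace_in//; exact: H0.
have dl2 : 0 < dl / 2 by rewrite divr_gt0.
have [N HN] := vz _ dl2; exists N => m /HN vm.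
have := H (v m); rewrite -lecR cmod_norm distrC; apply; last exact: vP.
by rewrite (le_lt_trans vm)// ltr_pdivrMr// ltr_pMr// ltr1n.
Qed.

Lemma bounded_cmod (A : set R[i]) : bounded_set (A : set (R[i])^o) ->
  exists2 r : R, 0 <= r & forall z, A z -> cmod z <= r.
Proof.
move=> [M [Mr H]]; pose M' : R := `|complex.Re M| + 1.
exists M'; first by rewrite addr_ge0.
move=> z zA; suff MM : M < M'%:C by have := H _ MM z zA; rewrite /= -cmod_norm lecR.
rewrite -(RRe_real Mr) ltcR /M' (le_lt_trans (ler_norm _))// ltrDl.
by rewrite ltr01.
Qed.

Lemma nbhs0_two_points (A : set R[i]) : nbhs0_closed_upper_half A ->
  A 0 /\ exists s t, [/\ A s, A t & s != t].
Proof.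
move=> [Asub /nbhs_cball[r r0 H]].
have A0 : A 0 by apply: H; rewrite ?subrr ?cmod0// /closed_upper_half /= lexx.
split => //; exists 0, ((r / 2)%:C); split => //.
  apply: H; last by rewrite /closed_upper_half /= lexx.
  by rewrite subr0 cmod_real ger0_norm ?divr_ge0 ?ltW// ltr_pdivrMr// ltr_pMr// ltr1n.
apply/eqP => /(congr1 (@complex.Re R)) /=; lra.
Qed.

End PlaneTopology.

(** * Convergence of the regularized functionals *)

Section Paths.
Variables (R : realType) (d : nat) (g : R).
Implicit Types (h X : 'I_d -> R[i] -> R[i]) (v : seq 'I_d) (s t u z : R[i]) (eps r M K : R).
Hypothesis g01 : 0 < g <= 1.

Definition blowup_bound h rho M := 0 <= M /\ forall i z,
  `|complex.Re z| <= rho -> 0 < complex.Im z <= rho -> cmod (h i z) <= M * complex.Im z `^ (g - 1).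

(** The properties of a single outcome on which the pathwise part relies. The bounds are asked for
    all integer radii, so that one null set serves all points. *)
Definition regular_path h X := [/\ forall i, hol (h i),
  forall N : nat, exists M, blowup_bound h N%:R M,
  forall i z, upper_half z -> seg_integrable (h i) 0 z /\ X i z = seg_int (h i) 0 z &
  forall i, {within (closed_upper_half (R:=R) : set (R[i])^o),
    continuous (X i : (R[i])^o -> (R[i])^o)}].

(** At level one the increment of the path is taken instead of the limit, so that this level is
    correct for every outcome and at all points. *)
Definition lim_tensors h X : tensors R d := fun k t s =>
  [ffun v : k.-tuple 'I_d => if tval v is [:: i] then X i t - X i s else chen_lim h v t s].

Definition lim_functional h X : mult_functional R d :=
  (fun z => [ffun i => X i z], lim_tensors h X).

Variables (h X : 'I_d -> R[i] -> R[i]).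
Hypothesis hX : regular_path h X.

Let holh i : hol (h i). Proof. by case: hX. Qed.

Let bounded N : exists2 M : R, 0 <= M & forall i z,
  `|complex.Re z| <= N%:R -> 0 < complex.Im z <= N%:R ->
  cmod (h i z) <= M * complex.Im z `^ (g - 1).
Proof. by case: hX => _ /(_ N)[M []] *; exists M. Qed.

Let prim i z : upper_half z -> seg_integrable (h i) 0 z /\ X i z = seg_int (h i) 0 z.
Proof. by case: hX => _ _ + _; apply. Qed.

Lemma reg_functional_incr eps v t s : 0 < eps -> closed_upper_half t -> closed_upper_half s ->
  (0 < size v)%N ->
  incr (reg_functional eps X) v t s = chen_int h v (ishift eps t) (ishift eps s).
Proof.
move=> e0 tP sP v0; have tP' := ishift_upper_half e0 tP; have sP' := ishift_upper_half e0 sP.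
case: v v0 => [|i [|j v]] // _.
  by rewrite /incr /= !ffunE /shift_path (primitive_increment holh g01 (@prim i) bounded).
have -> : incr (reg_functional eps X) [:: i, j & v] t s =
    iter_int (fun k => shift_path eps (X k)) [:: i, j & v] t s by rewrite /incr /word_coord ffunE.
rewrite iter_int_shift; apply: iter_int_chen => // k z zP; apply: cderive_eq.
exact: (cderiv_primitive holh g01 (@prim k) bounded).
Qed.

(* A radius beyond the given points, at which the bounds on the integrands are available. *)
Let large_disk (b : R) : exists r M, [/\ 0 <= r, 0 <= M, b <= r - 1 & forall i z,
  `|complex.Re z| <= 3 * r -> 0 < complex.Im z <= 3 * r ->
  cmod (h i z) <= M * complex.Im z `^ (g - 1)].
Proof.
pose N := (Num.truncn (3 * (`|b| + 1))).+1; have [M M0 HM] := bounded N.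
have NE : 3 * (`|b| + 1) <= N%:R by rewrite ltW// truncnS_gt.
have bb := ler_norm b; have b0 := normr_ge0 b.
have E : 3 * (N%:R / 3) = N%:R :> R by rewrite mulrC divfK.
exists (N%:R / 3), M; split=> //; try by move: NE; move: (N%:R) (`|b|) bb b0 => x y *; lra.
by rewrite E.
Qed.

Let ctends_above z : ctends (fun m => above m z) z.
Proof.
move=> e e0; have [N HN] := invS_small e0; exists N => m Nm.
rewrite /above /ishift addrC addKr cmod_imag ger0_norm ?HN//.
Qed.

Let above_upper m z : closed_upper_half z -> upper_half (above m z).
Proof. by apply: ishift_upper_half; rewrite invr_gt0 ltr0Sn. Qed.

Let upper_closed z : upper_half z -> closed_upper_half z.
Proof. exact: ltW. Qed.

(** Only words of length one need an argument: continuity of the path up to the boundary identifies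
    its increments with the limits from above. *)
Lemma lim_functional_incr v t s : closed_upper_half t -> closed_upper_half s ->
  incr (lim_functional h X) v t s = chen_lim h v t s.
Proof.
move=> tP sP; case: v => [|i [|j v]]; try by rewrite /incr /word_coord /= ffunE.
rewrite /incr /= !ffunE.
have [r [M [r0 M0 br HM]]] := large_disk (cmod t + cmod s).
have lim := @chen_lim_ctends _ _ h M g r 1 holh M0 g01 r0 HM [:: i] t s.
have tD : closed_upper_half t /\ cmod t <= r - 1.
  by split => //; have := cmod_ge0 s; move: br; move: (cmod t) (cmod s) => *; lra.
have sD : closed_upper_half s /\ cmod s <= r - 1.
  by split => //; have := cmod_ge0 t; move: br; move: (cmod t) (cmod s) => *; lra.
apply: (ctends_unique _ (lim tD sD isT)).
have cX z : closed_upper_half z -> ctends (fun m => X i (above m z)) (X i z).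
  move=> zP; have [_ _ _ /(_ i) cXi] := hX.
  apply: (within_ctends cXi zP) => // m; exact/upper_closed/above_upper.
apply: ctends_ext (ctendsB (cX t tP) (cX s sP)) => m.
by rewrite (primitive_increment holh g01 (@prim i) bounded)//; exact: above_upper.
Qed.

Lemma lim_tensorsE k (v : k.-tuple 'I_d) t s : closed_upper_half t -> closed_upper_half s ->
  lim_tensors h X k t s v = chen_lim h v t s.
Proof.
move=> tP sP; rewrite -lim_functional_incr// /lim_tensors ffunE.
case: v => -[|i [|j v]] /= sv; rewrite /incr /word_coord /= !ffunE//.
Qed.

Lemma lim_tensors_relation k (v : k.-tuple 'I_d) t u s : (0 < k)%N ->
  closed_upper_half t -> closed_upper_half u -> closed_upper_half s ->
  delta2 (lim_tensors h X k) t u s v =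
  \sum_(1 <= j < k) word_coord (lim_tensors h X) t u (take j v) *
                    word_coord (lim_tensors h X) u s (drop j v).
Proof.
move=> k0 tP uP sP; 
have subE (a b : {ffun k.-tuple 'I_d -> R[i]}) x : (a - b) x = a x - b x by rewrite !ffunE.
rewrite /delta2 !subE !lim_tensorsE//.
have [r [M [r0 M0 br HM]]] := large_disk (cmod t + cmod u + cmod s).
have t0 := cmod_ge0 t; have u0 := cmod_ge0 u; have s0 := cmod_ge0 s.
have tr : cmod t <= r - 1 by move: br t0 u0 s0; move: (cmod t) (cmod u) (cmod s) => *; lra.
have ur : cmod u <= r - 1 by move: br t0 u0 s0; move: (cmod t) (cmod u) (cmod s) => *; lra.
have sr : cmod s <= r - 1 by move: br t0 u0 s0; move: (cmod t) (cmod u) (cmod s) => *; lra.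
rewrite (@chen_lim_relation _ _ h M g r k holh M0 g01 r0 HM v t u s)// ?size_tuple//.
have chen0 x y : closed_upper_half x -> closed_upper_half y -> cmod x <= r - 1 ->
    cmod y <= r - 1 -> chen_lim h [::] x y = 1.
  move=> xP yP xr yr; apply: (ctends_unique _ (ctends_cst 1)).
  by apply: (@chen_lim_ctends _ _ h M g r 0 holh M0 g01 r0 HM [::]).
rewrite -(big_mkord xpredT (fun j => chen_lim h (take j v) t u * chen_lim h (drop j v) u s)).
(* The extreme terms [j = 0] and [j = k] of the full relation are those subtracted in [delta2]. *)
rewrite big_nat_recr//= big_ltn// take0 drop0 chen0// mul1r.
have -> : take k v = v :> seq _ by rewrite take_oversize ?size_tuple.
have -> : drop k v = [::] by rewrite drop_oversize ?size_tuple.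
rewrite chen0// mulr1.
rewrite addrK [X in X - _]addrC addrK [RHS]big_nat big_nat; apply: eq_bigr => j /andP[j1 jk].
by rewrite /word_coord !lim_tensorsE.
Qed.

Lemma lim_tensors_shuffle k m (i : k.-tuple 'I_d) (j : m.-tuple 'I_d) t s :
  closed_upper_half t -> closed_upper_half s ->
  lim_tensors h X k t s i * lim_tensors h X m t s j =
  \sum_(sg : 'S_(k + m) | is_shuffle sg)
    lim_tensors h X (k + m)%N t s (permute_tuple sg (cat_tuple i j)).
Proof.
move=> tP sP; rewrite !lim_tensorsE//.
under [RHS]eq_bigr do rewrite lim_tensorsE//.
have [r [M [r0 M0 br HM]]] := large_disk (cmod t + cmod s).
have t0 := cmod_ge0 t; have s0 := cmod_ge0 s.
have tr : cmod t <= r - 1 by move: br t0 s0; move: (cmod t) (cmod s) => *; lra.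
have sr : cmod s <= r - 1 by move: br t0 s0; move: (cmod t) (cmod s) => *; lra.
rewrite (sum_is_shuffle (fun l => chen_lim h l t s)).
by apply: (@chen_lim_shuffle _ _ h M g r (size i + size j) holh M0 g01 r0 HM).
Qed.

Variables (n : nat) (Omega : set R[i]) (r0 r M K : R).
Hypotheses (Omega_closed : Omega `<=` closed_upper_half (R := R))
  (Omega_bounded : forall z, Omega z -> cmod z <= r0).
Hypotheses (r_ge0 : 0 <= r) (hM : blowup_bound h (3 * r) M) (MK : chen_cst g r M n <= K).

Let M0 : 0 <= M. Proof. by case: hM. Qed.
Let hM' : forall i z, `|complex.Re z| <= 3 * r -> 0 < complex.Im z <= 3 * r ->
  cmod (h i z) <= M * complex.Im z `^ (g - 1).
Proof. by case: hM. Qed.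

Lemma reg_functional_bound eps : 0 < eps -> r0 + eps <= r ->
  incr_bound n Omega g K (incr (reg_functional eps X)) /\
  incr_modulus n Omega g K (incr (reg_functional eps X)).
Proof.
move=> e0 er.
have D z : Omega z -> upper_half (ishift eps z) /\ cmod (ishift eps z) <= r.
  move=> zO; split; first exact: ishift_upper_half (Omega_closed zO).
  by rewrite (le_trans (cmod_ishift _ (ltW e0)))//; have := Omega_bounded zO; lra.
split=> v.
  move=> t s /andP[v0 vn] tO sO; rewrite reg_functional_incr//; [|exact: Omega_closed..].
  have := chen_int_bound holh M0 g01 hM' (D s sO) (D t tO) vn; rewrite ishift_dist.
  by move/le_trans; apply; rewrite ler_wpM2r ?powR_ge0.
move=> t t' s s' /andP[v0 vn] tO tO' sO sO'.
rewrite !reg_functional_incr//; try exact: Omega_closed.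
have := chen_int_modulus holh M0 g01 r_ge0 hM' (D s sO) (D s' sO') (D t tO) (D t' tO') vn.
rewrite !ishift_dist; move/le_trans; apply.
by rewrite ler_wpM2r// addr_ge0// powR_ge0.
Qed.

Hypothesis r01 : r0 + 1 <= r.

Let D z : Omega z -> closed_upper_half z /\ cmod z <= r - 1.
Proof. move=> zO; split; first exact: Omega_closed.
by rewrite lerBrDr (le_trans _ r01)// lerD2r Omega_bounded. Qed.

Lemma lim_functional_bound : incr_bound n Omega g K (incr (lim_functional h X)) /\
  incr_modulus n Omega g K (incr (lim_functional h X)).
Proof.
split=> v.
  move=> t s /andP[v0 vn] tO sO; rewrite lim_functional_incr//; [|exact: Omega_closed..].
  have := chen_lim_bound holh M0 g01 r_ge0 hM' (D tO) (D sO) vn.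
  by move/le_trans; apply; rewrite ler_wpM2r ?powR_ge0.
move=> t t' s s' /andP[v0 vn] tO tO' sO sO'.
rewrite !lim_functional_incr//; try exact: Omega_closed.
have := chen_lim_modulus holh M0 g01 r_ge0 hM' (D tO) (D tO') (D sO) (D sO') vn.
move/le_trans; apply.
by rewrite ler_wpM2r// addr_ge0// powR_ge0.
Qed.

Lemma reg_functional_rate eps v t s : 0 < eps <= 1 -> (0 < size v <= n)%N -> Omega t -> Omega s ->
  cmod (incr (mf_sub (reg_functional eps X) (lim_functional h X)) v t s) <= 2 * K * eps `^ g.
Proof.
move=> e01 /andP[v0 vn] tO sO; have [e0 _] := andP e01.
have tP := Omega_closed tO; have sP := Omega_closed sO.
rewrite incr_sub reg_functional_incr// lim_functional_incr//.
have := chen_lim_rate holh M0 g01 r_ge0 hM' (D tO) (D sO) vn e01.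
move/le_trans; apply.
by rewrite ler_wpM2r ?powR_ge0// ler_wpM2l.
Qed.

End Paths.

(** * Convergence in L^p and regularity of the limit *)

Section Convergence.
Context {R : realType} {disp : measure_display} {T : measurableType disp}.
Variables (P : probability T R) (d n : nat) (Omega : set R[i]) (g gam r0 : R).
Hypotheses (P_complete : measure_is_complete P) (n0 : (0 < n)%N) (gg : 0 < gam < g).
Hypotheses (O0 : Omega 0) (Opair : exists s t, [/\ Omega s, Omega t & s != t]).
Hypothesis Or : forall z, Omega z -> cmod z <= r0.
Implicit Types (Y : T -> mult_functional R d) (D : set T) (K : T -> R) (c p J : R).

Lemma mf_norm_ge0 (x : mult_functional R d) mu : (0 <= mf_norm n mu Omega x)%E.
Proof.
rewrite /mf_norm adde_ge0 ?hoelder_norm_ge0//.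
by apply: sume_ge0 => k _; exact: hoelder_norm_ge0.
Qed.

Lemma Lnorm_mf_norm_le Y D K p c J : P.-negligible (~` D) -> 1 <= p -> 0 <= c -> 0 <= J ->
  measurable_fun setT K -> (forall w, 0 <= K w) -> (\int[P]_w ((K w) `^ p)%:E <= J%:E)%E ->
  (forall w, D w -> incr_bound n Omega gam (c * K w) (incr (Y w))) ->
  (Lnorm P p%:E (fun w => mf_norm n gam Omega (Y w)) <= (n%:R * c * J `^ p^-1)%:E)%E.
Proof.
move=> Dneg p1 c0 J0 mK K0 KJ YK.
apply: (Lnorm_le P_complete Dneg p1 _ J0 _ _ mK K0 KJ).
- by rewrite mulr_ge0.
- by move=> w; exact: mf_norm_ge0.
- move=> w Dw; rewrite -mulrA; apply: mf_norm_le => //; last exact: YK.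
  by rewrite mulr_ge0.
Qed.

Lemma in_Lp_incr Y D K p c J : P.-negligible (~` D) -> 1 <= p -> 0 <= c -> 0 <= J ->
  measurable_fun setT K -> (forall w, 0 <= K w) -> (\int[P]_w ((K w) `^ p)%:E <= J%:E)%E ->
  (forall w, D w -> incr_bound n Omega g (c * K w) (incr (Y w)) /\
     incr_modulus n Omega g (c * K w) (incr (Y w))) ->
  (forall v t s, (0 < size v <= n)%N -> Omega t -> Omega s ->
     cmeasurable_on D (fun w => incr (Y w) v t s)) ->
  in_Lp P n gam Omega p Y.
Proof.
move=> Dneg p1 c0 J0 mK K0 KJ YK mY; have [gam0 gamg] := andP gg.
have [L L0 HL] := incr_bound_widen d n gg Or.
have cK w : 0 <= c * K w by rewrite mulr_ge0.
split.
- apply: filterS (_ : {ae P, forall w, D w}) => [w Dw|//].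
  exact: mf_space_incr (mulr_ge0 L0 (cK w)) gam0 n0 (HL _ _ (cK w) (YK w Dw).1).
- move=> U; apply: (@measurable_preimage_open _ _ _ P d n Omega P_complete Y D
    (fun w => c * K w) g gam r0) => //.
  + by apply: measurable_funTS; exact: measurable_funM.
  + by move=> w /YK[].
  + by move=> w /YK[].
- apply: le_lt_trans (ltry _).
  apply: (@Lnorm_mf_norm_le Y D K p (L * c) J) => //; first by rewrite mulr_ge0.
  by move=> w Dw; rewrite -mulrA; exact: (HL _ _ (cK w) (YK w Dw).1).
Qed.

Lemma incr_sub_bound mu c (x y : mult_functional R d) :
  incr_bound n Omega mu c (incr x) -> incr_bound n Omega mu c (incr y) ->
  incr_bound n Omega mu (2 * c) (incr (mf_sub x y)).
Proof.
move=> Hx Hy v t s vn tO sO; rewrite incr_sub (le_trans (cmodB _ _))//.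
by rewrite -mulrA mulr2n mulrDl mul1r lerD ?Hx ?Hy.
Qed.

Lemma incr_sub_modulus mu c (x y : mult_functional R d) :
  incr_modulus n Omega mu c (incr x) -> incr_modulus n Omega mu c (incr y) ->
  incr_modulus n Omega mu (2 * c) (incr (mf_sub x y)).
Proof.
move=> Hx Hy v t t' s s' vn tO tO' sO sO'; rewrite !incr_sub.
have -> : incr x v t s - incr y v t s - (incr x v t' s' - incr y v t' s') =
  (incr x v t s - incr x v t' s') - (incr y v t s - incr y v t' s') by ring.
rewrite (le_trans (cmodB _ _))//.
by rewrite -[2 * c * _]mulrA mulr2n mulrDl mul1r lerD ?Hx ?Hy.
Qed.

Variables (alpha : R) (X' : 'I_d -> T -> R[i] -> R[i]) (Gam : 'I_d -> T -> R[i] -> R[i]).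
Hypotheses (ga : g < alpha) (alpha1 : alpha <= 1).
Hypothesis afX : forall i, afBm_derivative P alpha (X' i).
Hypothesis aeX : forall i, {ae P, forall w,
  (forall z, upper_half z ->
     seg_integrable (X' i w) 0 z /\ Gam i w z = seg_int (X' i w) 0 z) /\
  {within (closed_upper_half (R:=R) : set (R[i])^o),
     continuous (Gam i w : (R[i])^o -> (R[i])^o)}}.
Hypotheses (Oc : Omega `<=` closed_upper_half (R := R)) (r00 : 0 <= r0).

Let g0 : 0 < g. Proof. by case/andP: gg => gam0; exact: lt_trans. Qed.
Let g01 : 0 < g <= 1. Proof. by rewrite g0 (le_trans (ltW ga)). Qed.

Local Notation h w := (fun i => X' i w).
Local Notation G w := (fun i => Gam i w).
Local Notation lim w := (lim_functional (h w) (G w)).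
Local Notation reg eps w := (reg_functional eps (G w)).

Let holX i w : hol (X' i w).
Proof. by apply: analytic_hol; have [] := afX i. Qed.

Let mX i z : upper_half z -> cmeasurable_on setT (X' i ^~ z).
Proof. exact: (afBm_cmeasurable (afX i)). Qed.

Lemma ae_regular : {ae P, forall w, regular_path g (h w) (G w)}.
Proof.
have B : {ae P, forall w, forall N : nat, exists M, blowup_bound g (h w) N%:R M}.
  have BN (N : nat) : {ae P, forall w, exists M, blowup_bound g (h w) N%:R M}.
    have [|M [_ M0 _ HM]] := derivative_bound afX g0 ga alpha1 (rho := N.+1%:R) 0.
      by rewrite ltr0Sn.
    apply: filterS HM => w HM; exists (M w); split => // i z zr /andP[zi0 zi].
    (* The radius [N + 1] is used to cover [N = 0], the moment estimates being stated for positive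
       radii. *)
    have N1 : N%:R <= N.+1%:R :> R by rewrite ler_nat.
    by apply: HM; rewrite ?(le_trans zr N1)// zi0 (le_trans zi N1).
  apply: negligibleS (negligible_bigcup BN) => w /= /existsNP[N HN]; by exists N.
have := filter_forall _ aeX => A.
apply: filterS2 B (A _) => w Bw Aw; split=> // i.
- by move=> z; exact: (Aw i).1.
- exact: (Aw i).2.
Qed.

Lemma cvg_Lp_reg p : 1 <= p ->
  cvg_Lp P n gam Omega p (fun eps w => reg eps w) (fun w => lim w).
Proof.
move=> p1; have r00' := r00.
(* This set is measurable through completeness: its complement is negligible. *)
pose good r K w := regular_path g (h w) (G w) /\
  exists M, blowup_bound g (h w) (3 * r) M /\ chen_cst g r M n <= K w.
have good_exists r : 0 < r -> exists K, exists J, [/\ measurable_fun setT K, forall w, 0 <= K w, 0 <= J,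
    (\int[P]_w ((K w) `^ p)%:E <= J%:E)%E & P.-negligible (~` [set w | good r K w])].
  move=> r1; have [K [J [mK K0 J0 KJ HK]]] := random_chen_cst afX g0 ga alpha1 n r1 p1.
  exists K, J; split => //.
  apply: filterS2 ae_regular HK => w rw [M M0 [HM MK]]; split=> //; exists M; split=> //.
have goodr r (K : T -> R) w eps : 0 < eps -> r0 + 1 + eps <= r -> good r K w ->
   (incr_bound n Omega g (K w) (incr (reg eps w)) /\
    incr_modulus n Omega g (K w) (incr (reg eps w))) /\
   (incr_bound n Omega g (K w) (incr (lim w)) /\
    incr_modulus n Omega g (K w) (incr (lim w))).
  move=> e0 er [rw [M [HM MK]]].
  have r1 : 0 <= r by lra.
  split; first by apply: (reg_functional_bound g01 rw Oc Or r1 HM MK); lra.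
  by apply: (lim_functional_bound g01 rw Oc Or r1 HM MK); lra.
have mreg r (K : T -> R) eps v t s : 0 < eps -> (0 < size v <= n)%N -> Omega t -> Omega s ->
    cmeasurable_on [set w | good r K w] (fun w => incr (reg eps w) v t s).
  move=> e0 /andP[v0 _] tO sO.
  apply: (eq_cmeasurable (X := fun w => chen_int (h w) v (ishift eps t) (ishift eps s))).
    by move=> w [rw _]; rewrite (reg_functional_incr g01 rw)//; exact: Oc.
  apply: (@cmeasurable_chen _ _ _ _ _ X').
  - by move=> i z zP; split; apply: measurable_funTS; [exact: (mX i zP).1|exact: (mX i zP).2].
  - exact: holX.
  - exact: ishift_upper_half (Oc tO).
  - exact: ishift_upper_half (Oc sO).
have mlim r (K : T -> R) v t s : r0 + 1 <= r -> (0 < size v <= n)%N -> Omega t -> Omega s ->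
    cmeasurable_on [set w | good r K w] (fun w => incr (lim w) v t s).
  move=> r01 /andP[v0 vn] tO sO.
  apply: (cmeasurable_lim (X := fun m w => chen_int (h w) v (above m t) (above m s))).
    move=> m; apply: (@cmeasurable_chen _ _ _ _ _ X').
    - by move=> i z zP; split; apply: measurable_funTS; [exact: (mX i zP).1|exact: (mX i zP).2].
    - exact: holX.
    - by apply: ishift_upper_half (Oc tO); rewrite invr_gt0.
    - by apply: ishift_upper_half (Oc sO); rewrite invr_gt0.
  move=> w [rw [M [[M0 HM] MK]]].
  rewrite (lim_functional_incr g01 rw); [|exact: Oc..].
  have r1 : 0 <= r by lra.
  apply: (@chen_lim_ctends _ _ (h w) M g r n (holX^~ w) M0 g01 r1 HM) => //.
    by split; [exact: Oc|rewrite lerBrDr (le_trans _ r01)// lerD2r Or].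
  by split; [exact: Oc|rewrite lerBrDr (le_trans _ r01)// lerD2r Or].
split.
(* Membership in [L^p] is claimed for every [eps > 0], so the radius, and with it the random
   constant, depends on [eps]. *)
- move=> eps e0; have [|K [J [mK K0 J0 KJ Kneg]]] := good_exists (r0 + 1 + eps); first by lra.
  apply: (in_Lp_incr Kneg p1 ler01 J0 mK K0 KJ).
    by move=> w gw; rewrite mul1r; exact: (goodr _ K w eps e0 (lexx _) gw).1.
  by move=> v t s; exact: mreg.
- have [|K [J [mK K0 J0 KJ Kneg]]] := good_exists (r0 + 1 + 1); first by lra.
  apply: (in_Lp_incr Kneg p1 ler01 J0 mK K0 KJ).
    by move=> w gw; rewrite mul1r; exact: (goodr _ K w 1 ltr01 (lexx _) gw).2.
  by move=> v t s; apply: mlim; rewrite lerDl.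
- move=> eps e0; have [|K [J [mK K0 J0 KJ Kneg]]] := good_exists (r0 + 1 + eps); first by lra.
  apply: (in_Lp_incr Kneg p1 (ler0n R 2) J0 mK K0 KJ).
    move=> w gw; have [[A1 A2] [B1 B2]] := goodr _ K w eps e0 (lexx _) gw.
    by split; [exact: incr_sub_bound|exact: incr_sub_modulus].
  move=> v t s vn tO sO; apply: (eq_cmeasurable (X := fun w => incr (reg eps w) v t s - incr (lim w) v t s)).
    by move=> w _; rewrite incr_sub.
  by apply: cmeasurableB; [exact: mreg|apply: mlim => //; rewrite lerDl ltW].
(* For the limit [eps] is at most [1], and one random constant serves all such [eps]. *)
have [|K [J [mK K0 J0 KJ Kneg]]] := good_exists (r0 + 1 + 1); first by lra.
have [gam0 gamg] := andP gg.
(* The rate is [eps^(g - gam)], obtained by interpolating the uniform rate [eps^g] with the bounded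
   [g]-Hoelder norms. *)
pose b := g * (1 - gam / g).
have th1 : 0 < 1 - gam / g by rewrite subr_gt0 ltr_pdivrMr// mul1r.
have b0 : 0 < b by rewrite mulr_gt0.
have rate eps : 0 < eps <= 1 -> (Lnorm P p%:E (fun w => mf_norm n gam Omega (mf_sub (reg eps w) (lim w)))
    <= (n%:R * (2 * eps `^ b) * J `^ p^-1)%:E)%E.
  move=> e01; have [e0 e1] := andP e01.
  apply: (Lnorm_mf_norm_le Kneg p1 _ J0 mK K0 KJ); first by rewrite mulr_ge0// powR_ge0.
  move=> w gw; have [rw [M [HM MK]]] := gw.
  have r1 : 0 <= r0 + 1 + 1 by lra.
  have r2 : r0 + 1 + eps <= r0 + 1 + 1 by rewrite lerD2l.
  have [[A1 A2] [B1 B2]] := goodr _ K w eps e0 r2 gw.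
  have Kw2 : 0 <= 2 * K w by rewrite mulr_ge0.
  have := incr_bound_interpolate gg Kw2 (incr_sub_bound A1 B1) (fun v t s =>
    @reg_functional_rate _ _ _ g01 _ _ rw n Omega r0 (r0 + 1 + 1) M (K w) Oc Or r1 HM MK
      (_ : r0 + 1 <= r0 + 1 + 1) eps v t s e01).
  rewrite lerDl ler01 => /(_ isT).
  have -> // : (2 * K w) `^ (gam / g) * (2 * K w * eps `^ g) `^ (1 - gam / g) = 2 * eps `^ b * K w.
  rewrite (@powRM _ (2 * K w) (eps `^ g)) ?powR_ge0// mulrA -powRrM -/b.
  have -> : (2 * K w) `^ (gam / g) * (2 * K w) `^ (1 - gam / g) = 2 * K w.
    have [->|kn] := eqVneq (2 * K w) 0.
      by rewrite powR0 ?mul0r// gt_eqF// divr_gt0.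
    by rewrite -powRD ?subrKC ?powRr1//; apply/implyP => _; rewrite kn.
  ring.
apply: (@squeeze_cvge _ _ _ _ (fun=> 0%E) _ (fun eps => (n%:R * (2 * eps `^ b) * J `^ p^-1)%:E)).
- near=> eps; rewrite Lnorm_ge0/=; apply: rate.
  apply/andP; split; first by near: eps; exact: nbhs_right_gt.
  by near: eps; exact: nbhs_right_le.
- exact: cvg_cst.
apply: cvg_EFin; first exact: nearW.
apply/cvgrPdist_le => e e0.
pose C := n%:R * 2 * J `^ p^-1 + 1.
have C0 : 0 < C by rewrite ltr_wpDl// !mulr_ge0// powR_ge0.
have eC : 0 < e / C by rewrite divr_gt0.
have [dl dl0 Hdl] := powR_small b0 eC.
near=> eps.
have /Hdl : 0 <= eps <= dl.
  apply/andP; split; first by apply: ltW; near: eps; exact: nbhs_right_gt.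
  by near: eps; exact: nbhs_right_le.
rewrite ler_pdivlMr// => H; rewrite /= sub0r normrN ger0_norm ?mulr_ge0 ?powR_ge0//.
apply: le_trans H; rewrite /C mulrDr mulr1.
rewrite (_ : n%:R * (2 * eps `^ b) * J `^ p^-1 = eps `^ b * (n%:R * 2 * J `^ p^-1)); last by ring.
by rewrite lerDl powR_ge0.
Unshelve. all: by end_near. Qed.

Lemma lim_tensors_spaces : {ae P, forall w, forall k, (2 <= k <= n)%N ->
  in_C2mu (k%:R * gam) Omega (lim_tensors (h w) (G w) k) /\
  in_C2m gam Omega (lim_tensors (h w) (G w) k)}.
Proof.
have [gam0 gamg] := andP gg; have r1 : 0 < r0 + 1 by rewrite ltr_wpDl.
have [K [J [_ _ _ _ HK]]] := random_chen_cst afX g0 ga alpha1 n r1 (lexx 1).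
apply: filterS2 ae_regular HK => w rw [M M0 [HM MK]] k kn.
have K0 : 0 <= K w by apply: le_trans MK; exact: chen_cst_ge0.
have [B1 B2] := lim_functional_bound g01 rw Oc Or (ltW r1) (conj M0 HM) MK (lexx _).
have [L L0 HL] := incr_bound_widen d n gg Or.
have [_ sp] := mf_space_incr (mulr_ge0 L0 K0) gam0 n0 (HL _ _ K0 B1).
have [S1 S2] := sp k kn; split => //; split => //.
apply: (@le_lt_trans _ _ (2 * K w)%:E); last exact: ltry.
apply: ub_ereal_sup => _ [eps [s1 [s2 [/andP[e0 e1] [sO1 sO2] [tO1 tO2] ->]]]].
rewrite lee_fin ler_pdivrMr ?powR_gt0// /vnorm; apply: bigmax_le => [|v _].
  by rewrite !mulr_ge0 ?powR_ge0.
have [k2 kn'] := andP kn.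
(* A vertical shift is a displacement by [eps] of both arguments, so the modulus of continuity
   applies; [eps^g <= eps^gam] since [eps <= 1]. *)
have := B2 v (ishift eps s1) s1 (ishift eps s2) s2.
rewrite size_tuple kn' (ltnW k2) => /(_ isT tO1 sO1 tO2 sO2).
have sh z : cmod (ishift eps z - z) = eps by rewrite /ishift addrC addKr cmod_imag gtr0_norm.
rewrite !incr_tuple//= !sh => H.
have -> : (lim_tensors (h w) (G w) k (ishift eps s1) (ishift eps s2) - lim_tensors (h w) (G w) k s1 s2) v
  = lim_tensors (h w) (G w) k (ishift eps s1) (ishift eps s2) v - lim_tensors (h w) (G w) k s1 s2 v.
  by rewrite !ffunE.
apply: (le_trans H); rewrite -mulr2n -[_ *+ 2]mulr_natl mulrCA mulrA ler_wpM2l ?mulr_ge0//.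
by apply: ger_powR; rewrite ?e0// ltW.
Qed.

End Convergence.

Theorem theorem6p11 (R : realType) (disp : measure_display)
    (T : measurableType disp) (P : probability T R)
    (P_complete : measure_is_complete P)
    (d : nat) (d_gt0 : (0 < d)%N)
    (alpha : R) (alpha_gt0 : 0 < alpha) (alpha_lt : alpha < 1 / 2)
    (Gam : 'I_d -> T -> R[i] -> R[i]) (Gam_afBm : afBm P alpha Gam)
    (Omega : set R[i]) (Omega_nbhs : nbhs0_closed_upper_half Omega)
    (Omega_bounded : bounded_set (Omega : set (R[i])^o))
    (gamma : R) (gamma_gt0 : 0 < gamma) (gamma_lt : gamma < alpha) :
  let n := Num.truncn (alpha^-1) in
  exists bGam : T -> tensors R d,
    (forall w t s (i : 'I_d), bGam w 1%N t s [tuple i] = Gam i w t - Gam i w s)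
    /\
    (forall p : R, 1 <= p ->
       cvg_Lp P n gamma Omega p
         (fun eps w => reg_functional eps (fun i => Gam i w))
         (fun w => (fun z => [ffun i => Gam i w z], bGam w)))
    /\
    {ae P, forall w,
       (forall k, (2 <= k <= n)%N ->
          in_C2mu (k%:R * gamma) Omega (bGam w k) /\
          in_C2m gamma Omega (bGam w k))
       /\
       (forall k (i : k.-tuple 'I_d) (t u s : R[i]), (1 <= k <= n)%N ->
          Omega t -> Omega u -> Omega s ->
          delta2 (bGam w k) t u s i =
          \sum_(1 <= j < k)
            word_coord (bGam w) t u (take j i) * word_coord (bGam w) u s (drop j i))
       /\
       (forall k m (i : k.-tuple 'I_d) (j : m.-tuple 'I_d) (t s : R[i]),
          (1 <= k)%N -> (1 <= m)%N -> (k + m <= n)%N ->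
          Omega t -> Omega s ->
          bGam w k t s i * bGam w m t s j =
          \sum_(sg : 'S_(k + m) | is_shuffle sg)
            bGam w (k + m)%N t s (permute_tuple sg (cat_tuple i j)))}.
Proof.
move=> n.
have [afG _] := Gam_afBm.
have /boolp.choice[X' HX'] : forall i : 'I_d, exists X' : T -> R[i] -> R[i],
    afBm_derivative P alpha X' /\ {ae P, forall w,
      (forall z, upper_half z -> seg_integrable (X' w) 0 z /\ Gam i w z = seg_int (X' w) 0 z) /\
      {within (closed_upper_half (R:=R) : set (R[i])^o),
         continuous (Gam i w : (R[i])^o -> (R[i])^o)}}.
  by move=> i; have [_ [X' afX aeX]] := afG i; exists X'.
have afX i := (HX' i).1; have aeX i := (HX' i).2.
have [Oc _] := Omega_nbhs.
have [zeroO pairO] := nbhs0_two_points Omega_nbhs.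
have [r0 r00 Or] := bounded_cmod Omega_bounded.
have n0 : (0 < n)%N.
  rewrite /n truncn_gt0 invf_ge1//; apply: ltW; apply: lt_trans alpha_lt _.
  by rewrite ltr_pdivrMr// mul1r ltr1n.
have alpha1 : alpha <= 1.
  by apply: ltW; apply: lt_trans alpha_lt _; rewrite ltr_pdivrMr// mul1r ltr1n.
(* An exponent strictly between: the gap to [alpha] pays for the supremum of the derivative process,
   the gap to [gamma] for the rate of convergence. *)
pose g := (gamma + alpha) / 2.
have gg : 0 < gamma < g by rewrite gamma_gt0 /g; lra.
have ga : g < alpha by rewrite /g; lra.
have g01 : 0 < g <= 1 by apply/andP; split; [case/andP: gg|]; lra.
exists (fun w => lim_tensors (fun i => X' i w) (fun i => Gam i w)); split.
  by move=> w t s i; rewrite /lim_tensors ffunE.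
split.
  move=> p p1.
  exact: (cvg_Lp_reg P_complete n0 gg zeroO pairO Or ga alpha1 afX aeX Oc r00 p1).
have A := ae_regular gg ga alpha1 afX aeX.
have B := lim_tensors_spaces n0 gg Or ga alpha1 afX aeX Oc r00.
apply: filterS2 A B => w rw sp; split; first exact: sp.
split=> [k i t u s /andP[k1 kn] tO uO sO|k m i j t s k1 m1 km tO sO].
  by apply: (lim_tensors_relation g01 rw) => //; exact: Oc.
by apply: (lim_tensors_shuffle g01 rw) => //; exact: Oc.
Qed.
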